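(* Let $p$ be a prime with $p\equiv1\pmod4$. Then $$U_{\frac{p-1}2}\equiv\left(1+2(-1)^{\frac{p-1}4}\right)h(-3p)\pmod p.$$
   Context: $[x]$ is the greatest integer not exceeding $x$. The sequence $\{U_n\}_{n\ge0}$ is defined by $U_0=1$ and $U_n=-2\sum_{k=1}^{[n/2]}\binom n{2k}U_{n-2k}$ for $n\ge1$; all $U_n$ are integers. $h(d)$ denotes the class number of the form class group consisting of (proper equivalence) classes of primitive, integral binary quadratic forms of discriminant $d$ (positive definite forms when $d<0$). *)

(* Defs.v *)
From HB Require Import structures.
From mathcomp Require Import all_boot all_order all_algebra.
From mathcomp Require Import finmap.
From mathcomp Require Import boolp classical_sets cardinality.

Set Implicit Arguments.
Unset Strict Implicit.
Unset Printing Implicit Defensive.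

Import Order.TTheory GRing.Theory Num.Theory.
Local Open Scope ring_scope.

Fixpoint U_upto (n : nat) : seq int :=
  if n is m.+1 then
    let s := U_upto m in
    rcons s (- 2 * \sum_(1 <= k < (n %/ 2).+1)
                     'C(n, 2 * k)%:Z * nth 0 s (n - 2 * k)%N)
  else [:: 1].

Definition U (n : nat) : int := nth 0 (U_upto n) n.

Lemma size_U_upto n : size (U_upto n) = n.+1.
Proof. by elim: n => //= n IHn; rewrite size_rcons IHn. Qed.

Lemma nth_U_upto m n : (m <= n)%N -> nth 0 (U_upto n) m = U m.
Proof.
elim: n => [|n IHn]; first by rewrite leqn0 => /eqP ->.
rewrite leq_eqVlt => /predU1P[-> //|le_mn].
by rewrite [U_upto n.+1]/= nth_rcons size_U_upto le_mn IHn.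
Qed.

Lemma U0 : U 0 = 1.
Proof. by []. Qed.

Lemma U_rec n : (0 < n)%N ->
  U n = - 2 * \sum_(1 <= k < (n %/ 2).+1) 'C(n, 2 * k)%:Z * U (n - 2 * k)%N.
Proof.
case: n => // n _.
rewrite {1}/U [U_upto n.+1]/= nth_rcons size_U_upto ltnn eqxx; congr (_ * _).
rewrite !big_nat; apply: eq_bigr => k /andP[k_gt0 _]; congr (_ * _).
have le_n : (n.+1 - 2 * k <= n)%N.
  by rewrite leq_subLR -add1n leq_add2r muln_gt0.
by rewrite nth_U_upto.
Qed.

(* BQForm a b c is the form a x^2 + b x y + c y^2. *)
Record bqform := BQForm { qa : int; qb : int; qc : int }.

Definition qeval (f : bqform) (x y : int) : int :=
  qa f * x ^+ 2 + qb f * x * y + qc f * y ^+ 2.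

Definition qdisc (f : bqform) : int := qb f ^+ 2 - 4 * qa f * qc f.

Definition primitive_form (f : bqform) : Prop :=
  gcdz (gcdz (qa f) (qb f)) (qc f) = 1.

Definition posdef_form (f : bqform) : Prop :=
  forall x y : int, (x, y) <> (0, 0) -> 0 < qeval f x y.

Definition properly_equivalent (f g : bqform) : Prop :=
  exists r s t u : int, r * u - s * t = 1 /\
    forall x y : int, qeval g x y = qeval f (r * x + s * y) (t * x + u * y).

Local Open Scope classical_set_scope.

Definition class_forms (d : int) : set bqform :=
  [set f | [/\ qdisc f = d, primitive_form f & d < 0 -> posdef_form f]].

Definition form_class (d : int) (f : bqform) : set bqform :=
  [set g | class_forms d g /\ properly_equivalent f g].

Definition form_classes (d : int) : set (set bqform) :=
  form_class d @` class_forms d.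

(* fset_set of an infinite set is empty, so this is the number of classes
   whenever there are finitely many of them, as for every d < 0. *)
Definition class_number (d : int) : nat := #|` fset_set (form_classes d)|%fset.

(* Main.v *)
(* With D = 3p and chi the quadratic character mod D attached to Q(sqrt(-3p)), put
   c(n) = r(n) - 4 r(n/4), where r(n) is the number of representations of n by the
   h = h(-3p) classes of forms, so that r(0) = h and r(n) = 2 sum_(m | n) chi(m).
   The weight 1 - 4 [v in 2Z^2] is minus the sum of the three nontrivial characters of
   (Z/2)^2, so the sums of (N - Q(v))_+^3 against it are alternating sums, which third
   differences bound by O(N^(5/2)); hence c is Abel summable to 0.  On the other hand
   sum c(n) q^n = -3h + 2 sum_m chi(m) (psi(q^m) + 2 psi(q^(2m))) with psi(z) = z/(1+z),
   and as m |-> psi(q^m) is convex this tends to -3h + 3 L(0, chi) when q -> 1.  So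
   h = L(0, chi) = - sum_(m < D) m chi(m) / D.

   Umbrally, V(x) = (x + U)^n satisfies V(x + 3) + V(x) = (x + 1)^n + (x + 2)^n; telescoping
   from 0 to 3p with n = (p-1)/2 and Euler's criterion give
   2 U_n = sum_(m < D) (-1)^(m+1) chi(m) mod p, which is (2 - 4 chi(2)) L(0, chi). *)

Require Import Defs.
From mathcomp Require Import all_boot all_order all_fingroup all_algebra all_solvable all_field.
From mathcomp Require Import zify ring lra.
From mathcomp Require Import finmap boolp classical_sets cardinality.

Set Implicit Arguments.
Unset Strict Implicit.
Unset Printing Implicit Defensive.

Import Order.TTheory GRing.Theory Num.Theory.
Local Open Scope ring_scope.

(** * Quadratic characters and Gauss sums *)

(** The usual road to the class number compares lattice points with the area of an ellipse and so
    meets pi and L(1, chi). A weight of mean zero on (Z/2)^2 cancels the area term, and the limit at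
    q = 1 is then the rational value L(0, chi); hence everything runs in [rat], with rational q and
    truncated sums, and no real number occurs. The exponent 3 is the least one that works here. With
    (N - Q)_+^k, k alternating summations by parts bound each of the O(N) terms by O(N^(k/2)), while
    the (k+1)-fold partial sums of the series 1 grow like N^k; one needs 1 + k/2 < k. The formula
    for r(n) is algebraic. A representation of n is e times a primitive one, and a primitive
    representation of a corresponds up to sign to a root of x^2 + x + (3p+1)/4 modulo a. Thus r/2 is
    the Dirichlet convolution of the indicator of squares with a root count; it is evaluated prime
    by prime, and quadratic reciprocity turns solvability modulo a prime into a value of chi. The
    factor 2 reflects that the only proper automorphs are 1 and -1, which uses p > 3. *)

Definition qchar (F : finFieldType) (x : F) : int :=
  if x == 0 then 0 else if x ^+ (#|F|.-1)./2 == 1 then 1 else -1.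

Section QuadraticCharacter.
Variable F : finFieldType.
Hypothesis F2 : (2%:R : F) != 0.
Hypothesis F_odd : odd #|F|.

Lemma neq_opp1_1 : (-1 : F) != 1.
Proof. by rewrite eq_sym -subr_eq0 opprK -(natrD _ 1 1). Qed.

Lemma card_half : #|F|.-1 = (#|F|.-1)./2.*2.
Proof.
have := finNzRing_gt1 F; have := odd_double_half #|F|.-1.
by move: F_odd; case: #|F| => //= n; case: (odd n) => //= _ {1}<-.
Qed.

Lemma expf_card1 (x : F) : x != 0 -> x ^+ #|F|.-1 = 1.
Proof.
move=> x0; apply: (mulfI x0); rewrite mulr1 -exprS prednK ?expf_card //.
exact: ltn_trans (finNzRing_gt1 F).
Qed.

Lemma intr_qchar (x : F) : (qchar x)%:~R = x ^+ (#|F|.-1)./2.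
Proof.
rewrite /qchar; have [->|x0] := eqVneq x 0.
  rewrite expr0n; case: eqP => // h; have := card_half; rewrite h => h1.
  by have := finNzRing_gt1 F; move: h1; case: #|F| => [|[]].
case: eqP => [->|/eqP nx1] //; apply/eqP; rewrite eq_sym.
have: (x ^+ (#|F|.-1)./2) ^+ 2 == 1 by rewrite -exprM muln2 -card_half expf_card1.
by rewrite sqrf_eq1 (negPf nx1).
Qed.

Lemma qcharP (x : F) : [\/ qchar x = 0, qchar x = 1 | qchar x = -1].
Proof. by rewrite /qchar; case: ifP => _; [constructor 1|case: ifP => _; [constructor 2|constructor 3]]. Qed.

Lemma qchar_eq0 (x : F) : (qchar x == 0) = (x == 0).
Proof. by rewrite /qchar; case: (x == 0) => //; case: ifP. Qed.

(** In odd characteristic 0, 1 and -1 stay distinct, so identities between integer symbols may be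
    checked in [F], where [qchar] is a power map. Multiplicativity and all later evaluations of
    symbols go this way. *)
Lemma intr_sign_inj (a b : int) :
  [\/ a = 0, a = 1 | a = -1] -> [\/ b = 0, b = 1 | b = -1] ->
  a%:~R = b%:~R :> F -> a = b.
Proof.
have h1 := neq_opp1_1; have h3 := oner_neq0 F.
have h2 : -1 != 0 :> F by rewrite oppr_eq0.
case=> -> [] -> //; rewrite ?mulrNz ?mulr1z ?mulr0z => /eqP h; exfalso; move: h;
by rewrite ?(negPf h1) ?(negPf h2) ?(negPf h3) // eq_sym ?(negPf h1) ?(negPf h2) ?(negPf h3).
Qed.

Lemma qcharM (x y : F) : qchar (x * y) = qchar x * qchar y.
Proof.
apply: intr_sign_inj; first exact: qcharP.
  by case: (qcharP x) (qcharP y) => -> [] ->; do ?[by constructor 1|by constructor 2|by constructor 3].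
by rewrite intrM !intr_qchar exprMn.
Qed.

Lemma qchar1 : qchar (1 : F) = 1.
Proof. by rewrite /qchar oner_eq0 expr1n eqxx. Qed.

Lemma qchar_sqr (x : F) : x != 0 -> qchar (x ^+ 2) = 1.
Proof.
by move=> x0; rewrite expr2 qcharM; move: x0; rewrite -qchar_eq0; case: (qcharP x) => ->.
Qed.

Lemma finField_generator : exists2 g : F, g != 0 &
  (forall x, x != 0 -> exists k, x = g ^+ k) /\ (forall k, g ^+ k = 1 -> (#|F|.-1 %| k)%N).
Proof.
have /cyclicP[g gP] := field_unit_group_cyclic [set: {unit F}]%G.
exists (val g); first by rewrite -unitfE (valP g).
split=> [x|k].
  rewrite -unitfE => Ux; have : (Sub x Ux : {unit F}) \in [set: {unit F}] by rewrite inE.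
  rewrite gP => /cycleP[k hk]; exists k; by rewrite -FinRing.val_unitX -hk.
move=> gk; rewrite -card_finField_unit /= gP; rewrite [X in (X %| _)%N](_ : _ = #[g]%g) //.
by rewrite order_dvdn -val_eqE FinRing.val_unitX gk.
Qed.

(** Write x = g^k for a generator g. Euler's criterion says that the order 2m of g divides km, so k
    is even. *)
Lemma qchar_eq1_sqr (x : F) : qchar x = 1 -> exists y, y ^+ 2 = x.
Proof.
have [g g0 [gen ord]] := finField_generator.
move=> hx; have x0 : x != 0 by rewrite -qchar_eq0 hx.
have [k xk] := gen _ x0; have := intr_qchar x; rewrite hx xk -exprM => /esym /ord.
rewrite {1}card_half -muln2 mulnC dvdn_pmul2r.
  by move=> /dvdnP[j ->]; exists (g ^+ j); rewrite -exprM.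
have := finNzRing_gt1 F; move: card_half; case: (_./2) => //.
by case: #|F| => [|[]].
Qed.

Lemma qchar_nonresidue : exists x : F, qchar x = -1.
Proof.
have [g g0 [gen ord]] := finField_generator; exists g.
case: (qcharP g) => // [/eqP|h]; first by rewrite qchar_eq0 (negPf g0).
have := intr_qchar g; rewrite h => /esym /ord; rewrite {1}card_half => /dvdn_leq.
have := finNzRing_gt1 F; move: card_half; case: (_./2) => //.
  by case: #|F| => [|[]].
by move=> n _ _ /(_ isT); lia.
Qed.

Lemma sum_qchar : \sum_(x : F) qchar x = 0.
Proof.
have [c hc] := qchar_nonresidue.
have c0 : c != 0 by rewrite -qchar_eq0 hc.
set S := \sum_x _; suff : S = - S by move: S => S; lia.
rewrite {1}/S (reindex_inj (mulfI c0)) /= -sumrN; apply: eq_bigr => x _.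
by rewrite qcharM hc mulN1r.
Qed.

End QuadraticCharacter.

(** * Gauss sums in a field with a primitive r-th root of unity *)

Section GaussSum.
Variable r : nat.
Hypothesis r_pr : prime r.
Hypothesis r_odd : odd r.

Lemma Fp_two_neq0 : (2%:R : 'F_r) != 0.
Proof.
rewrite -(dvdn_pcharf (pchar_Fp r_pr)) dvdn_prime2 //; apply/eqP => h.
by move: r_odd; rewrite h.
Qed.

Lemma Fp_odd_card : odd #|'F_r|.
Proof. by rewrite card_Fp. Qed.

Let qM := qcharM Fp_two_neq0 Fp_odd_card.

Variables (K : fieldType) (z : K).
Hypothesis z_prim : r.-primitive_root z.

Let e (x : 'F_r) : K := z ^+ x.

Lemma gauss_eD x y : e (x + y) = e x * e y.
Proof.
rewrite /e -exprD -(prim_expr_mod z_prim (x + y)%N); congr (z ^+ _).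
by rewrite /=; congr (_ %% _)%N; exact: Fp_cast.
Qed.

Lemma gauss_e_nat n : e n%:R = z ^+ n.
Proof. by rewrite /e val_Fp_nat // (prim_expr_mod z_prim). Qed.

Lemma gauss_sum_e c : \sum_(x : 'F_r) e (x * c) = if c == 0 then r%:R else 0.
Proof.
have [->|c0] := eqVneq c 0.
  rewrite (eq_bigr (fun=> 1)) => [|x _]; last by rewrite mulr0 /e expr0.
  by rewrite sumr_const card_Fp.
rewrite -(reindex_inj (mulIf c0) (P := xpredT) (F := e)) /=.
set S := \sum_x _; have : e 1 * S = S.
  rewrite mulr_sumr [RHS](reindex_inj (addrI 1)) /=.
  by apply: eq_bigr => x _; rewrite gauss_eD.
move=> h; apply/eqP; have /eqP : (e 1 - 1) * S = 0 by rewrite mulrBl h mul1r subrr.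
rewrite mulf_eq0 => /orP[|//]; rewrite subr_eq0 (gauss_e_nat 1).
by rewrite -(prim_order_dvd z_prim) dvdn1 => /eqP r1; move: r_pr; rewrite r1.
Qed.

Definition gauss_sum := \sum_(x : 'F_r) (qchar x)%:~R * e x.

(** Substituting y = xc turns the product of symbols into [qchar c], and orthogonality in x leaves
    only c = -1. The row x = 0 has to be added and subtracted; it contributes the sum of all
    symbols, which is 0. *)
Lemma gauss_sum_sqr : gauss_sum ^+ 2 = (qchar (-1 : 'F_r))%:~R * r%:R.
Proof.
have q0 : qchar (0 : 'F_r) = 0 by rewrite /qchar eqxx.
rewrite expr2 /gauss_sum big_distrlr /=.
transitivity (\sum_(x : 'F_r) \sum_(c : 'F_r) ((qchar x)^+2 * qchar c)%:~R * e (x * (1 + c))).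
  apply: eq_bigr => x _; have [->|x0] := eqVneq x 0.
    by rewrite !big1 // => y _; rewrite q0 ?mul0r ?mulr0z ?mul0r.
  rewrite (reindex_inj (mulfI x0)) /=; apply: eq_bigr => c _.
  by rewrite qM mulrDr mulr1 gauss_eD !intrM; ring.
transitivity (\sum_(x : 'F_r) \sum_(c : 'F_r) ((qchar c)%:~R * e (x * (1 + c)) - (x == 0)%:R * (qchar c)%:~R)).
  apply: eq_bigr => x _; apply: eq_bigr => c _; have [->|x0] := eqVneq x 0.
    rewrite q0 expr0n /= !mul0r /e expr0. by rewrite mulr1 mul1r subrr.
  have := qchar_sqr Fp_two_neq0 Fp_odd_card x0; rewrite expr2 qM -expr2 => ->.
  by rewrite mul1r mul0r subr0.
rewrite exchange_big /=.
transitivity (\sum_(c : 'F_r) (qchar c)%:~R * (if 1 + c == 0 then r%:R else 0) - \sum_(c : 'F_r) (qchar c)%:~R : K).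
  rewrite -sumrB; apply: eq_bigr => c _; rewrite sumrB -mulr_sumr gauss_sum_e; congr (_ - _).
  rewrite -mulr_suml (bigD1 0) //= big1 ?eqxx ?addr0 ?mul1r // => i /negPf -> //.
rewrite -rmorph_sum /= (sum_qchar Fp_two_neq0 Fp_odd_card) mulr0z subr0.
rewrite (bigD1 (-1)) //= subrr eqxx big1 ?addr0 // => c hc.
by rewrite addrC addr_eq0 (negPf hc) mulr0.
Qed.

(** In characteristic l the l-th power is a ring morphism that fixes the integer coefficients and
    sends z to z^l; reindexing by x -> lx brings out the symbol of l. *)
Lemma gauss_sum_frobenius l : prime l -> l \in [pchar K] -> odd l -> l != r ->
  gauss_sum ^+ l = (qchar (l%:R : 'F_r))%:~R * gauss_sum.
Proof.
move=> l_pr lK l_odd l_r.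
have l0 : (l%:R : 'F_r) != 0.
  by rewrite -(dvdn_pcharf (pchar_Fp r_pr)) dvdn_prime2 // eq_sym.
rewrite -(pFrobenius_autE lK) /gauss_sum rmorph_sum /= mulr_sumr.
rewrite [RHS](reindex_inj (mulfI l0)) /=; apply: eq_bigr => x _.
rewrite rmorphM /= rmorph_int mulrA -intrM qM mulrA -expr2.
have := qchar_sqr Fp_two_neq0 Fp_odd_card l0; rewrite expr2 qM -expr2 => ->.
rewrite mul1r; congr (_ * _); rewrite pFrobenius_autE -exprM mulnC.
by rewrite -gauss_e_nat natrM natr_Zp.
Qed.

End GaussSum.

Lemma prim_root_of_dvd_card (K : finFieldType) (r : nat) : prime r -> (r %| #|K|.-1)%N ->
  exists z : K, r.-primitive_root z.
Proof.
move=> r_pr /dvdnP[k hk]; have [g g0 [_ ord]] := finField_generator K.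
have z1 : (g ^+ k) ^+ r = 1 by rewrite -exprM -hk expf_card1.
have [m mz /(primeP r_pr).2 /orP[] /eqP em] := prim_order_exists (prime_gt0 r_pr) z1; last first.
  by exists (g ^+ k); rewrite -em.
have := prim_expr_order mz; rewrite em expr1 => /ord; have := finNzRing_gt1 K.
case: k hk {z1 mz} => [|k] hk; first by case: #|K| hk => [|[]].
by move=> _ /dvdn_leq; rewrite hk => /(_ isT); have := prime_gt1 r_pr; nia.
Qed.

(* Quadratic reciprocity in Euler's form, with [r* = (-1/r) r]. *)
Lemma gauss_reciprocity (r l : nat) : prime r -> odd r -> prime l -> odd l -> l != r ->
  (l%:Z %| ((qchar (-1 : 'F_r) * r%:Z) ^+ (l.-1)./2 - qchar (l%:R : 'F_r))%R)%Z.
Proof.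
move=> r_pr r_odd l_pr l_odd l_r.
have r1 : (0 < r.-1)%N by have := prime_gt1 r_pr; case: (r) => [|[]].
(* A field with l^(r-1) elements contains the r-th roots of unity, since r divides l^(r-1) - 1 by
   Fermat. *)
have [K lK cK] := pPrimePowerField l_pr r1.
have F2 := Fp_two_neq0 r_pr r_odd; have Fo := Fp_odd_card r_pr r_odd.
have [|z z_prim] := prim_root_of_dvd_card (K := K) r_pr.
  rewrite cK -subn1 (dvdn_pcharf (pchar_Fp r_pr)) natrB ?expn_gt0 ?prime_gt0 //.
  rewrite natrX subr_eq0 -[in r.-1](card_Fp r_pr) expf_card1 //.
  by rewrite -(dvdn_pcharf (pchar_Fp r_pr)) dvdn_prime2 // eq_sym.
rewrite (dvdz_pcharf lK) rmorphB rmorphXn rmorphM /= subr_eq0 -[_%:~R * _](gauss_sum_sqr r_pr r_odd z_prim).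
have l0 : l = (1 + (l.-1)./2 * 2)%N by have := prime_gt1 l_pr; lia.
have g0 : gauss_sum r z != 0.
  rewrite -sqrf_eq0 (gauss_sum_sqr r_pr r_odd z_prim) mulf_neq0 //.
    case: (qcharP (-1 : 'F_r)) => [/eqP|->|->]; rewrite ?oner_neq0 ?oppr_eq0 ?oner_neq0 //.
    by rewrite qchar_eq0 oppr_eq0 oner_eq0.
  by rewrite -(dvdn_pcharf lK) dvdn_prime2.
(* After multiplication by the nonzero Gauss sum g, the left side (g^2)^((l-1)/2) becomes g^l, which
   Frobenius evaluates. *)
rewrite -(inj_eq (mulfI g0)) -exprM -exprS mulrC; apply/eqP.
rewrite -(gauss_sum_frobenius r_pr r_odd z_prim l_pr lK) //; congr (_ ^+ _); lia.
Qed.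

(** For p = 1 mod 4, -3p is the product of the prime discriminants -3 and p, and this is its
    Kronecker symbol. In this form periodicity and parity are immediate; reciprocity is needed only
    to link it with -3p being a square modulo l. *)
Definition chi (p m : nat) : int := qchar (m%:R : 'F_3) * qchar (m%:R : 'F_p).

Section Chi.
Variable p : nat.
Hypothesis p_pr : prime p.
Hypothesis p4 : p = 1 %[mod 4].

Lemma p_gt4 : (4 < p)%N.
Proof. by have := prime_gt1 p_pr; lia. Qed.

Lemma p_odd : odd p. Proof. by have := p4; lia. Qed.

Let F2p := Fp_two_neq0 p_pr p_odd.
Let Fop := Fp_odd_card p_pr p_odd.
Let F23 := Fp_two_neq0 (isT : prime 3) isT.
Let Fo3 := Fp_odd_card (isT : prime 3) isT.

Lemma intr_qcharp m : (qchar (m%:R : 'F_p))%:~R = m%:R ^+ (p - 1)./2 :> 'F_p.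
Proof. by rewrite (intr_qchar Fop) card_Fp // subn1. Qed.

Lemma chiM m n : chi p (m * n) = chi p m * chi p n.
Proof. rewrite /chi !natrM (qcharM F2p Fop) (qcharM F23 Fo3); ring. Qed.

Lemma chi1 : chi p 1 = 1.
Proof. by rewrite /chi !qchar1. Qed.

Lemma disc3 : (3 * p)%:R = 0 :> 'F_3.
Proof. by rewrite natrM (pchar_Fp_0 (isT : prime 3)) mul0r. Qed.

Lemma discp : (3 * p)%:R = 0 :> 'F_p.
Proof. by rewrite natrM (pchar_Fp_0 p_pr) mulr0. Qed.

Lemma chi_periodic m : chi p (m + 3 * p) = chi p m.
Proof.
by rewrite /chi !(natrD _ m) disc3 discp !addr0.
Qed.

Lemma qcharp_m1 : qchar (-1 : 'F_p) = 1.
Proof.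
apply: (intr_sign_inj F2p (qcharP _)); first by constructor 2.
rewrite (intr_qchar Fop) card_Fp // -signr_odd (_ : odd _ = false) //.
by have := p4; lia.
Qed.

Lemma qchar3_m1 : qchar (-1 : 'F_3) = -1.
Proof. by rewrite /qchar card_Fp. Qed.

Lemma chi_opp m : (m <= 3 * p)%N -> chi p (3 * p - m) = - chi p m.
Proof.
move=> hm; rewrite /chi !(natrB _ hm) disc3 discp !sub0r.
rewrite -[- (m%:R : 'F_3)]mulN1r -[- (m%:R : 'F_p)]mulN1r (qcharM F2p Fop) (qcharM F23 Fo3).
rewrite qcharp_m1 qchar3_m1; ring.
Qed.

Lemma chiP m : [\/ chi p m = 0, chi p m = 1 | chi p m = -1].
Proof.
rewrite /chi; case: (qcharP (m%:R : 'F_3)) (qcharP (m%:R : 'F_p)) => -> [] ->;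
by do ?[by constructor 1|by constructor 2|by constructor 3].
Qed.

Lemma chi_eq0 m : (chi p m == 0) = (3 %| m)%N || (p %| m)%N.
Proof.
by rewrite /chi mulf_eq0 !qchar_eq0 -(dvdn_pcharf (pchar_Fp p_pr)) -(dvdn_pcharf (pchar_Fp (isT : prime 3))).
Qed.

(** With i^2 = -1 one has (1 + i)^2 = 2i, so 2 and i have the same symbol, and i^((p-1)/2) =
    (-1)^((p-1)/4). *)
Lemma qcharp_2 : qchar (2%:R : 'F_p) = (-1) ^+ ((p - 1) %/ 4).
Proof.
have [i i2] := qchar_eq1_sqr Fop qcharp_m1.
have i0 : 1 + i != 0.
  apply/eqP => h; have : i ^+ 2 = 1 by rewrite (_ : i = -1) ?sqrrN ?expr1n //; apply/eqP; rewrite -addr_eq0 addrC h.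
  by rewrite i2; apply/eqP/neq_opp1_1.
have e2 : (1 + i) ^+ 2 = 2%:R * i by rewrite sqrrD i2; ring.
have := qchar_sqr F2p Fop i0; rewrite e2 (qcharM F2p Fop).
suff -> : qchar i = (-1) ^+ ((p - 1) %/ 4).
  rewrite -signr_odd; move: (qchar _) => q; case: (odd _) => /=; rewrite ?expr0 ?expr1; lia.
apply: (intr_sign_inj F2p (qcharP _)).
  by rewrite -signr_odd; case: odd; [constructor 3|constructor 2].
rewrite (intr_qchar Fop) card_Fp // rmorphXn rmorphN1 -i2 -exprM.
by congr (_ ^+ _); have := p4; lia.
Qed.

Lemma chi_2 : chi p 2 = - (-1) ^+ ((p - 1) %/ 4).
Proof.
rewrite /chi qcharp_2 (_ : qchar _ = -1) ?mulN1r //.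
by rewrite /qchar card_Fp.
Qed.

(** Reciprocity for r = 3 and r = p, whose starred values are -3 and p, identifies the two factors
    of (-3p)^((l-1)/2) modulo l. *)
Lemma chi_prime_odd l : prime l -> odd l -> ~~ (l %| 3 * p)%N ->
  qchar ((- 3 * p%:Z)%:~R : 'F_l) = chi p l.
Proof.
move=> l_pr l_odd; rewrite Euclid_dvdM // !dvdn_prime2 // negb_or => /andP[l3 lp].
apply: (intr_sign_inj (Fp_two_neq0 l_pr l_odd) (qcharP _) (chiP _)).
rewrite (intr_qchar (Fp_odd_card l_pr l_odd)) card_Fp // rmorphM /= exprMn /chi intrM.
have h3 := gauss_reciprocity (isT : prime 3) isT l_pr l_odd l3.
have hp := gauss_reciprocity p_pr p_odd l_pr l_odd lp.
move: h3 hp; rewrite !(dvdz_pcharf (pchar_Fp l_pr)) !rmorphB !rmorphXn !rmorphM /= !subr_eq0.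
rewrite qchar3_m1 qcharp_m1 mul1r -rmorphM /= => /eqP <- /eqP <- //.
Qed.

(** The constant c for which x^2 + x + c has discriminant 1 - 4c = -3p; the division is exact since
    p = 1 mod 4. *)
Definition root_const := ((3 * p + 1) %/ 4)%N.

Lemma root_constE : (4 * root_const = 3 * p + 1)%N.
Proof. by rewrite /root_const; have := p4; lia. Qed.

(** For odd l complete the square: 4(x^2 + x + c) = (2x + 1)^2 + 3p. For l = 2, x^2 + x is always
    even, so a root exists exactly when c is even, that is p = 5 mod 8, which is the condition
    [chi p 2 = 1]. *)
Lemma chi_root l : prime l -> ~~ (l %| 3 * p)%N ->
  (exists x, l %| x * x + x + root_const)%N <-> chi p l = 1.
Proof.
move=> l_pr lD; have [l2|/negPf l_odd] := even_prime l_pr.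
  rewrite l2 chi_2; have c := root_constE; split => [[x]|].
    move=> hx; rewrite -signr_odd (_ : odd _) //.
    have : ~~ odd (x * x + x) by rewrite oddD oddM andbb addbb.
    by move: hx c; lia.
  by rewrite -signr_odd; case e: odd => // _; exists 0%N; move: e c; have := p4; lia.
have {}l_odd : odd l by case: odd l_odd.
have F2 := Fp_two_neq0 l_pr l_odd; have Fo := Fp_odd_card l_pr l_odd.
rewrite -chi_prime_odd //; have ePP (x : 'F_l) : 4%:R * (x * x + x + root_const%:R) = (2%:R * x + 1)^+2 + 3%:R * p%:R.
  have := congr1 (fun n => n%:R : 'F_l) root_constE; rewrite natrM natrD natrM => h.
  by rewrite mulrDr h; ring.
have d4 : (4%:R : 'F_l) != 0 by rewrite (natrM _ 2 2) mulf_neq0.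
have dE : (-3 * p%:Z)%:~R = - (3%:R * p%:R) :> 'F_l by rewrite rmorphM rmorphN /= mulNr.
split => [[x hx]|/(qchar_eq1_sqr Fo)[y hy]].
  move: hx; rewrite (dvdn_pcharf (pchar_Fp l_pr)) !natrD natrM => /eqP hx.
  have := ePP x%:R; rewrite hx mulr0 => /eqP; rewrite eq_sym addr_eq0 => /eqP e.
  rewrite dE -e qchar_sqr //; apply/eqP => e0; move: e; rewrite e0 expr0n => /eqP.
  by rewrite eq_sym oppr_eq0 -natrM -(dvdn_pcharf (pchar_Fp l_pr)) (negPf lD).
exists (val ((y - 1) / 2%:R)); rewrite (dvdn_pcharf (pchar_Fp l_pr)) !natrD natrM natr_Zp.
have := ePP ((y - 1) / 2%:R); rewrite [2%:R * (_ / _)]mulrC divfK // subrK hy dE addNr => /eqP.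
by rewrite mulf_eq0 (negPf d4).
Qed.

End Chi.

(** * Dirichlet convolution and roots of x^2 + x + c *)

Definition multiplicative_fun (f : nat -> int) :=
  forall a b, (0 < a)%N -> (0 < b)%N -> coprime a b -> f (a * b)%N = f a * f b.

Lemma gcdn_split a b d : coprime a b -> (d %| a * b)%N -> (gcdn d a * gcdn d b)%N = d.
Proof.
move=> cab dab; apply/eqP; rewrite eqn_dvd; apply/andP; split.
  rewrite Gauss_dvd ?dvdn_gcdl //.
  by apply: (coprime_dvdl (dvdn_gcdr d a)); apply: (coprime_dvdr (dvdn_gcdr d b)).
by rewrite muln_gcdr !muln_gcdl !dvdn_gcd dvdn_mulr // dvdn_mull // dvdn_mulr.
Qed.

Lemma gcdn_coprime_mul a b x y : coprime a b -> (x %| a)%N -> (y %| b)%N -> gcdn (x * y) a = x.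
Proof.
move=> cab xa yb; by rewrite gcdnC Gauss_gcdl ?(coprime_dvdr yb) // gcdnC; apply/gcdn_idPl.
Qed.

Lemma divisors_coprime_mul a b : (0 < a)%N -> (0 < b)%N -> coprime a b ->
  perm_eq (divisors (a * b)) [seq (x * y)%N | x <- divisors a, y <- divisors b].
Proof.
move=> a0 b0 cab; have ab0 : (0 < a * b)%N by rewrite muln_gt0 a0.
apply: uniq_perm; first exact: divisors_uniq.
  apply: allpairs_uniq; rewrite ?divisors_uniq // => -[x y] [x' y'] /allpairsP[[u v] /= [+ + [-> ->]]].
  rewrite -!dvdn_divisors // => xa yb /allpairsP[[u' v'] /= [+ + [-> ->]]].
  rewrite -!dvdn_divisors // => xa' yb' e.
  have e1 : u = u' by rewrite -(gcdn_coprime_mul cab xa yb) e (gcdn_coprime_mul cab).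
  congr (_, _) => //; move: e; rewrite -e1 => /eqP; rewrite eqn_pmul2l ?(dvdn_gt0 _ xa) //.
  by move/eqP.
move=> d; rewrite -dvdn_divisors //; apply/idP/allpairsP => [dab|[[x y] /= [+ + ->]]].
  exists (gcdn d a, gcdn d b); rewrite /= -!dvdn_divisors // !dvdn_gcdr; split => //.
  by rewrite gcdn_split.
by rewrite -!dvdn_divisors //; apply: dvdn_mul.
Qed.

Lemma divisors_pfactor l k : prime l ->
  perm_eq (divisors (l ^ k)) [seq (l ^ j)%N | j <- iota 0 k.+1].
Proof.
move=> l_pr; apply: uniq_perm; first exact: divisors_uniq.
  by rewrite map_inj_uniq ?iota_uniq //; apply: expnI; exact: prime_gt1.
move=> d; rewrite -dvdn_divisors ?expn_gt0 ?prime_gt0 //.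
apply/(dvdn_pfactor d k l_pr)/mapP => [[j jk ->]|[j + ->]].
  by exists j => //; rewrite mem_iota add0n ltnS.
by rewrite mem_iota add0n ltnS => /andP[_ jk]; exists j.
Qed.

Definition dirichlet (f g : nat -> int) (n : nat) : int :=
  \sum_(d <- divisors n) f d * g (n %/ d)%N.

Lemma dirichlet_mult f g : multiplicative_fun f -> multiplicative_fun g ->
  multiplicative_fun (dirichlet f g).
Proof.
move=> fM gM a b a0 b0 cab; rewrite /dirichlet (perm_big _ (divisors_coprime_mul a0 b0 cab)) /=.
rewrite big_allpairs_dep big_distrlr /=; apply: eq_big_seq => x; rewrite -dvdn_divisors // => xa.
apply: eq_big_seq => y; rewrite -dvdn_divisors // => yb.
have x0 := dvdn_gt0 a0 xa; have y0 := dvdn_gt0 b0 yb.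
have cxy : coprime x y by apply: coprime_dvdl xa _; apply: coprime_dvdr yb _.
rewrite fM // (_ : (a * b) %/ (x * y) = (a %/ x) * (b %/ y))%N ?gM.
- ring.
- by rewrite divn_gt0 // dvdn_leq.
- by rewrite divn_gt0 // dvdn_leq.
- apply: (coprime_dvdl (dvdn_div xa)); exact: (coprime_dvdr (dvdn_div yb)).
- by rewrite -{1}(divnK xa) -{1}(divnK yb) mulnACA mulnK // muln_gt0 x0.
Qed.

Lemma dirichlet_pfactor f g l k : prime l ->
  dirichlet f g (l ^ k) = \sum_(0 <= j < k.+1) f (l ^ j)%N * g (l ^ (k - j))%N.
Proof.
move=> l_pr; rewrite /dirichlet (perm_big _ (divisors_pfactor k l_pr)) big_map /index_iota subn0.
apply: eq_big_seq => j; rewrite mem_iota add0n ltnS => /andP[_ jk].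
by rewrite expnB ?prime_gt0.
Qed.

Lemma multiplicative_eq f g : multiplicative_fun f -> multiplicative_fun g ->
  (forall l k, prime l -> f (l ^ k)%N = g (l ^ k)%N) -> forall n, (0 < n)%N -> f n = g n.
Proof.
move=> fM gM fg; elim/ltn_ind => n IHn n0.
have [n1|n1] := leqP n 1.
  have -> : n = 1%N by lia.
  exact: (fg 2 0%N).
have l_pr := pdiv_prime n1; set l := pdiv n in l_pr.
have [m clm nE] := pfactor_coprime l_pr n0.
have ln : (0 < logn l n)%N by rewrite logn_gt0 mem_primes l_pr n0 pdiv_dvd.
have m0 : (0 < m)%N by move: n0; rewrite nE muln_gt0 => /andP[].
have lk1 : (1 < l ^ logn l n)%N by rewrite -[1%N](exp1n (logn l n)) ltn_exp2r ?prime_gt1.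
have lk0 : (0 < l ^ logn l n)%N by exact: ltnW.
have cml : coprime m (l ^ logn l n) by rewrite coprime_sym coprimeXl.
have mn : (m < n)%N by rewrite [X in (_ < X)%N]nE ltn_Pmulr.
by rewrite nE fM // gM // fg // IHn.
Qed.

Definition is_square (n : nat) : bool := [exists e : 'I_n.+1, (e * e == n)%N].

Lemma is_squareP n : reflect (exists e, n = e * e)%N (is_square n).
Proof.
apply: (iffP existsP) => [[e /eqP <-]|[e ->]]; first by exists e.
have h : (e < (e * e).+1)%N by case: e => // e; rewrite ltnS leq_pmulr.
by exists (Ordinal h).
Qed.

(** If ab = e^2, then e is the product of gcd(e, a) and gcd(e, b); their squares divide a and b
    respectively and have product ab, so both divisibilities are equalities. *)
Lemma is_square_mult : multiplicative_fun (fun n => (is_square n)%:Z).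
Proof.
move=> a b a0 b0 cab; suff -> : is_square (a * b) = is_square a && is_square b.
  by case: is_square; case: is_square.
apply/is_squareP/andP => [[e eE]|[/is_squareP[x ->] /is_squareP[y ->]]]; last first.
  by exists (x * y)%N; rewrite mulnACA.
have eab : (e %| a * b)%N by rewrite eE dvdn_mulr.
have e12 := gcdn_split cab eab.
set e1 := gcdn e a in e12; set e2 := gcdn e b in e12.
have e1a : (e1 %| a)%N := dvdn_gcdr e a; have e2b : (e2 %| b)%N := dvdn_gcdr e b.
have sq1 : (e1 * e1 %| a)%N.
  have h : (e1 * e1 %| a * b)%N by rewrite eE -e12 mulnACA dvdn_mulr.
  rewrite Gauss_dvdl in h => //; rewrite coprimeMl andbb; exact: coprime_dvdl e1a _.
have sq2 : (e2 * e2 %| b)%N.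
  have h : (e2 * e2 %| a * b)%N by rewrite eE -e12 mulnACA dvdn_mull.
  rewrite Gauss_dvdr in h => //; rewrite coprimeMl andbb; apply: coprime_dvdl e2b _.
  by rewrite coprime_sym.
have E : (a * b = (e1 * e1) * (e2 * e2))%N by rewrite eE -e12 mulnACA.
have l1 := dvdn_leq a0 sq1; have l2 := dvdn_leq b0 sq2.
have s1 := dvdn_gt0 a0 sq1; have s2 := dvdn_gt0 b0 sq2.
have ea : a = (e1 * e1)%N.
  by apply/eqP; rewrite eqn_leq l1 andbT -(leq_pmul2r s2) -E leq_pmul2l.
split; apply/is_squareP; [by exists e1|exists e2].
by apply/eqP; rewrite -(eqn_pmul2l s1) -E -ea.
Qed.

Lemma is_square_pfactor l k : prime l -> is_square (l ^ k) = ~~ odd k.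
Proof.
move=> l_pr; apply/is_squareP/idP => [[e eE]|ek]; last first.
  exists (l ^ k./2)%N; rewrite -expnD addnn; congr (_ ^ _)%N.
  by have := odd_double_half k; rewrite (negPf ek) add0n => ->.
have : (e %| l ^ k)%N by rewrite eE dvdn_mulr.
move=> /(dvdn_pfactor _ _ l_pr)[j _ ej]; move: eE; rewrite ej -expnD => /(expnI (prime_gt1 l_pr)) ->.
by rewrite addnn odd_double.
Qed.

Definition root_count (c a : nat) : nat := \sum_(x < a) (a %| x * x + x + c)%N.

Lemma dvdn_root_mod c a x y : x = y %[mod a] -> (a %| x * x + x + c)%N = (a %| y * y + y + c)%N.
Proof.
move=> h; rewrite /dvdn -(modnDml (x * x + x)) -(modnDml (y * y + y)).
by rewrite -(modnDm (x * x)) -(modnDm (y * y)) -(modnMm x x) -(modnMm y y) h.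
Qed.

Lemma root_count_mult c : multiplicative_fun (fun n => (root_count c n)%:Z).
Proof.
move=> a b a0 b0 cab; rewrite -PoszM; congr Posz; rewrite /root_count.
have ab0 : (0 < a * b)%N by rewrite muln_gt0 a0.
pose h (uv : 'I_a * 'I_b) : 'I_(a * b) := Ordinal (ltn_pmod (chinese a b uv.1 uv.2) ab0).
have h1 uv : h uv = uv.1 %[mod a].
  by rewrite /= modn_dvdm ?dvdn_mulr // chinese_modl.
have h2 uv : h uv = uv.2 %[mod b].
  by rewrite /= modn_dvdm ?dvdn_mull // chinese_modr.
have h_inj : injective h.
  move=> [u v] [u' v'] /(congr1 val) e; congr (_, _); apply: val_inj.
    by have := h1 (u, v); rewrite e h1 /= !modn_small.
  by have := h2 (u, v); rewrite e h2 /= !modn_small.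
have h_bij : bijective h by apply: inj_card_bij; rewrite // card_prod !card_ord.
rewrite (reindex h) /=; last exact: onW_bij.
rewrite big_distrlr /= pair_big /=; apply: eq_bigr => uv _.
rewrite Gauss_dvd // -(dvdn_root_mod c (esym (h1 uv))) -(dvdn_root_mod c (esym (h2 uv))).
by case: (a %| _)%N; case: (b %| _)%N.
Qed.

(** * Roots of x^2 + x + c modulo prime powers *)

Section RootCount.
Variable p : nat.
Hypothesis p_pr : prime p.
Hypothesis p4 : p = 1 %[mod 4].

Let c := root_const p.
Let cE : (4 * c = 3 * p + 1)%N := root_constE p_pr p4.

Lemma root_sq x : (4 * (x * x + x + c) = (2 * x + 1) * (2 * x + 1) + 3 * p)%N.
Proof. rewrite mulnDr cE; nia. Qed.

Lemma root_count1 : root_count c 1 = 1%N.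
Proof. by rewrite /root_count big_ord_recl big_ord0 dvd1n. Qed.

Lemma dvdn_disc_root l x : prime l -> odd l -> (l %| 3 * p)%N ->
  (l %| x * x + x + c)%N = (l %| 2 * x + 1)%N.
Proof.
move=> l_pr l_odd lD; rewrite -[RHS]orbb -(Euclid_dvdM _ _ l_pr).
rewrite -(dvdn_addl ((2 * x + 1) * (2 * x + 1)) lD) -root_sq Gauss_dvdr //.
by rewrite (_ : 4 = 2 ^ 2)%N // coprimeXr // coprimen2.
Qed.

Lemma root_count_ramified1 l : prime l -> odd l -> (l %| 3 * p)%N -> root_count c l = 1%N.
Proof.
(* For l dividing 3p the only root modulo l is the zero (l-1)/2 of 2x + 1. *)
move=> l_pr l_odd lD; have hl : (l./2 < l)%N by have := prime_gt0 l_pr; lia.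
rewrite /root_count (bigD1 (Ordinal hl)) //= big1 => [|i hi].
  by rewrite dvdn_disc_root // (_ : (2 * l./2 + 1 = l)%N) ?dvdnn //; lia.
rewrite dvdn_disc_root //; apply/eqP; rewrite eqb0; apply/negP => /dvdnP[k hk].
have hi' : val i <> l./2 by move=> e; move/eqP: hi; apply; apply: val_inj.
have := ltn_ord i; have : k = 1%N \/ k = 0%N \/ (1 < k)%N by lia.
by case=> [k1|[k0|k1]]; move: hk hi'; rewrite ?k1 ?k0 /=; nia.
Qed.

Lemma disc_sqfree l : prime l -> (l * l %| 3 * p)%N -> False.
Proof.
move=> l_pr hl; have p5 := p_gt4 p_pr p4.
have : (l %| 3 * p)%N by apply: dvdn_trans hl; rewrite dvdn_mulr.
rewrite Euclid_dvdM // dvdn_prime2 // [X in _ || X]dvdn_prime2 // => /orP[] /eqP e; move: hl; rewrite e.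
  by rewrite dvdn_pmul2l // dvdn_prime2 // => /eqP p3; move: p5; rewrite -p3.
by rewrite dvdn_pmul2r ?prime_gt0 // dvdn_prime2 // => /eqP p3; move: p5; rewrite p3.
Qed.

Lemma root_count_ramified2 l k : prime l -> odd l -> (l %| 3 * p)%N -> root_count c (l ^ k.+2) = 0%N.
Proof.
move=> l_pr l_odd lD; apply: big1 => x _; apply/eqP; rewrite eqb0; apply/negP => h.
have l2 : (l * l %| x * x + x + c)%N by apply: dvdn_trans h; rewrite !expnS mulnA dvdn_mulr.
have lx : (l %| 2 * x + 1)%N by rewrite -dvdn_disc_root //; apply: dvdn_trans l2; rewrite dvdn_mulr.
apply: (disc_sqfree l_pr).
by rewrite -(dvdn_addr _ (dvdn_mul lx lx)) -root_sq dvdn_mull.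
Qed.

Lemma root_count_inert l k : prime l -> ~~ (l %| 3 * p)%N -> chi p l = -1 ->
  root_count c (l ^ k.+1) = 0%N.
Proof.
move=> l_pr lD hl; apply: big1 => x _; apply/eqP; rewrite eqb0; apply/negP => h.
suff : chi p l = 1 by rewrite hl.
by apply/(chi_root p_pr p4 l_pr lD); exists x; apply: dvdn_trans h; rewrite expnS dvdn_mulr.
Qed.

Lemma unramified_root l x : prime l -> ~~ (l %| 3 * p)%N -> (l %| x * x + x + c)%N ->
  ~~ (l %| 2 * x + 1)%N.
Proof.
move=> l_pr lD lx; apply: contra lD => h.
by rewrite -(dvdn_addr _ (dvdn_mulr (2 * x + 1) h)) -root_sq dvdn_mull.
Qed.

(** Hensel lifting: the derivative 2x + 1 is a unit at a root modulo l, and t = -m/(2x+1) is the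
    Newton correction, where m is the value at x divided by l^(k+1). *)
Lemma hensel_root l k : prime l -> ~~ (l %| 3 * p)%N -> chi p l = 1 ->
  exists x, (l ^ k.+1 %| x * x + x + c)%N.
Proof.
move=> l_pr lD hl; elim: k => [|k [x hx]]; first by rewrite expn1; apply/(chi_root p_pr p4 l_pr lD).
have lx : (l %| x * x + x + c)%N by apply: dvdn_trans hx; rewrite expnS dvdn_mulr.
have u := unramified_root l_pr lD lx; have /dvdnP[m hm] := hx.
have u' : ((2 * x + 1)%:R : 'F_l) != 0 by rewrite -(dvdn_pcharf (pchar_Fp l_pr)).
pose t : nat := val (- (m%:R) / (2 * x + 1)%:R : 'F_l).
exists (x + t * l ^ k.+1)%N.
have -> : ((x + t * l ^ k.+1) * (x + t * l ^ k.+1) + (x + t * l ^ k.+1) + c =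
  l ^ k.+1 * (m + t * (2 * x + 1)) + l * l ^ k.+1 * (t * t * l ^ k))%N.
  rewrite [(_ * (m + _))%N]mulnDr [(l ^ _ * m)%N]mulnC -hm !expnS; ring.
rewrite [(l ^ k.+2)%N]expnS dvdn_addl; last exact: dvdn_mulr.
rewrite mulnC dvdn_pmul2l ?expn_gt0 ?prime_gt0 //.
by rewrite (dvdn_pcharf (pchar_Fp l_pr)) natrD natrM natr_Zp divfK // subrr.
Qed.

Lemma root_count_split l k : prime l -> ~~ (l %| 3 * p)%N -> chi p l = 1 ->
  root_count c (l ^ k.+1) = 2%N.
Proof.
move=> l_pr lD hl; have [x hx] := hensel_root k l_pr lD hl.
have a0 : (0 < l ^ k.+1)%N by rewrite expn_gt0 prime_gt0.
have la : (l %| l ^ k.+1)%N by rewrite expnS dvdn_mulr.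
have cop n : ~~ (l%:Z %| n)%Z -> coprimez (l ^ k.+1)%:Z n.
  by move=> h; rewrite coprimezE /= coprimeXl // prime_coprime.
move: (l ^ k.+1)%N a0 la cop hx => a a0 la cop hx.
have [y ya hy] : exists2 y, (y < a)%N & (a %| y * y + y + c)%N.
  by exists (x %% a)%N; rewrite ?ltn_pmod // (@dvdn_root_mod c a _ x) // modn_mod.
have z_lt : (a - 1 - y < a)%N by move: ya; clear; lia.
have u := unramified_root l_pr lD (dvdn_trans la hy).
(* The second root is the reflection a - 1 - y of y under x -> -1 - x. The prime l cannot divide
   both factors w - y and w + y + 1, as their difference 2y + 1 is a unit modulo l; so the full
   power a divides one of them. *)
have key w : (a%:Z %| (w%:Z - y%:Z) * (w%:Z + y%:Z + 1))%Z = (a %| w * w + w + c)%N.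
  have -> : (w%:Z - y%:Z) * (w%:Z + y%:Z + 1) = (w * w + w + c)%:Z - (y * y + y + c)%:Z.
    by rewrite !PoszD !PoszM; ring.
  by rewrite rpredBr.
have hz : (a %| (a - 1 - y) * (a - 1 - y) + (a - 1 - y) + c)%N.
  rewrite -key; apply: dvdz_mull; have -> : (a - 1 - y)%N%:Z + y%:Z + 1 = a%:Z by move: ya; clear; lia.
  exact: dvdzz.
have yz : Ordinal ya != Ordinal z_lt.
  apply/eqP => /(congr1 val) /= e; move: u.
  have -> : (2 * y + 1 = a)%N by move: e ya; clear; lia.
  by rewrite la.
rewrite /root_count (bigD1 (Ordinal ya)) //= (bigD1 (Ordinal z_lt)) 1?eq_sym //= hy hz.
rewrite big1 // => w /andP[w1 w2]; apply/eqP; rewrite eqb0 -key; apply/negP => hw.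
have nb : ~~ ((l%:Z %| (val w)%:Z - y%:Z) && (l%:Z %| (val w)%:Z + y%:Z + 1))%Z.
  apply: contra u => /andP[h1 h2]; have := rpredB h2 h1.
  by have -> : w%:Z + y%:Z + 1 - (w%:Z - y%:Z) = (2 * y + 1)%N%:Z by clear; lia.
have wa := ltn_ord w.
have w1' : nat_of_ord w <> y by move=> e; move/eqP: w1; apply; apply: val_inj.
have w2' : nat_of_ord w <> (a - 1 - y)%N by move=> e; move/eqP: w2; apply; apply: val_inj.
move: nb; rewrite negb_and => /orP[] /cop h.
  move: hw; rewrite Gauss_dvdzr // => /dvdzP[q hq].
  move: hq wa w2' (ya); move: (nat_of_ord w) => n; clear => hq na nz ya.
  have : q <= 0 \/ q = 1 \/ 2 <= q by lia.
  by case=> [q0|[q1|q2]]; [nia|move: hq; rewrite q1; lia|nia].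
move: hw; rewrite Gauss_dvdzl // => /dvdzP[q hq].
move: hq wa w1' (ya); move: (nat_of_ord w) => n; clear => hq na nz ya.
have : q <= -1 \/ q = 0 \/ 1 <= q by lia.
by case=> [q0|[q1|q2]]; [nia|move: hq; rewrite q1; lia|nia].
Qed.

(** One formula for the three cases: split primes give 2, inert ones 0, and ramified ones 1 or 0
    according to k = 0 or k > 0, thanks to 0^0 = 1. *)
Lemma root_count_pfactor l k : prime l ->
  (root_count c (l ^ k.+1))%:Z = chi p l ^+ k + chi p l ^+ k.+1.
Proof.
move=> l_pr; have [lD|lD] := boolP (l %| 3 * p)%N; last first.
  case: (chiP p l) => h.
  - move/eqP: h; rewrite chi_eq0 //; move: lD; rewrite Euclid_dvdM // !dvdn_prime2 // => /norP[].
    by rewrite eq_sym => /negPf -> ; rewrite eq_sym => /negPf ->.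
  - by rewrite h root_count_split // !expr1n.
  by rewrite h root_count_inert // exprS mulN1r subrr.
have h : chi p l = 0.
  apply/eqP; rewrite chi_eq0 //; move: lD; rewrite Euclid_dvdM // !dvdn_prime2 //.
  by rewrite ![l == _]eq_sym.
have l_odd : odd l.
  move: lD; rewrite Euclid_dvdM // !dvdn_prime2 // => /orP[] /eqP -> //; exact: p_odd.
rewrite h; case: k => [|k]; first by rewrite expn1 root_count_ramified1.
by rewrite root_count_ramified2 // !expr0n.
Qed.

Lemma chi_mult : multiplicative_fun (chi p).
Proof. by move=> a b _ _ _; exact: chiM. Qed.

Lemma chiX l k : chi p (l ^ k) = chi p l ^+ k.
Proof. by elim: k => [|k IHk]; rewrite ?expn0 ?chi1 // expnS chiM // IHk exprS. Qed.

Definition chi_sum (n : nat) : int := dirichlet (chi p) (fun=> 1) n.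

(** In terms of Euler factors, 1/(1 - x^2) times (1 + x)/(1 - chi(l) x) equals 1/((1 - x)(1 - chi(l)
    x)). *)
Lemma dirichlet_square_root_count n : (0 < n)%N ->
  dirichlet (fun d => (is_square d)%:Z) (fun a => (root_count c a)%:Z) n = chi_sum n.
Proof.
apply: multiplicative_eq.
- by apply: dirichlet_mult; [exact: is_square_mult|exact: root_count_mult].
- by apply: dirichlet_mult => //; exact: chi_mult.
move=> l k l_pr; rewrite /chi_sum !dirichlet_pfactor //.
under eq_bigr do rewrite is_square_pfactor //.
under [RHS]eq_bigr do rewrite mulr1 chiX.
rewrite [RHS]big_nat_rev /= add0n; under [RHS]eq_bigr do rewrite subSS.
elim/ltn_ind: k => -[|[|k]] IHk.
- by rewrite !big_nat1 /= expn0 root_count1.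
- by rewrite !big_nat_recl // !big_geq //= root_count_pfactor // expr0 expr1; ring.
(* The exponents 0 and 1 are split off the left side, the second one giving no square; passing from
   k to k + 2 adds chi^(k+1) + chi^(k+2) on both sides. *)
rewrite big_nat_recl // big_nat_recl // [RHS]big_nat_recl // [X in _ = _ + X]big_nat_recl //=.
rewrite mul0r add0r mul1r !subn0 root_count_pfactor // subn1 /=.
have := IHk k (leqnSn _).
under [in X in _ -> X]eq_bigr do rewrite negbK !subSS.
under [in X in _ -> _ = X]eq_bigr do rewrite !subSS.
by move=> ->; ring.
Qed.

End RootCount.

(** * Binary quadratic forms of discriminant -3p *)

Definition act (f : bqform) (r s t u : int) : bqform :=
  BQForm (qeval f r t) (2 * qa f * r * s + qb f * (r * u + s * t) + 2 * qc f * t * u)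
    (qeval f s u).

Lemma qeval_act f r s t u x y : qeval (act f r s t u) x y = qeval f (r * x + s * y) (t * x + u * y).
Proof. by case: f => a b c; rewrite /act /qeval /=; ring. Qed.

(** The values at (1, 0), (0, 1) and (1, 1) determine the coefficients. Equality of forms thus
    reduces to polynomial identities between values, which is how the laws of [act] are proved. *)
Lemma qform_ext f g : (forall x y, qeval g x y = qeval f x y) -> g = f.
Proof.
case: f g => [a b c] [a' b' c'] h; rewrite /qeval /= in h.
have := h 1 0; have := h 0 1; have := h 1 1.
rewrite !(expr0n, expr1n, mulr0, mulr1, mul0r, add0r, addr0) /= => h1 hc ha.
by congr BQForm; lia.
Qed.

Lemma properly_equivalentP f g : properly_equivalent f g <->
  exists r s t u : int, r * u - s * t = 1 /\ g = act f r s t u.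
Proof.
split=> [[r [s [t [u [D h]]]]]|[r [s [t [u [D ->]]]]]]; exists r, s, t, u; split=> //.
  by apply: qform_ext => x y; rewrite qeval_act h.
by move=> x y; rewrite qeval_act.
Qed.

Lemma act_act f r s t u r' s' t' u' :
  act (act f r s t u) r' s' t' u' =
  act f (r * r' + s * t') (r * s' + s * u') (t * r' + u * t') (t * s' + u * u').
Proof. by apply: qform_ext => x y; rewrite !qeval_act; congr qeval; ring. Qed.

Lemma act_id f : act f 1 0 0 1 = f.
Proof. by apply: qform_ext => x y; rewrite qeval_act; congr qeval; ring. Qed.

Lemma properly_equivalent_refl f : properly_equivalent f f.
Proof. by apply/properly_equivalentP; exists 1, 0, 0, 1; rewrite act_id. Qed.

Lemma properly_equivalent_sym f g : properly_equivalent f g -> properly_equivalent g f.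
Proof.
move=> /properly_equivalentP[r [s [t [u [D ->]]]]]; apply/properly_equivalentP.
exists u, (- s), (- t), r; split; first by rewrite -D; ring.
rewrite act_act -[LHS]act_id; congr act; rewrite -?D; ring.
Qed.

Lemma properly_equivalent_trans f g k :
  properly_equivalent f g -> properly_equivalent g k -> properly_equivalent f k.
Proof.
move=> /properly_equivalentP[r [s [t [u [D ->]]]]] /properly_equivalentP[r' [s' [t' [u' [D' ->]]]]].
apply/properly_equivalentP; rewrite act_act; do 4!eexists; split; last by [].
rewrite -[1](mulr1 1) -{1}D -D'; ring.
Qed.

Lemma qdisc_act f r s t u : r * u - s * t = 1 -> qdisc (act f r s t u) = qdisc f.
Proof.
move=> D; rewrite -[RHS]mulr1 -(expr1n _ 2) -D; case: f => a b c.
by rewrite /qdisc /act /qeval /=; ring.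
Qed.

Lemma qeval_square f x y : 4 * qa f * qeval f x y = (2 * qa f * x + qb f * y) ^+ 2 - qdisc f * y ^+ 2.
Proof. by rewrite /qeval /qdisc; ring. Qed.

Section Forms.
Variable p : nat.
Hypothesis p_pr : prime p.
Hypothesis p4 : p = 1 %[mod 4].

Let d : int := - 3 * p%:Z.

Definition disc_form (f : bqform) : Prop := qdisc f = d /\ 0 < qa f.

Let p_gt0 : (0 : int) < p%:Z. Proof. by rewrite ltz_nat prime_gt0. Qed.

Lemma disc_form_gt0 f (x y : int) : disc_form f -> (x, y) <> (0, 0) -> 0 < qeval f x y.
Proof.
move=> [fd a0] xy; have a4 : 0 < 4 * qa f by lia.
rewrite -(pmulr_rgt0 _ a4) qeval_square fd /d mulNr mulNr opprK.
have [y0|y0] := eqVneq y 0.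
  have x0 : x != 0 by apply/eqP => x0; apply: xy; rewrite x0 y0.
  have h : 0 < (2 * qa f * x) ^+ 2 by rewrite exprn_even_gt0 //= mulf_neq0 // mulf_neq0 // gt_eqF.
  by rewrite y0; move: h; rewrite /exprz; lia.
have h : 0 < y ^+ 2 by rewrite exprn_even_gt0.
rewrite ltr_wpDl ?sqr_ge0 //; move: p_gt0 h; lia.
Qed.

(** The square of a common divisor of the coefficients divides 3p, which is squarefree, so
    primitivity is automatic; definiteness follows from the sign of the leading coefficient by
    completing the square. *)
Lemma class_formsE f : class_forms d f <-> disc_form f.
Proof.
split=> [[fd _ pd]|[fd a0]].
  split=> //; have d0 : d < 0 by rewrite /d; lia.
  have := pd d0 1 0 => /(_ ltac:(by [])).
  by rewrite /qeval expr1n expr0n /= !(mulr0, mulr1, addr0).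
split=> // [|_ x y]; last exact: disc_form_gt0.
apply/eqP; case: eqP => // /eqP g1; exfalso.
set g := gcdz _ _ in g1.
have ga : (g %| qa f)%Z by apply: dvdz_trans (dvdz_gcdl _ _) (dvdz_gcdl _ _).
have gb : (g %| qb f)%Z by apply: dvdz_trans (dvdz_gcdl _ _) (dvdz_gcdr _ _).
have gc : (g %| qc f)%Z := dvdz_gcdr _ _.
have gd : (g * g %| d)%Z.
  rewrite -fd /qdisc expr2; apply: rpredB; first exact: dvdz_mul.
  by rewrite -mulrA; apply: dvdz_mull; exact: dvdz_mul.
have g1' : (1 < `|g|)%N.
  have g0 : (0 <= g) by [].
  have : g != 0 by apply: contraTN a0 => /eqP g0'; move: ga; rewrite g0' dvd0z => /eqP ->.
  by move: g1 g0; lia.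
apply: (disc_sqfree p_pr p4 (pdiv_prime g1')).
apply: dvdn_trans (dvdn_mul (pdiv_dvd _) (pdiv_dvd _)) _.
by move: gd; rewrite dvdzE /d !abszM.
Qed.

Lemma act_disc_form f r s t u : disc_form f -> r * u - s * t = 1 ->
  disc_form (act f r s t u).
Proof.
move=> hf D; have [fd _] := hf; split; first by rewrite qdisc_act.
apply: disc_form_gt0 => // -[r0 t0]; by move: D; rewrite r0 t0 mul0r mulr0 subrr.
Qed.

Lemma disc_form_equiv f g : disc_form f -> properly_equivalent f g -> disc_form g.
Proof. by move=> hf /properly_equivalentP[r [s [t [u [D ->]]]]]; exact: act_disc_form. Qed.

Lemma reduction f : disc_form f -> exists g, [/\ properly_equivalent f g, disc_form g,
  `|qb g| <= qa g & qa g <= qc g].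
Proof.
have [n] := ubnP `|qa f|%N; elim: n f => // n IHn f fn hf; have [fd a0] := hf.
have a2 : (0 < 2 * qa f) by lia.
(* Dividing b + a rather than b by 2a places the new middle coefficient m - a in [-a, a). *)
have [q [m [mE m0 m1]]] : exists q m, [/\ qb f + qa f = q * (2 * qa f) + m, 0 <= m & m < 2 * qa f].
  exists ((qb f + qa f) %/ (2 * qa f))%Z, ((qb f + qa f) %% (2 * qa f))%Z.
  by rewrite -divz_eq modz_ge0 ?ltz_pmod // gt_eqF.
pose g := act f 1 (- q) 0 1.
have D1 : 1 * 1 - - q * 0 = 1 :> int by ring.
have fg : properly_equivalent f g by apply/properly_equivalentP; exists 1, (- q), 0, 1.
have hg : disc_form g := disc_form_equiv hf fg.
have ga : qa g = qa f by rewrite /g /= /qeval; ring.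
have gb : qb g = m - qa f.
  have -> : m = qb f + qa f - q * (2 * qa f) by rewrite mE; ring.
  by rewrite /g /act /=; ring.
have gb' : `|qb g| <= qa g by rewrite ga gb; lia.
have [ac|ca] := lerP (qa g) (qc g); first by exists g.
have D2 : 0 * 0 - (-1) * 1 = 1 :> int by [].
pose k := act g 0 (-1) 1 0.
have gk : properly_equivalent g k by apply/properly_equivalentP; exists 0, (-1), 1, 0.
have hk := disc_form_equiv hg gk.
have ka : qa k = qc g by rewrite /k; move: (g) => [a b c]; rewrite /act /qeval /=; ring.
have [|k' [kk' hk' b' c']] := IHn k _ hk.
  by have [_ ] := hk; rewrite ka; move: ca fn; rewrite ga; lia.
by exists k'; split=> //; apply: properly_equivalent_trans kk'; apply: properly_equivalent_trans gk.
Qed.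

(** From b^2 <= a^2 <= ac one gets 3ac <= 4ac - b^2 = 3p, so a and c are at most p; the bound 3p is
    a convenient common box. *)
Lemma reduced_bound g : disc_form g -> `|qb g| <= qa g -> qa g <= qc g ->
  [/\ `|qa g| <= (3 * p)%N%:Z, `|qb g| <= (3 * p)%N%:Z & `|qc g| <= (3 * p)%N%:Z].
Proof.
case: g => a b c [/=]; rewrite /qdisc /d /= => e a0 ba ac.
have b2 : b ^+ 2 <= a * c by nia.
have : 3 * (a * c) <= 3 * p%:Z by nia.
move=> h; have h' : c <= p%:Z by nia.
by split; lia.
Qed.

(** Every class contains a reduced form, and these lie in a finite box. Finiteness is what allows
    membership in [fset_set] to be read as being a class. *)
Lemma finite_form_classes : finite_set (form_classes d).
Proof.
pose M := (3 * p)%N.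
pose G (x : 'I_(2 * M).+1 * 'I_(2 * M).+1 * 'I_(2 * M).+1) :=
  form_class d (BQForm (x.1.1%:Z - M%:Z) (x.1.2%:Z - M%:Z) (x.2%:Z - M%:Z)).
apply: (@sub_finite_set _ _ (G @` setT)%classic); last by apply: finite_image; exact: finite_finset.
move=> C [f /class_formsE hf <-].
have [g [fg hg gb gc]] := reduction hf.
have [h1 h2 h3] := reduced_bound hg gb gc.
have ex (x : int) : `|x| <= M%:Z -> exists i : 'I_(2 * M).+1, i%:Z - M%:Z = x.
  move=> hx; have hi : (absz (x + M%:Z)%R < (2 * M).+1)%N by lia.
  by exists (Ordinal hi) => /=; lia.
have [i hi] := ex _ h1; have [j hj] := ex _ h2; have [k hk] := ex _ h3.
exists (i, j, k) => //; rewrite /G /= hi hj hk.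
have -> : BQForm (qa g) (qb g) (qc g) = g by case: (g).
apply/seteqP; split=> x /= [hx ex']; split=> //.
  exact: properly_equivalent_trans fg ex'.
exact: properly_equivalent_trans (properly_equivalent_sym fg) ex'.
Qed.

Lemma class_representatives : exists F : 'I_(class_number d) -> bqform,
  [/\ forall i, disc_form (F i),
      forall g, disc_form g -> exists i, properly_equivalent (F i) g &
      forall i j, properly_equivalent (F i) (F j) -> i = j].
Proof.
rewrite /class_number; set S := fset_set _.
have inS C : C \in S <-> form_classes d C.
  by rewrite in_fset_set; [rewrite inE|exact: finite_form_classes].
have h (i : 'I_#|` S|) : exists f, class_forms d f /\ form_class d f = nth set0 S i.
  have : nth set0 S i \in S by apply: mem_nth; exact: ltn_ord.
  by move/inS => [f hf <-]; exists f.
have [F hF] := choice h; exists F; split=> [i|g hg|i j hij].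
- by apply/class_formsE; have [] := hF i.
- have : form_class d g \in S by apply/inS; exists g => //; apply/class_formsE.
  move=> gS; have iS : (index (form_class d g) S < #|` S|)%N by rewrite index_mem.
  exists (Ordinal iS); have [_ e] := hF (Ordinal iS); rewrite nth_index // in e.
  have : form_class d (F (Ordinal iS)) g.
    by rewrite e; split; [apply/class_formsE|exact: properly_equivalent_refl].
  by case.
have [_ ei] := hF i; have [_ ej] := hF j; apply: val_inj; apply/eqP.
rewrite -(nth_uniq set0 (ltn_ord i) (ltn_ord j) (fset_uniq S)) -ei -ej; apply/eqP.
apply/seteqP; split=> x /= [hx ex']; split=> //.
  exact: properly_equivalent_trans (properly_equivalent_sym hij) ex'.
exact: properly_equivalent_trans hij ex'.
Qed.

(** Invariance, written as F M = M^(-T) F for the Gram matrix F, is linear in M and gives (r - u)a =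
    -bt and as = -ct. Hence a^2 ((r + u)^2 - 4) = -3p t^2, and t <> 0 would force a trace of
    absolute value at most 1. Only the first column is needed, since it carries the represented
    vector. *)
Lemma automorph_trivial f (r s t u : int) : disc_form f -> r * u - s * t = 1 ->
  act f r s t u = f -> (r = 1 /\ t = 0) \/ (r = -1 /\ t = 0).
Proof.
move=> [fd a0] D e; move: fd a0 e; case: f => a b c; rewrite /qdisc /act /d /qeval /= => fd a0 [e1 e2 e3].
have h1 : (r - u) * a + b * t = 0.
  have : 2 * ((r - u) * a + b * t) = 0.
    have -> : 2 * ((r - u) * a + b * t) = 2 * u * (a * r ^+ 2 + b * r * t + c * t ^+ 2) -
      t * (2 * a * r * s + b * (r * u + s * t) + 2 * c * t * u) - (2 * a * u - t * b)
      + (2 * a * r + b * t) * (1 - (r * u - s * t)) by ring.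
    by rewrite e1 e2 D; ring.
  lia.
have h2 : a * s + c * t = 0.
  have : 2 * (a * s + c * t) = 0.
    have -> : 2 * (a * s + c * t) = u * (2 * a * r * s + b * (r * u + s * t) + 2 * c * t * u) -
      2 * t * (a * s ^+ 2 + b * s * u + c * u ^+ 2) - (u * b - 2 * t * c)
      + (2 * a * s + b * u) * (1 - (r * u - s * t)) by ring.
    by rewrite e2 e3 D; ring.
  lia.
have key : a ^+ 2 * ((r + u) ^+ 2 - 4) = (- 3 * p%:Z) * t ^+ 2.
  rewrite -fd.
  have -> : a ^+ 2 * ((r + u) ^+ 2 - 4) = ((r - u) * a) ^+ 2 + 4 * a ^+ 2 * (r * u - s * t - 1) + 4 * a * (a * s) * t by ring.
  have -> : (r - u) * a = - (b * t) by lia.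
  have -> : a * s = - (c * t) by lia.
  by rewrite D; ring.
have [t0|t0] := eqVneq t 0.
  have au : r = u.
    by move: h1; rewrite t0 mulr0 addr0 => /eqP; rewrite mulf_eq0 (gt_eqF a0) orbF subr_eq0 => /eqP.
  have : r ^+ 2 == 1 by move: D; rewrite t0 -au mulr0 subr0 -expr2 => ->.
  by rewrite sqrf_eq1 => /orP[] /eqP ->; [left|right].
have t2 : 0 < t ^+ 2 by rewrite lt_neqAle sqr_ge0 eq_sym expf_eq0 t0.
have a2 : 0 < a ^+ 2 by rewrite exprn_gt0.
have tr : (r + u) ^+ 2 < 4.
  have pt : 0 < p%:Z * t ^+ 2 := mulr_gt0 p_gt0 t2.
  by rewrite -subr_lt0 -(pmulr_rlt0 _ a2) key; move: pt; clear; lia.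
(* The [p]-adic valuations of the two sides have different parities. *)
have vp (k : nat) : coprime p k -> (0 < k)%N -> k%:Z * a ^+ 2 = 3 * p%:Z * t ^+ 2 -> False.
  move=> pk k0 /(congr1 absz); rewrite !abszM !absz_nat => /(congr1 (logn p)).
  have ta : (0 < `|a|)%N by rewrite absz_gt0 gt_eqF.
  have tt : (0 < `|t|)%N by rewrite absz_gt0.
  have p3 : coprime p 3 by rewrite prime_coprime // dvdn_prime2 //; have := p_gt4 p_pr p4; lia.
  rewrite !lognM ?muln_gt0 ?ta ?tt ?(prime_gt0 p_pr) //.
  by rewrite (logn_coprime pk) (logn_coprime p3) (logn_prime p p_pr) eqxx; lia.
(* The two values correspond to automorphs of order 4 and of order 3 or 6, and lead to 4 a^2 = 3p
   t^2 and 3 a^2 = 3p t^2. *)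
have tr' : (r + u) ^+ 2 = 0 \/ (r + u) ^+ 2 = 1.
  move: (r + u) tr => w; rewrite expr2; clear => tr.
  have : w = 0 \/ w = 1 \/ w = -1 by nia.
  by case=> [->|[->|->]]; [left|right|right].
have p5 := p_gt4 p_pr p4; exfalso; case: tr' => e; rewrite e in key.
  apply: (vp 4%N) => //; last by move: key; lia.
  by rewrite (_ : 4 = 2 ^ 2)%N // coprimeXr // coprimen2 p_odd.
by apply: (vp 3%N) => //; [rewrite prime_coprime // dvdn_prime2 //; lia|move: key; lia].
Qed.

End Forms.

(** * Representation numbers *)

Definition centered (B : nat) (i : nat) : int := i%:Z - B%:Z.

Definition representations (f : bqform) (B n : nat) : nat :=
  \sum_(i < (2 * B).+1) \sum_(j < (2 * B).+1) (qeval f (centered B i) (centered B j) == n%:Z).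

Definition fits (f : bqform) (N : int) (B : nat) : Prop :=
  forall x y : int, qeval f x y <= N -> (`|x| <= B%:Z) /\ (`|y| <= B%:Z).

Lemma centered_surj B (x : int) : `|x| <= B%:Z -> exists i : 'I_(2 * B).+1, centered B i = x.
Proof.
move=> hx; have hi : (absz (x + B%:Z)%R < (2 * B).+1)%N by lia.
by exists (Ordinal hi); rewrite /centered /=; lia.
Qed.

Lemma centered_inj B (i j : 'I_(2 * B).+1) : centered B i = centered B j -> i = j.
Proof. by move=> h; apply: val_inj => /=; rewrite /centered in h; lia. Qed.

Lemma centered_rev B (i : 'I_(2 * B).+1) : centered B (rev_ord i) = - centered B i.
Proof. by rewrite /centered /=; have := ltn_ord i; lia. Qed.

Lemma sum_bool_pair (T : finType) (P : pred T) (t0 t1 : T) : t0 != t1 ->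
  (forall t, P t <-> t = t0 \/ t = t1) -> (\sum_t P t = 2)%N.
Proof.
move=> h hP; rewrite (bigD1 t0) //= (bigD1 t1) 1?eq_sym //= big1 => [|t /andP[h1 h2]].
  have -> : P t0 by apply/hP; left.
  by have -> : P t1 by apply/hP; right.
apply/eqP; rewrite eqb0; apply/negP => /hP[] e; by rewrite e eqxx in h1 h2.
Qed.

Lemma qa_shift g k : qa (act g 1 k 0 1) = qa g.
Proof. by case: g => a b c; rewrite /act /qeval /=; ring. Qed.

Lemma qb_shift g k : qb (act g 1 k 0 1) = qb g + 2 * qa g * k.
Proof. by case: g => a b c; rewrite /act /=; ring. Qed.

(** * Representations by the classes, counted through roots modulo n/e^2 *)

Section Count.
Variable p : nat.
Hypothesis p_pr : prime p.
Hypothesis p4 : p = 1 %[mod 4].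
Let c := root_const p.

Variables (h : nat) (F : 'I_h -> bqform).
Hypothesis F_red : forall i, disc_form p (F i).
Hypothesis F_sur : forall g, disc_form p g -> exists i, properly_equivalent (F i) g.
Hypothesis F_inj : forall i j, properly_equivalent (F i) (F j) -> i = j.

Variables (n B : nat).
Hypothesis n_gt0 : (0 < n)%N.
Hypothesis F_fits : forall i, fits (F i) n%:Z B.

Let I := 'I_(2 * B).+1.
Let T : finType := ('I_h * I * I)%type.
Let K : finType := ('I_n.+1 * 'I_n.+1)%type.

Let cx (t : T) : int := centered B t.1.2.
Let cy (t : T) : int := centered B t.2.

Let V (t : T) : bool := qeval (F t.1.1) (cx t) (cy t) == n%:Z.

Let P (k : K) : bool := [&& (0 < k.1)%N, (k.1 * k.1 %| n)%N,
  (k.2 < n %/ (k.1 * k.1))%N & (n %/ (k.1 * k.1) %| k.2 * k.2 + k.2 + c)%N].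

(** The discriminant is (2b+1)^2 - 4(b^2 + b + c) = 1 - 4c = -3p whenever a divides b^2 + b + c. *)
Let form_of (a b : nat) : bqform :=
  BQForm a%:Z (2 * b%:Z + 1) ((b * b + b + c) %/ a)%:Z.

(* A representation (i, x, y) of [n] is attached to (e, b) when (x, y) = e (r, t') and
   some completion of (r, t') to a matrix of SL2 takes [F i] to the form with leading
   coefficient n / e^2 and middle coefficient 2 b + 1. *)
Let rel (t : T) (k : K) : Prop := exists r s t' u : int,
  [/\ r * u - s * t' = 1, act (F t.1.1) r s t' u = form_of (n %/ (k.1 * k.1)) k.2,
      cx t = k.1%:Z * r & cy t = k.1%:Z * t'].

Lemma form_of_disc_form a b : (0 < a)%N -> (a %| b * b + b + c)%N -> disc_form p (form_of a b).
Proof.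
move=> a0 /dvdnP[q hq]; split=> //=; rewrite /qdisc /= hq mulnK //.
have h4 := root_sq p_pr p4 b; rewrite -/c hq in h4.
by rewrite expr2; move: h4; clear; nia.
Qed.

Lemma form_of_eq g a b : (0 < a)%N -> disc_form p g -> qa g = a%:Z -> qb g = 2 * b%:Z + 1 ->
  (a %| b * b + b + c)%N /\ g = form_of a b.
Proof.
case: g => A B' C a0 [/= + _] hA hB; rewrite /qdisc /= hA hB => hd.
have h4 := root_sq p_pr p4 b; rewrite -/c in h4.
have hC : a%:Z * C = (b * b + b + c)%N%:Z.
  by move: h4 hd; rewrite expr2; move: (b * b + b + c)%N => m; clear; nia.
have C0 : 0 <= C.
  have : 0 <= a%:Z * C by rewrite hC.
  by rewrite pmulr_rge0.
move: C C0 hC {hd} => [C|//] _ hC; have {}hC : (a * C = b * b + b + c)%N by move: hC; rewrite -PoszM => -[].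
by split; [rewrite -hC dvdn_mulr|rewrite /form_of -hC mulKn].
Qed.

Lemma rel_vec t k : P k -> rel t k -> V t.
Proof.
move=> /and4P[_ kn _ _] [r [s [t' [u [D e ex ey]]]]].
rewrite /V ex ey (_ : qeval _ _ _ = k.1%:Z ^+ 2 * qeval (F t.1.1) r t'); last by rewrite /qeval; ring.
have /= -> := congr1 qa e.
by rewrite expr2 -!PoszM mulnC divnK.
Qed.

Lemma rel_exists t : V t -> exists2 k, P k & rel t k.
Proof.
have [x ex] : exists x, cx t = x by eexists.
have [y ey] : exists y, cy t = y by eexists.
rewrite /V ex ey => /eqP hV.
have xy : (x, y) <> (0, 0).
  by move=> [x0 y0]; move: hV; rewrite x0 y0 /qeval expr0n /= !mulr0 !addr0; lia.
have [v [w vw]] := Bezoutz x y.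
have hg : gcdz x y = `|gcdz x y|%N by rewrite gez0_abs.
set e := `|gcdz x y|%N in hg.
have e0 : (0 < e)%N.
  rewrite lt0n; apply/eqP => e0; move: hg; rewrite e0 => /eqP; rewrite gcdz_eq0 => /andP[/eqP x0 /eqP y0].
  by apply: xy; rewrite x0 y0.
have /dvdzP[r hr] := dvdz_gcdl x y; have /dvdzP[t' ht] := dvdz_gcdr x y.
rewrite hg in hr ht vw.
have D : r * v - - w * t' = 1.
  have e0' : e%:Z != 0 by lia.
  by apply: (mulIf e0'); rewrite mul1r -{2}vw hr ht; ring.
pose f := F t.1.1; have fr : disc_form p f := F_red _.
have gr := act_disc_form p_pr p4 fr D.
set g := act f r (- w) t' v in gr.
have nE : n%:Z = e%:Z * e%:Z * qa g.
  by rewrite -hV hr ht /g /= /qeval; ring.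
have [gd ga0] := gr.
have [a aE] : exists a : nat, qa g = a%:Z by exists `|qa g|%N; rewrite gez0_abs // ltW.
have a0 : (0 < a)%N by rewrite aE in ga0.
have {}nE : n = (e * e * a)%N by move: nE; rewrite aE -!PoszM => -[].
(* The middle coefficient is odd because the discriminant is odd. *)
have [b0 bE] : exists b0, qb g = 2 * b0 + 1.
  exists (qb g %/ 2)%Z; have := divz_eq (qb g) 2.
  have := modz_ge0 (qb g) (isT : (2 : int) != 0); have := ltz_pmod (qb g) (isT : (0 < 2 :> int)).
  move: ((qb g %/ 2)%Z) ((qb g %% 2)%Z) => q m m2 m0 qE.
  have [m1|m1] : m = 0 \/ m = 1 by lia.
    by move: gd; rewrite /qdisc qE m1 addr0; move: p4; nia.
  by rewrite qE m1; ring.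
have a0' : a%:Z != 0 by lia.
have [b bb] : exists b : nat, (b0 %% a%:Z)%Z = b%:Z.
  by exists `|(b0 %% a%:Z)%Z|%N; rewrite gez0_abs // modz_ge0.
(* The completion of the first column is free up to adding k times that column to the second one;
   this shifts b by ka and is used to bring b into [0, a). *)
pose k := - (b0 %/ a%:Z)%Z.
have bE' : b0 = - k * a%:Z + b%:Z by rewrite {1}(divz_eq b0 a%:Z) bb opprK.
have ba : (b < a)%N by have := ltz_pmod b0 (a0 : 0 < a%:Z); rewrite bb.
have D1 : 1 * 1 - k * 0 = 1 :> int by rewrite mulr0 subr0 mulr1.
have g'r := act_disc_form p_pr p4 gr D1.
have [||ad gE] := form_of_eq a0 g'r (b := b).
- by rewrite qa_shift.
- by rewrite qb_shift aE bE bE'; ring.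
have en : (e < n.+1)%N by rewrite ltnS nE -mulnA leq_pmulr // muln_gt0 e0.
have bn : (b < n.+1)%N.
  rewrite ltnS (leq_trans (ltnW ba)) // nE leq_pmull // muln_gt0 e0 //.
have na : (n %/ (e * e) = a)%N by rewrite nE mulKn // muln_gt0 e0.
exists (Ordinal en, Ordinal bn); first by rewrite /P /= e0 na ba ad nE dvdn_mulr.
exists r, (r * k - w), t', (t' * k + v); rewrite /= na; split.
- by rewrite -D; ring.
- by rewrite -gE /g act_act -/f; congr act; ring.
- by rewrite ex hr mulrC.
- by rewrite ey ht mulrC.
Qed.

(** The number e is the gcd of the vector. Two completions of the same column differ by q = s'u -
    u's times that column, so the two values of b are congruent modulo a, and both lie in [0, a). *)
Lemma rel_unique t k k' : P k -> P k' -> rel t k -> rel t k' -> k = k'.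
Proof.
case: k k' => [e b] [e' b'] /and4P[/= e0 en ba _] /and4P[/= e0' en' ba' _].
move=> [r [s [t1 [u [/= D E ex ey]]]]] [r' [s' [t1' [u' [/= D' E' ex' ey']]]]].
have gcd_e (e1 : nat) (r1 s1 t2 u1 : int) : r1 * u1 - s1 * t2 = 1 ->
    cx t = e1%:Z * r1 -> cy t = e1%:Z * t2 -> gcdz (cx t) (cy t) = e1%:Z.
  move=> D1 -> ->; rewrite -mulz_gcdr; have -> : gcdz r1 t2 = 1; last by rewrite mulr1.
  by apply/eqP/coprimezP; exists (u1, - s1); rewrite /= -D1; ring.
have ee : e = e'.
  apply: val_inj; have := gcd_e _ _ _ _ _ D ex ey; rewrite (gcd_e _ _ _ _ _ D' ex' ey') => -[] //.
subst e'; have e0z : (val e)%:Z != 0 by rewrite eqz_nat -lt0n.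
have rr : r = r' by apply: (mulfI e0z); rewrite -ex -ex'.
have tt : t1 = t1' by apply: (mulfI e0z); rewrite -ey -ey'.
subst r' t1'; congr (_, _); apply: val_inj => /=.
have := congr1 qb E; have := congr1 qb E'; have := congr1 qa E.
set a := (n %/ _)%N in ba ba' *.
rewrite /= => hA hB' hB.
have : 2 * b'%:Z + 1 - (2 * b%:Z + 1) = 2 * a%:Z * (s' * u - u' * s).
  rewrite -hB -hB' -hA /qeval.
  move: (qa (F _)) (qb (F _)) (qc (F _)) => A B0 C.
  have es : s' = s + (s' * u - u' * s) * r.
    suff : s' - (s + (s' * u - u' * s) * r) = 0 by move/eqP; rewrite subr_eq0 => /eqP.
    have -> : s' - (s + (s' * u - u' * s) * r) =
      s' * (1 - (r * u - s * t1)) - s * (1 - (r * u' - s' * t1)) by ring.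
    by rewrite D D' !subrr !mulr0 subrr.
  have eu : u' = u + (s' * u - u' * s) * t1.
    suff : u' - (u + (s' * u - u' * s) * t1) = 0 by move/eqP; rewrite subr_eq0 => /eqP.
    have -> : u' - (u + (s' * u - u' * s) * t1) =
      u' * (1 - (r * u - s * t1)) - u * (1 - (r * u' - s' * t1)) by ring.
    by rewrite D D' !subrr !mulr0 subrr.
  move: (s' * u - u' * s) es eu => q -> ->; ring.
move: (s' * u - u' * s) => q hq; move: (nat_of_ord b) (nat_of_ord b') ba ba' hq => x x'.
clear; move=> xa xa' hq.
have : q <= -1 \/ q = 0 \/ 1 <= q by lia.
by case=> [q0|[q1|q2]]; [nia|move: hq; rewrite q1; lia|nia].
Qed.

(** Exactly one representative is equivalent to [form_of a b], and two matrices M, M' leading to it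
    differ by the automorph M^(-1) M' = 1 or -1 up to its second column. The fibre is therefore a
    vector and its opposite, indexed by [rev_ord]. *)
Lemma rel_fiber k : P k -> exists t0 t1, t0 != t1 /\ forall t, rel t k <-> t = t0 \/ t = t1.
Proof.
move=> Pk; have := Pk; rewrite /P; case: k Pk => [e b] /= Pk /and4P[e0 en ba ad].
set a := (n %/ _)%N in ba ad *; have a0 : (0 < a)%N by case: (a) ba.
have fr := form_of_disc_form a0 ad.
have [i /properly_equivalentP[r [s [t [u [D hE]]]]]] := F_sur fr.
have hn : qeval (F i) (e%:Z * r) (e%:Z * t) = n%:Z.
  rewrite (_ : qeval _ _ _ = e%:Z ^+ 2 * qeval (F i) r t); last by rewrite /qeval; ring.
  by have /= <- := congr1 qa hE; rewrite expr2 -!PoszM mulnC divnK.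
have [|hx hy] := F_fits (i := i) (x := e%:Z * r) (y := e%:Z * t); first by rewrite hn.
have [i1 h1] := centered_surj hx; have [i2 h2] := centered_surj hy.
exists (i, i1, i2), (i, rev_ord i1, rev_ord i2); split.
  apply/eqP => e12; have er := congr1 cx e12; have et := congr1 cy e12.
  rewrite /cx /cy /= !centered_rev h1 h2 in er et.
  have e0z : (nat_of_ord e)%:Z != 0 by rewrite eqz_nat -lt0n.
  have r0 : r = 0 by apply: (mulfI e0z); move: er; rewrite mulr0; clear; lia.
  have t0 : t = 0 by apply: (mulfI e0z); move: et; rewrite mulr0; clear; lia.
  by move: D; rewrite r0 t0 mul0r mulr0 subrr.
case=> [[j j1] j2]; split; last first.
  case=> [[-> -> ->]|[-> -> ->]].
    by exists r, s, t, u; rewrite /cx /cy /=.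
  exists (- r), (- s), (- t), (- u); rewrite /cx /cy /= !centered_rev h1 h2 !mulrN; split=> //.
    by rewrite -D; ring.
  rewrite -/a hE; apply: qform_ext => x y; rewrite !qeval_act /qeval; ring.
move=> [r' [s' [t' [u' [/= D' hE' ex ey]]]]]; rewrite /cx /cy /= -/a in hE' ex ey.
have ji : j = i.
  apply: F_inj; apply: (@properly_equivalent_trans _ (form_of a b)).
    by apply/properly_equivalentP; exists r', s', t', u'.
  by apply: properly_equivalent_sym; apply/properly_equivalentP; exists r, s, t, u.
subst j.
have hF : act (form_of a b) u (- s) (- t) r = F i.
  by rewrite hE act_act -[RHS]act_id; congr act; rewrite -?D; ring.
have D1 : (u * r' - s * t') * (r * u' - t * s') - (u * s' - s * u') * (r * t' - t * r') = 1.
  by rewrite -[RHS](mulr1 1) -{1}D -D'; ring.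
have aut : act (form_of a b) (u * r' - s * t') (u * s' - s * u') (r * t' - t * r') (r * u' - t * s') = form_of a b.
  by rewrite -{2}hE' -hF act_act; congr act; ring.
have e1 : r' = r * (u * r' - s * t') + s * (r * t' - t * r') by rewrite -[LHS]mulr1 -D; ring.
have e2 : t' = t * (u * r' - s * t') + u * (r * t' - t * r') by rewrite -[LHS]mulr1 -D; ring.
have [[k1 k2]|[k1 k2]] := automorph_trivial p_pr p4 fr D1 aut;
  rewrite k1 k2 !mulr0 !addr0 ?mulrN !mulr1 in e1 e2; [left|right];
  congr (_, _, _); apply: (@centered_inj B); by rewrite ?centered_rev ?ex ?ey ?h1 ?h2 ?e1 ?e2 ?mulrN.
Qed.

(** Double counting of [rel]: each representation has one key (e, b), each key two
    representations. *)
Lemma count_representations :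
  (\sum_(i < h) representations (F i) B n =
   2 * \sum_(e < n.+1 | (0 < e)%N && (e * e %| n)%N) root_count c (n %/ (e * e)))%N.
Proof.
transitivity (\sum_(t : T) V t)%N.
  rewrite /representations pair_big pair_big /=; apply: eq_bigr => -[[i j] l] _ //.
transitivity (\sum_(k : K | P k) 2)%N.
  transitivity (\sum_(t : T) \sum_(k : K | P k) `[< rel t k >])%N.
    apply: eq_bigr => t _; have [Vt|nVt] := boolP (V t); last first.
      rewrite big1 // => k Pk; apply/eqP; rewrite eqb0; apply: contra nVt => /asboolP.
      exact: rel_vec.
    have [k Pk tk] := rel_exists Vt; rewrite (bigD1 k) //= asboolT // big1 // => k' /andP[Pk' k'k].
    apply/eqP; rewrite eqb0; apply: contra k'k => /asboolP tk'.
    by apply/eqP; exact: rel_unique tk' tk.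
  rewrite exchange_big /=; apply: eq_bigr => k Pk.
  have [t0 [t1 [t01 ht]]] := rel_fiber Pk.
  by apply: (sum_bool_pair t01) => t; rewrite -ht; split=> [/asboolP|h0] //; apply/asboolP.
rewrite big_distrr /= [LHS]big_mkcond /= -(pair_bigA _ (fun e b => if P (e, b) then 2 else 0)%N) /=.
rewrite [RHS]big_mkcond /=; apply: eq_bigr => e _; rewrite /P /=.
case: (posnP e) => e0 /=; first by rewrite big1.
case en: (e * e %| n)%N => /=; last by rewrite big1.
set a := (n %/ (e * e))%N.
have an : (a <= n.+1)%N by apply: leq_trans (leqnSn n); exact: leq_div.
rewrite /root_count -(big_mkord xpredT (fun b => if (b < a)%N && (a %| b * b + b + c)%N then 2 else 0)%N).
rewrite (big_cat_nat (n := a)) //= [X in (_ + X)%N]big_nat_cond [X in (_ + X)%N]big1 => [|b]; last first.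
  by rewrite andbT => /andP[ab _]; rewrite ltnNge ab.
rewrite addn0 big_distrr /= -(big_mkord xpredT (fun b => 2 * (a %| b * b + b + c))%N).
rewrite !big_nat; apply: eq_bigr => b /andP[_ ->] /=.
by case: (a %| _)%N.
Qed.

Lemma sum_square_divisors (G : nat -> int) :
  \sum_(e < n.+1 | (0 < e)%N && (e * e %| n)%N) G (n %/ (e * e))%N =
  dirichlet (fun m => (is_square m)%:Z) G n.
Proof.
rewrite /dirichlet.
transitivity (\sum_(e < n.+1 | (0 < e)%N && (e * e %| n)%N) \sum_(m <- divisors n | m == (e * e)%N) G (n %/ m)%N).
  apply: eq_bigr => e /andP[e0 en].
  by rewrite -big_filter filter_pred1_uniq ?divisors_uniq ?big_seq1 // -dvdn_divisors.
rewrite (exchange_big_dep xpredT) //=; apply: eq_big_seq => m; rewrite -dvdn_divisors // => mn.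
have m0 := dvdn_gt0 n_gt0 mn.
have [sq|nsq] := boolP (is_square m); last first.
  rewrite mul0r big1 // => e /andP[_ /eqP me].
  by case/negP: nsq; apply/is_squareP; exists e.
have /is_squareP[e eE] := sq.
have e0 : (0 < e)%N by move: m0; rewrite eE muln_gt0 andbb.
have en : (e < n.+1)%N by rewrite ltnS (leq_trans _ (dvdn_leq n_gt0 mn)) // eE leq_pmulr.
rewrite mul1r (big_pred1 (Ordinal en)) // => e' /=.
apply/idP/eqP => [/andP[_ /eqP me]|->] /=; last by rewrite e0 -eE mn eqxx.
apply: val_inj => /=; move: me; rewrite eE => /eqP; by rewrite !mulnn eqn_sqr eq_sym => /eqP.
Qed.

Lemma sum_representations :
  ((\sum_(i < h) representations (F i) B n)%N)%:Z = 2 * chi_sum p n.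
Proof.
rewrite count_representations PoszM -(dirichlet_square_root_count p_pr p4) // -sum_square_divisors.
congr (_ * _); rewrite -[LHS]natz natr_sum; apply: eq_bigr => e _; exact: natz.
Qed.

End Count.

(** * Alternating lattice sums *)

Definition pos_part (k : int) : int := if 0 <= k then k else 0.

Lemma pos_part_ge0 k : 0 <= pos_part k.
Proof. by rewrite /pos_part; case: ifP. Qed.

Lemma pos_part_le k m : 0 <= m -> k <= m -> pos_part k <= m.
Proof. by rewrite /pos_part; case: ifP. Qed.

Lemma Posz_sum (I : finType) (F : I -> nat) : (\sum_i F i)%N%:Z = \sum_i (F i)%:Z.
Proof. exact: (big_morph Posz PoszD). Qed.

Section Alternating.

Lemma alternating_diff (u : nat -> int) L : u 0%N = 0 -> u L = 0 ->
  \sum_(i < L) (-1) ^+ i * (u i - u i.+1) = 2 * \sum_(i < L) (-1) ^+ i * u i.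
Proof.
move=> u0 uL.
have h : \sum_(i < L) (-1) ^+ i * u i.+1 = - \sum_(i < L) (-1) ^+ i * u i.
  have := big_ord_recl L (fun i : 'I_L.+1 => (-1) ^+ i * u i) (idx := 0) (op := +%R).
  rewrite big_ord_recr /= u0 uL !mulr0 addr0 add0r => ->.
  by rewrite -sumrN; apply: eq_bigr => i _; rewrite /bump /= add1n exprS; ring.
under eq_bigr do rewrite mulrBr.
rewrite sumrB h; ring.
Qed.

(** Three alternating summations by parts, each trading a factor 2 for one difference; the vanishing
    at both ends removes every boundary term. *)
Lemma alternating_bound (u : nat -> int) L M : u 0%N = 0 -> u 1%N = 0 -> u 2%N = 0 ->
  u L = 0 -> u L.+1 = 0 -> u L.+2 = 0 ->
  (forall i, `|u i - 3 * u i.+1 + 3 * u i.+2 - u i.+3| <= M) ->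
  `|8 * \sum_(i < L) (-1) ^+ i * u i| <= L%:Z * M.
Proof.
move=> u0 u1 u2 uL uL1 uL2 hM.
pose v i := u i - u i.+1; pose w i := v i - v i.+1.
have -> : 8 * \sum_(i < L) (-1) ^+ i * u i = \sum_(i < L) (-1) ^+ i * (w i - w i.+1).
  rewrite alternating_diff; try by rewrite /w /v ?u0 ?u1 ?u2 ?uL ?uL1 ?uL2 !subr0.
  rewrite /w alternating_diff; try by rewrite /v ?u0 ?u1 ?u2 ?uL ?uL1 ?uL2 !subr0.
  rewrite /v alternating_diff // !mulrA //.
apply: le_trans (ler_norm_sum _ _ _) _.
have -> : L%:Z * M = \sum_(i < L) M by rewrite sumr_const card_ord -mulr_natl natz.
apply: ler_sum => i _; rewrite normrM normrX normrN1 expr1n mul1r.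
apply: le_trans (hM i); rewrite le_eqVlt; apply/orP; left; apply/eqP; congr `|_|.
by rewrite /w /v; ring.
Qed.

End Alternating.

(** The numbers q0 + je - aj^2 are the values of N - Q at four consecutive points of a row. If all
    are positive, the third difference is a polynomial in which the cubic terms in q0 cancel,
    leaving O((as)^3). If none is, it vanishes. If the sign changes, every value is itself O(as),
    since the slope is. *)
Lemma cube_third_difference (a s q0 e : int) : 0 < a -> 0 < s ->
  (forall j : int, 0 <= j -> j <= 3 -> 0 < q0 + j * e - a * j ^+ 2 ->
    q0 + j * e - a * j ^+ 2 <= s ^+ 2 /\ `|e - 2 * a * j| <= 2 * a * s) ->
  `|pos_part q0 ^+ 3 - 3 * pos_part (q0 + e - a) ^+ 3
    + 3 * pos_part (q0 + 2 * e - 4 * a) ^+ 3 - pos_part (q0 + 3 * e - 9 * a) ^+ 3|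
  <= 8 * (33 * (a * s)) ^+ 3.
Proof.
move=> a0 s0 h.
have h0 := h 0 isT isT; have h1 := h 1 isT isT; have h2 := h 2 isT isT; have h3 := h 3 isT isT.
have {}h0 : 0 < q0 -> q0 <= s ^+ 2 /\ `|e| <= 2 * a * s.
  have e1 : q0 + 0 * e - a * 0 ^+ 2 = q0 by ring.
  have e2 : e - 2 * a * 0 = e by ring.
  by rewrite e1 e2 in h0.
have {}h1 : 0 < q0 + e - a -> `|e - 2 * a| <= 2 * a * s.
  have e1 : q0 + 1 * e - a * 1 ^+ 2 = q0 + e - a by ring.
  have e2 : e - 2 * a * 1 = e - 2 * a by ring.
  by rewrite e1 e2 in h1 => /h1[].
have {}h2 : 0 < q0 + 2 * e - 4 * a -> `|e - 4 * a| <= 2 * a * s.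
  move: h2; rewrite (_ : a * 2 ^+ 2 = 4 * a); last by ring.
  by rewrite (_ : 2 * a * 2 = 4 * a); [move=> h2 /h2[]|ring].
have {}h3 : 0 < q0 + 3 * e - 9 * a -> `|e - 6 * a| <= 2 * a * s.
  move: h3; rewrite (_ : a * 3 ^+ 2 = 9 * a); last by ring.
  by rewrite (_ : 2 * a * 3 = 6 * a); [move=> h3 /h3[]|ring].
have aA : a <= a * s by rewrite ler_peMr // ltW.
have [pall|] := boolP [&& 0 < q0, 0 < q0 + e - a, 0 < q0 + 2 * e - 4 * a & 0 < q0 + 3 * e - 9 * a].
  move: pall => /and4P[p0 p1 p2 p3].
  rewrite /pos_part (ltW p0) (ltW p1) (ltW p2) (ltW p3); have [qs es] := h0 p0; clear h h0 h1 h2 h3.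
  have -> : q0 ^+ 3 - 3 * (q0 + e - a) ^+ 3 + 3 * (q0 + 2 * e - 4 * a) ^+ 3 - (q0 + 3 * e - 9 * a) ^+ 3 =
    36 * (q0 * a * e) - 108 * (q0 * a * a) - 6 * (e * e * e) + 108 * (a * e * e) - 450 * (a * a * e) + 540 * (a * a * a) by ring.
  have n3 (x y z X Y Z : int) : `|x| <= X -> `|y| <= Y -> `|z| <= Z -> `|x * y * z| <= X * Y * Z.
    by move=> hx hy hz; rewrite !normrM !ler_pM // mulr_ge0.
  have qn : `|q0| <= s ^+ 2 by rewrite ger0_norm // ltW.
  have an : `|a| <= a by rewrite ger0_norm // ltW.
  have an' : `|a| <= a * s by rewrite ger0_norm // ltW.
  have a1 : 0 <= a - 1 by clear -a0; lia.
  have s1 : 0 <= s - 1 by clear -s0; lia.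
  have a0' := ltW a0; have s0' := ltW s0.
  have sa2 : 0 <= (a - 1) * (a ^+ 2 * s ^+ 3).
    by apply: mulr_ge0 => //; apply: mulr_ge0; apply: exprn_ge0.
  have sa3 : 0 <= (s - 1) * (a ^+ 2 * s ^+ 2) + (a - 1) * (a ^+ 2 * s ^+ 3).
    by apply: addr_ge0 => //; apply: mulr_ge0 => //; apply: mulr_ge0; apply: exprn_ge0.
  have b1 : `|q0 * a * e| <= 2 * (a * s) ^+ 3.
    apply: le_trans (n3 _ _ _ _ _ _ qn an es) _; rewrite -subr_ge0.
    by rewrite (_ : _ - _ = 2 * ((a - 1) * (a ^+ 2 * s ^+ 3))) ?mulr_ge0 //; ring.
  have b2 : `|q0 * a * a| <= (a * s) ^+ 3.
    apply: le_trans (n3 _ _ _ _ _ _ qn an an) _; rewrite -subr_ge0.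
    by rewrite (_ : _ - _ = (s - 1) * (a ^+ 2 * s ^+ 2) + (a - 1) * (a ^+ 2 * s ^+ 3)) //; ring.
  have b3 : `|e * e * e| <= 8 * (a * s) ^+ 3.
    by apply: le_trans (n3 _ _ _ _ _ _ es es es) _; rewrite le_eqVlt; apply/orP; left; apply/eqP; ring.
  have b4 : `|a * e * e| <= 4 * (a * s) ^+ 3.
    by apply: le_trans (n3 _ _ _ _ _ _ an' es es) _; rewrite le_eqVlt; apply/orP; left; apply/eqP; ring.
  have b5 : `|a * a * e| <= 2 * (a * s) ^+ 3.
    by apply: le_trans (n3 _ _ _ _ _ _ an' an' es) _; rewrite le_eqVlt; apply/orP; left; apply/eqP; ring.
  have b6 : `|a * a * a| <= (a * s) ^+ 3.
    by apply: le_trans (n3 _ _ _ _ _ _ an' an' an') _; rewrite le_eqVlt; apply/orP; left; apply/eqP; ring.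
  have A0 : 0 <= a * s by rewrite mulr_ge0 // ltW.
  have A3 : 0 <= (a * s) ^+ 3 by rewrite exprn_ge0.
  (* 2100 = 36*2 + 108 + 6*8 + 108*4 + 450*2 + 540 collects the six monomials, and 2100 <= 8 *
     7^3. *)
  apply: (@le_trans _ _ (2100 * (a * s) ^+ 3)); last first.
    apply: (@le_trans _ _ (8 * (7 * (a * s)) ^+ 3)); first by rewrite exprMn; move: A3; clear; lia.
    by rewrite ler_pM2l // lerXn2r ?nnegrE ?mulr_ge0 // ler_wpM2r.
  move: b1 b2 b3 b4 b5 b6 A3; move: (_ * a * e) (_ * a * a) (e * e * e) (a * e * e) (a * a * e) (a * a * a) ((a * s) ^+ 3).
  by clear; lia.
rewrite -!(mulrA 2 a s) in h0 h1 h2 h3.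
move: (a * s) aA h0 h1 h2 h3 => A aA h0 h1 h2 h3 npall.
have A0 : 0 <= A by apply: le_trans aA; exact: ltW.
have [none|some] := boolP [&& q0 <= 0, q0 + e - a <= 0, q0 + 2 * e - 4 * a <= 0 & q0 + 3 * e - 9 * a <= 0].
  move: none => /and4P[p0 p1 p2 p3].
  have pp k : k <= 0 -> pos_part k ^+ 3 = 0.
    by rewrite /pos_part => k0; case: ifP => // k0'; rewrite (_ : k = 0) ?expr0n //; apply/eqP; rewrite eq_le k0.
  by rewrite !pp // (_ : 0 - 3 * 0 + 3 * 0 - 0 = 0 :> int) // normr0 mulr_ge0 // exprn_ge0 // mulr_ge0.
have bnd : [/\ q0 <= 33 * A, q0 + e - a <= 33 * A, q0 + 2 * e - 4 * a <= 33 * A & q0 + 3 * e - 9 * a <= 33 * A].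
  (* The four values differ by at most 3 |e| + 9 a, and one of them is not positive. *)
  have eb : `|e| <= 8 * A.
    (* At a positive point j <= 3 one has |e - 2aj| <= 2A, so |e| <= 2A + 6a <= 8A; hence 33 = 3*8 +
       9. The factor 8 of the final bound is 1 + 3 + 3 + 1. *)
    move: some; rewrite !negb_and -!ltNge => /or4P[/h0[_]|/h1|/h2|/h3]; clear -a0 aA; lia.
  by move: npall; rewrite !negb_and -!leNgt => /or4P[] k0; split; clear -a0 aA eb k0; lia.
have B0 : 0 <= 33 * A by rewrite mulr_ge0.
have pb k : k <= 33 * A -> 0 <= pos_part k ^+ 3 <= (33 * A) ^+ 3.
  move=> hk; rewrite exprn_ge0 ?pos_part_ge0 //= lerXn2r ?nnegrE ?pos_part_ge0 //.
  exact: pos_part_le.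
have [/pb c0 /pb c1 /pb c2 /pb c3] := bnd.
move: c0 c1 c2 c3; move: (_ ^+ 3) (_ ^+ 3) (_ ^+ 3) (_ ^+ 3) (_ ^+ 3); clear; lia.
Qed.

(** For k >= 0 this is (k-1)k(k+1), six times a tetrahedral number; the linear correction makes
    weighted sums agree exactly with fourth iterated partial sums. *)
Definition cubic_weight (k : int) : int := pos_part k ^+ 3 - pos_part k.

(* This weight is minus the sum of the three nontrivial characters of (Z/2)^2, so its
   sums alternate in [a] or in [b]. *)
Definition even_weight (a b : nat) : int := 1 - 4 * (~~ odd a && ~~ odd b)%:Z.

Lemma even_weightE a b :
  even_weight a b = - ((-1) ^+ a + (-1) ^+ b + (-1) ^+ (a + b)).
Proof.
rewrite /even_weight -(signr_odd _ a) -(signr_odd _ b) -(signr_odd _ (a + b)) oddD.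
by case: (odd a); case: (odd b).
Qed.

Lemma even_weight_le a b : `|even_weight a b| <= 3.
Proof. by rewrite /even_weight; case: (_ && _). Qed.

(** * Weighted sums over lattice points and the coefficients of theta *)

Section LatticeSum.
Variable p : nat.
Hypothesis p_pr : prime p.
Hypothesis p4 : p = 1 %[mod 4].

(** From 4a f(x, y) = (2ax + by)^2 + 3p y^2 and 4a s^2 <= (2as)^2. The first bound controls the
    slope of f along a row, the second the size of the ellipse. *)
Lemma disc_form_axis (f : bqform) (x y s : int) : disc_form p f -> 0 <= s ->
  qeval f x y <= s ^+ 2 ->
  [/\ `|2 * qa f * x + qb f * y| <= 2 * qa f * s & `|y| <= 2 * qa f * s].
Proof.
move=> [fd a0] s0 fs.
have a1 : 1 <= qa f by clear -a0; lia.
have sq := qeval_square f x y; rewrite fd in sq.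
have p1 : 1 <= p%:Z by have := prime_gt0 p_pr; clear; lia.
have h1 : 4 * qa f * qeval f x y <= (2 * qa f * s) ^+ 2.
  apply: (@le_trans _ _ (4 * qa f * s ^+ 2)); first by rewrite ler_pM2l // mulr_gt0.
  rewrite (_ : (2 * qa f * s) ^+ 2 = 4 * qa f * s ^+ 2 * qa f); last by ring.
  by rewrite ler_peMr // !mulr_ge0 ?exprn_ge0 // ltW.
have as0 : 0 <= 2 * qa f * s by rewrite !mulr_ge0 // ltW.
have sqb (z : int) : z ^+ 2 <= (2 * qa f * s) ^+ 2 -> `|z| <= 2 * qa f * s.
  by rewrite -(real_normK (num_real z)) ler_sqr // nnegrE.
have y0 := sqr_ge0 y; have z0 := sqr_ge0 (2 * qa f * x + qb f * y).
have py : y ^+ 2 <= p%:Z * y ^+ 2 by rewrite ler_peMl.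
by split; apply: sqb; move: sq h1 y0 z0 py; rewrite !mulNr opprK -mulrA; clear; lia.
Qed.

Definition swap_form (f : bqform) := BQForm (qc f) (qb f) (qa f).

Lemma qeval_swap f x y : qeval (swap_form f) y x = qeval f x y.
Proof. by rewrite /qeval /=; ring. Qed.

Lemma swap_disc_form f : disc_form p f -> disc_form p (swap_form f).
Proof.
move=> hf; split; first by rewrite -hf.1 /qdisc /=; ring.
have h01 : (0 : int, 1 : int) <> (0, 0) by [].
by have /= := disc_form_gt0 p_pr p4 hf h01; rewrite /qeval /= expr0n expr1n /= !mulr0 mul0r !add0r mulr1.
Qed.

(** The margin 3 makes the summand vanish at the three indices at each end of a row, as three
    summations by parts require. *)
Definition fits3 (f : bqform) (N : int) (B : nat) : Prop :=
  forall x y : int, qeval f x y <= N -> (`|x| + 3 <= B%:Z) /\ (`|y| + 3 <= B%:Z).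

Lemma disc_form_ge0 f x y : disc_form p f -> 0 <= qeval f x y.
Proof.
move=> hf; have [->|x0] := eqVneq x 0; last first.
  by apply: ltW; apply: (disc_form_gt0 p_pr p4 hf) => -[/eqP]; rewrite (negPf x0).
have [->|y0] := eqVneq y 0; first by rewrite /qeval; lia.
by apply: ltW; apply: (disc_form_gt0 p_pr p4 hf) => -[/eqP]; rewrite (negPf y0).
Qed.

Lemma alternating_row_bound f (s N y : int) B : disc_form p f -> 0 < s -> N <= s ^+ 2 ->
  fits3 f N B ->
  `|8 * \sum_(i < (2 * B).+1) (-1) ^+ i * pos_part (N - qeval f (centered B i) y) ^+ 3|
  <= (2 * B).+1%:Z * (8 * (33 * (qa f * s)) ^+ 3).
Proof.
move=> hf s0 Ns hB.
have out (i : nat) : B%:Z < `|centered B i| + 3 -> pos_part (N - qeval f (centered B i) y) ^+ 3 = 0.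
  move=> hi; rewrite /pos_part subr_ge0; case: ifP => [/hB[h _]|_]; last by rewrite expr0n.
  by have := lt_le_trans hi h; rewrite ltxx.
apply: (@alternating_bound (fun i => pos_part (N - qeval f (centered B i) y) ^+ 3));
  try by apply: out; rewrite /centered; clear; lia.
move=> i; have [fd a0] := hf.
set q0 := N - qeval f (centered B i) y.
pose e := - (2 * qa f * centered B i + qb f * y).
have qE (k : nat) : N - qeval f (centered B (i + k)) y = q0 + k%:Z * e - qa f * k%:Z ^+ 2.
  have -> : centered B (i + k) = centered B i + k%:Z by rewrite /centered PoszD; ring.
  by rewrite /q0 /e /qeval; ring.
have := @cube_third_difference (qa f) s q0 e a0 s0.
have := qE 1%N; have := qE 2%N; have := qE 3%N; rewrite addn1 addn2 addn3 => -> -> ->.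
have -> : q0 + 1 * e - qa f * 1 ^+ 2 = q0 + e - qa f by ring.
have -> : q0 + 2 * e - qa f * 2 ^+ 2 = q0 + 2 * e - 4 * qa f by ring.
have -> : q0 + 3 * e - qa f * 3 ^+ 2 = q0 + 3 * e - 9 * qa f by ring.
apply=> j j0 j3 hj.
have jE : q0 + j * e - qa f * j ^+ 2 = N - qeval f (centered B i + j) y by rewrite /q0 /e /qeval; ring.
rewrite jE in hj *.
have f0 := disc_form_ge0 (centered B i + j) y hf.
have fs : qeval f (centered B i + j) y <= s ^+ 2 by move: hj f0 Ns; clear; lia.
split; first by move: f0 Ns; clear; lia.
have [h _] := disc_form_axis hf (ltW s0) fs; rewrite -normrN in h.
by rewrite (_ : e - 2 * qa f * j = - (2 * qa f * (centered B i + j) + qb f * y)) // /e; ring.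
Qed.

(** Of the three characters in [even_weight], two alternate along i and one along j, whence 16 and
    8; the form is swapped for the latter. The linear part of the weight is bounded trivially,
    giving 24 = 8 * 3. *)
Lemma lattice_sum_bound f (s N : int) B : disc_form p f -> 0 < s -> N <= s ^+ 2 ->
  fits3 f N B ->
  `|8 * \sum_(i < (2 * B).+1) \sum_(j < (2 * B).+1)
    even_weight i j * cubic_weight (N - qeval f (centered B i) (centered B j))|
  <= (2 * B).+1%:Z * (2 * B).+1%:Z *
     (16 * (33 * (qa f * s)) ^+ 3 + 8 * (33 * (qc f * s)) ^+ 3 + 24 * s ^+ 2).
Proof.
move=> hf s0 Ns hB; set L := (2 * B).+1.
pose u (i j : nat) := pos_part (N - qeval f (centered B i) (centered B j)).
have Lsum (M : int) : \sum_(i < L) M = L%:Z * M by rewrite sumr_const card_ord -mulr_natl natz.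
(* The sign (-1)^(w j) is constant along a row in i; [w] is false for (-1)^i and [odd] for
   (-1)^(i+j). *)
have rowb (w : nat -> bool) : `|8 * \sum_(i < L) \sum_(j < L) (-1) ^+ (w j) * (-1) ^+ i * u i j ^+ 3|
    <= L%:Z * (L%:Z * (8 * (33 * (qa f * s)) ^+ 3)).
  rewrite exchange_big mulr_sumr -Lsum; apply: le_trans (ler_norm_sum _ _ _) _; apply: ler_sum => j _.
  under eq_bigr do rewrite -mulrA.
  rewrite -mulr_sumr mulrCA normrM normrX normrN1 expr1n mul1r.
  exact: alternating_row_bound.
have colb : `|8 * \sum_(i < L) \sum_(j < L) (-1) ^+ j * u i j ^+ 3|
    <= L%:Z * (L%:Z * (8 * (33 * (qc f * s)) ^+ 3)).
  rewrite mulr_sumr -Lsum; apply: le_trans (ler_norm_sum _ _ _) _; apply: ler_sum => i _.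
  have hB' : fits3 (swap_form f) N B.
    by move=> x y; rewrite -[f in swap_form f]/f (qeval_swap f y x) => /hB[].
  have := @alternating_row_bound (swap_form f) s N (centered B i) B (swap_disc_form hf) s0 Ns hB'.
  by under eq_bigr do rewrite qeval_swap.
have linb : `|8 * \sum_(i < L) \sum_(j < L) even_weight i j * u i j| <= L%:Z * (L%:Z * (24 * s ^+ 2)).
  rewrite mulr_sumr -Lsum; apply: le_trans (ler_norm_sum _ _ _) _; apply: ler_sum => i _.
  rewrite mulr_sumr -Lsum; apply: le_trans (ler_norm_sum _ _ _) _; apply: ler_sum => j _.
  have : `|u i j| <= s ^+ 2.
    rewrite ger0_norm ?pos_part_ge0 // pos_part_le ?sqr_ge0 //.
    have := disc_form_ge0 (centered B i) (centered B j) hf; move: Ns; clear; lia.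
  move=> hu; rewrite !normrM mulrCA.
  have : `|even_weight i j| * `|u i j| <= 3 * s ^+ 2 by rewrite ler_pM // even_weight_le.
  by clear; lia.
have -> : 8 * \sum_(i < L) \sum_(j < L) even_weight i j * cubic_weight (N - qeval f (centered B i) (centered B j))
  = - (8 * \sum_(i < L) \sum_(j < L) (-1) ^+ false * (-1) ^+ i * u i j ^+ 3)
    - (8 * \sum_(i < L) \sum_(j < L) (-1) ^+ odd j * (-1) ^+ i * u i j ^+ 3)
    - (8 * \sum_(i < L) \sum_(j < L) (-1) ^+ j * u i j ^+ 3)
    - 8 * \sum_(i < L) \sum_(j < L) even_weight i j * u i j.
  rewrite -!mulrN -!mulrDr; congr (_ * _); rewrite -!sumrN -!big_split /=; apply: eq_bigr => i _.
  rewrite -!sumrN -!big_split /=; apply: eq_bigr => j _.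
  by rewrite /cubic_weight -/(u i j) mulrBr {1}even_weightE exprD signr_odd; ring.
have r1 := rowb (fun=> false); have r2 := rowb odd.
have n4 (x1 x2 x3 x4 X1 X2 X3 X4 : int) : `|x1| <= X1 -> `|x2| <= X2 -> `|x3| <= X3 -> `|x4| <= X4 ->
    `|- x1 - x2 - x3 - x4| <= X1 + X2 + X3 + X4 by clear; lia.
apply: le_trans (n4 _ _ _ _ _ _ _ _ r1 r2 colb linb) _.
by rewrite le_eqVlt; apply/orP; left; apply/eqP; ring.
Qed.

Lemma box_sum f (B X : nat) (G : int -> int) : disc_form p f ->
  (forall k : int, X%:Z < k -> G k = 0) ->
  \sum_(i < (2 * B).+1) \sum_(j < (2 * B).+1) G (qeval f (centered B i) (centered B j)) =
  \sum_(n < X.+1) (representations f B n)%:Z * G n%:Z.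
Proof.
move=> hf GX.
have one (k : int) : 0 <= k -> G k = \sum_(n < X.+1) (k == n%:Z)%:Z * G n%:Z.
  case: k => // k _; have [kX|kX] := ltnP k X.+1; last first.
    rewrite GX ?ltz_nat // big1 // => n _; rewrite eqz_nat (_ : (k == n) = false) ?mul0r //.
    by apply/negbTE; rewrite neq_ltn (leq_trans (ltn_ord n) kX) orbT.
  rewrite (bigD1 (Ordinal kX)) //= eqxx mul1r big1 ?addr0 // => n nk.
  by rewrite eqz_nat eq_sym (_ : (nat_of_ord n == k) = false) ?mul0r //; apply/negbTE.
transitivity (\sum_(i < (2 * B).+1) \sum_(n < X.+1) \sum_(j < (2 * B).+1)
    (qeval f (centered B i) (centered B j) == n%:Z)%:Z * G n%:Z).
  apply: eq_bigr => i _; rewrite exchange_big /=; apply: eq_bigr => j _.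
  by rewrite -one //; exact: disc_form_ge0.
rewrite exchange_big /=; apply: eq_bigr => n _.
rewrite /representations Posz_sum mulr_suml; apply: eq_bigr => i _.
by rewrite /= Posz_sum mulr_suml.
Qed.

Lemma representations0 f B : disc_form p f -> representations f B 0 = 1%N.
Proof.
move=> hf; have hB : (B < (2 * B).+1)%N by rewrite ltnS mul2n -addnn leq_addr.
have cB : centered B B = 0 by rewrite /centered subrr.
have z (i j : 'I_(2 * B).+1) : (qeval f (centered B i) (centered B j) == 0%N%:Z) = (i == Ordinal hB) && (j == Ordinal hB).
  apply/eqP/andP => [e|[/eqP -> /eqP ->]]; last by rewrite cB /qeval; lia.
  have [x0 y0] : centered B i = 0 /\ centered B j = 0.
    have [[-> ->] //|/eqP h] := eqVneq (centered B i, centered B j) (0, 0).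
    by have := disc_form_gt0 p_pr p4 hf h; rewrite e ltxx.
  by split; apply/eqP; apply: (@centered_inj B); rewrite /= cB.
rewrite /representations; under eq_bigr => i _ do under eq_bigr => j _ do rewrite z.
rewrite (bigD1 (Ordinal hB)) //= (bigD1 (Ordinal hB)) //= eqxx.
rewrite big1 => [|j /negPf ->]; last by rewrite andbF.
by rewrite big1 // => i /negPf ->; apply: big1.
Qed.

Variables (h : nat) (F : 'I_h -> bqform).
Hypothesis F_red : forall i, disc_form p (F i).
Hypothesis F_sur : forall g, disc_form p g -> exists i, properly_equivalent (F i) g.
Hypothesis F_inj : forall i j, properly_equivalent (F i) (F j) -> i = j.

Definition theta_coef (n : nat) : int := if n == 0%N then h%:Z else 2 * chi_sum p n.

Definition theta_diff_coef (n : nat) : int :=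
  theta_coef n - if (4 %| n)%N then 4 * theta_coef (n %/ 4) else 0.

Lemma sum_box (B X : nat) (G : int -> int) : (forall i, fits (F i) X%:Z B) ->
  (forall k : int, X%:Z < k -> G k = 0) ->
  \sum_(l < h) \sum_(i < (2 * B).+1) \sum_(j < (2 * B).+1)
     G (qeval (F l) (centered B i) (centered B j)) =
  \sum_(n < X.+1) theta_coef n * G n%:Z.
Proof.
move=> hB GX.
transitivity (\sum_(l < h) \sum_(n < X.+1) (representations (F l) B n)%:Z * G n%:Z).
  by apply: eq_bigr => l _; rewrite (box_sum _ (F_red l) GX).
rewrite exchange_big /=; apply: eq_bigr => n _; rewrite -mulr_suml -Posz_sum; congr (_ * _).
rewrite /theta_coef; case: eqP => [->|/eqP n0].
  by under eq_bigr do rewrite representations0 //; rewrite sum1_card card_ord.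
apply: (sum_representations p_pr p4 F_red F_sur F_inj); first by rewrite lt0n.
by move=> i x y hxy; apply: hB; apply: le_trans hxy _; rewrite lez_nat -ltnS.
Qed.

(** Since Q(2v) = 4 Q(v), the coefficient r(n/4) counts the representations of n by even vectors. *)
Lemma theta_diff_lattice (N B : nat) (w : int -> int) : (forall i, fits (F i) N%:Z B) ->
  (forall k, k < 0 -> w k = 0) ->
  \sum_(n < N.+1) theta_diff_coef n * w (N%:Z - n%:Z) =
  \sum_(l < h) \sum_(i < (2 * (2 * B)).+1) \sum_(j < (2 * (2 * B)).+1)
    even_weight i j * w (N%:Z - qeval (F l) (centered (2 * B) i) (centered (2 * B) j)).
Proof.
move=> hB w0.
have s1 : \sum_(n < N.+1) theta_coef n * w (N%:Z - n%:Z) =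
    \sum_(l < h) \sum_(i < (2 * (2 * B)).+1) \sum_(j < (2 * (2 * B)).+1)
    w (N%:Z - qeval (F l) (centered (2 * B) i) (centered (2 * B) j)).
  rewrite (@sum_box (2 * B) N (fun k => w (N%:Z - k))) //.
    by move=> i x y /hB[]; clear; lia.
  by move=> k hk; rewrite w0 // subr_lt0.
have s2 : \sum_(n < N.+1) (if (4 %| n)%N then theta_coef (n %/ 4) else 0) * w (N%:Z - n%:Z) =
    \sum_(n < (N %/ 4).+1) theta_coef n * w (N%:Z - 4 * n%:Z).
  rewrite -(big_mkord xpredT (fun n => (if (4 %| n)%N then theta_coef (n %/ 4) else 0) * w (N%:Z - n%:Z))).
  rewrite -(big_mkord xpredT (fun n => theta_coef n * w (N%:Z - 4 * n%:Z))).
  elim: N {hB s1} (N%:Z) => [|N IHN] M.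
    by rewrite div0n !big_nat1 /= div0n mulr0.
  rewrite big_nat_recr //= IHN divnS //; case: (4 %| N.+1)%N / boolP => d4.
    rewrite add1n [RHS]big_nat_recr //=; congr (_ + _); move/dvdnP: d4 => [q hq].
    have -> : (N %/ 4).+1 = q by lia.
    by rewrite hq PoszM [q%:Z * _]mulrC.
  by rewrite add0n mul0r addr0.
have s3 : \sum_(n < (N %/ 4).+1) theta_coef n * w (N%:Z - 4 * n%:Z) =
    \sum_(l < h) \sum_(i < (2 * B).+1) \sum_(j < (2 * B).+1)
    w (N%:Z - 4 * qeval (F l) (centered B i) (centered B j)).
  rewrite (@sum_box B (N %/ 4)%N (fun k => w (N%:Z - 4 * k))) //.
    by move=> i x y hxy; apply: hB; apply: le_trans hxy _; rewrite lez_nat leq_div.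
  move=> k hk; rewrite w0 //; have := ltn_ceil N (isT : 0 < 4)%N.
  by move: (N %/ 4)%N hk; clear; lia.
have even_sum (g : nat -> int) :
    \sum_(i < (2 * (2 * B)).+1) (~~ odd i)%:Z * g i = \sum_(i < (2 * B).+1) g (2 * i)%N.
  rewrite -(big_mkord xpredT (fun i => (~~ odd i)%:Z * g i)) -(big_mkord xpredT (fun i => g (2 * i)%N)).
  elim: (2 * B)%N => [|m IHm]; first by rewrite !big_nat1 mul1r.
  rewrite [RHS]big_nat_recr //= -IHm (_ : (2 * m.+1).+1 = (2 * m).+3)%N; last by rewrite mulnS.
  rewrite big_nat_recr // big_nat_recr //= mul2n odd_double /= mul0r addr0 mul1r.
  by rewrite mul2n doubleS.
have s4 : \sum_(l < h) \sum_(i < (2 * B).+1) \sum_(j < (2 * B).+1)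
    w (N%:Z - 4 * qeval (F l) (centered B i) (centered B j)) =
  \sum_(l < h) \sum_(i < (2 * (2 * B)).+1) \sum_(j < (2 * (2 * B)).+1)
    (~~ odd i && ~~ odd j)%:Z * w (N%:Z - qeval (F l) (centered (2 * B) i) (centered (2 * B) j)).
  apply: eq_bigr => l _.
  (* The large box is centred at the even index 2B, so an index and its coordinate have the same
     parity, and the even points are the doubles of the small box. *)
  have dbl (i : nat) : centered (2 * B) (2 * i) = 2 * centered B i.
    by rewrite /centered !PoszM mulrBr.
  transitivity (\sum_(i < (2 * (2 * B)).+1) (~~ odd i)%:Z * \sum_(j < (2 * (2 * B)).+1)
     (~~ odd j)%:Z * w (N%:Z - qeval (F l) (centered (2 * B) i) (centered (2 * B) j))).
    rewrite (even_sum (fun i => \sum_(j < (2 * (2 * B)).+1)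
     (~~ odd j)%:Z * w (N%:Z - qeval (F l) (centered (2 * B) i) (centered (2 * B) j)))).
    apply: eq_bigr => i _.
    rewrite (even_sum (fun j => w (N%:Z - qeval (F l) (centered (2 * B) (2 * i)) (centered (2 * B) j)))).
    apply: eq_bigr => j _; rewrite !dbl; congr (w (_ - _)).
    by rewrite /qeval; ring.
  apply: eq_bigr => i _; rewrite mulr_sumr; apply: eq_bigr => j _.
  by case: (odd i); case: (odd j); rewrite /= ?mul0r ?mulr0 ?mul1r.
transitivity (\sum_(n < N.+1) theta_coef n * w (N%:Z - n%:Z) -
   4 * \sum_(n < N.+1) (if (4 %| n)%N then theta_coef (n %/ 4) else 0) * w (N%:Z - n%:Z)).
  rewrite mulr_sumr -sumrB; apply: eq_bigr => n _; rewrite /theta_diff_coef.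
  by case: (4 %| n)%N; rewrite mulrBl ?mulrA // !mul0r mulr0.
rewrite s2 s3 s4 s1 mulr_sumr -sumrB; apply: eq_bigr => l _.
rewrite mulr_sumr -sumrB; apply: eq_bigr => i _; rewrite mulr_sumr -sumrB; apply: eq_bigr => j _.
by rewrite /even_weight; ring.
Qed.

Lemma disc_form_fits (f : bqform) (C s N : int) (x y : int) : disc_form p f ->
  qa f + qc f <= C -> 0 < s -> N <= s ^+ 2 -> qeval f x y <= N ->
  (`|x| + 3 <= 4 * C * s) /\ (`|y| + 3 <= 4 * C * s) /\ (`|x| <= 2 * C * s) /\ (`|y| <= 2 * C * s).
Proof.
move=> hf hC s0 Ns fN; have fs := le_trans fN Ns.
have [_ a0] := hf; have [_ c0] := swap_disc_form hf; rewrite /= in c0.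
have [_ hy] := disc_form_axis hf (ltW s0) fs.
rewrite -(qeval_swap f x y) in fs.
have [_ hx] := disc_form_axis (swap_disc_form hf) (ltW s0) fs.
rewrite /= in hx.
have sa : s <= qa f * s by rewrite ler_peMl ?(ltW s0) //; move: a0; clear; lia.
have sc : s <= qc f * s by rewrite ler_peMl ?(ltW s0) //; move: c0; clear; lia.
have sC : qa f * s + qc f * s <= C * s by rewrite -mulrDl ler_pM2r.
by move: hx hy sa sc sC s0; rewrite -!(mulrA 2) -(mulrA 4); clear; lia.
Qed.

Lemma theta_diff_bound : exists K : nat, forall s N : nat, (0 < s)%N -> (N <= s * s)%N ->
  `|\sum_(n < N.+1) theta_diff_coef n * cubic_weight (N%:Z - n%:Z)| <= K%:Z * s%:Z ^+ 5.
Proof.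
pose C := (\sum_(l < h) (`|qa (F l)| + `|qc (F l)|))%N.
have hC l : qa (F l) + qc (F l) <= C%:Z.
  have [_ a0] := F_red l; have [_ c0] := swap_disc_form (F_red l); rewrite /= in c0.
  have : ((`|qa (F l)| + `|qc (F l)|) <= C)%N by rewrite /C (bigD1 l) //= leq_addr.
  by move: (C) a0 c0; clear; lia.
have Ca l : qa (F l) <= C%:Z /\ qc (F l) <= C%:Z.
  have [_ a0] := F_red l; have [_ c0] := swap_disc_form (F_red l); rewrite /= in c0.
  by have := hC l; move: a0 c0; clear; lia.
(* 81 = 9 * 9 comes from the box side 2B + 1 <= 9Cs, and 24 = 16 + 8 merges the two cubic terms of
   [lattice_sum_bound]. *)
pose Q : int := 81 * C%:Z ^+ 2 * (24 * (33 * C%:Z) ^+ 3 + 24).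
exists (absz (h%:Z * Q)) => s N s0 Ns.
have Q0 : 0 <= Q by rewrite /Q !mulr_ge0 ?addr_ge0 ?mulr_ge0 ?exprn_ge0 ?mulr_ge0.
rewrite gez0_abs ?mulr_ge0 //.
have Ns' : N%:Z <= s%:Z ^+ 2 by rewrite expr2 -PoszM lez_nat.
have s0' : 0 < s%:Z by rewrite ltz_nat.
have fi l x y (hx : qeval (F l) x y <= N%:Z) := disc_form_fits (F_red l) (hC l) s0' Ns' hx.
rewrite (@theta_diff_lattice N (2 * C * s)); last 2 first.
- by move=> l x y /(fi l)[_ [_ []]]; rewrite !PoszM.
- by move=> k k0; rewrite /cubic_weight /pos_part leNgt k0 subr0 expr0n.
set B := (2 * (2 * C * s))%N.
have BE : B%:Z = 4 * C%:Z * s%:Z by rewrite /B !PoszM; ring.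
apply: le_trans (ler_norm_sum _ _ _) _.
have -> : h%:Z * Q * s%:Z ^+ 5 = \sum_(l < h) (Q * s%:Z ^+ 5).
  by rewrite sumr_const card_ord -mulr_natl natz mulrA.
apply: ler_sum => l _.
have hf3 : fits3 (F l) N%:Z B by move=> x y /(fi l)[h1 [h2 _]]; rewrite BE.
have := lattice_sum_bound (F_red l) s0' Ns' hf3.
set X := \sum_(i < _) _; set Y := _ + 24 * _ => hX.
have [ac cc] := Ca l.
have [_ a0] := F_red l; have [_ c0] := swap_disc_form (F_red l); rewrite /= in c0.
have C0 : 0 <= C%:Z by [].
have s1 : 1 <= s%:Z by move: s0'; clear; lia.
have cube (a : int) : 0 < a -> a <= C%:Z -> (33 * (a * s%:Z)) ^+ 3 <= (33 * C%:Z) ^+ 3 * s%:Z ^+ 3.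
  move=> a0' aC; rewrite -exprMn -(mulrA 33) lerXn2r ?nnegrE ?mulr_ge0 ?(ltW a0') //.
  by rewrite ler_pM2l // ler_pM2r.
have hY : Y <= (24 * (33 * C%:Z) ^+ 3 + 24) * s%:Z ^+ 3.
  have lin (x y u w z : int) : x <= w -> y <= w -> u <= z -> 16 * x + 8 * y + 24 * u <= 24 * w + 24 * z.
    by clear; lia.
  by rewrite mulrDl /Y -(mulrA 24); apply: lin; [exact: cube|exact: cube|exact: ler_weXn2l].
have Y0 : 0 <= Y by rewrite /Y !addr_ge0 ?mulr_ge0 ?exprn_ge0 ?mulr_ge0 // ltW.
have hL : (2 * B).+1%:Z <= 9 * C%:Z * s%:Z.
  have C1 : 1 <= C%:Z by move: a0 ac; clear; lia.
  have Cs : 1 <= C%:Z * s%:Z by rewrite mulr_ege1.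
  rewrite -addn1 PoszD PoszM BE -!mulrA; move: Cs; clear; lia.
have : `|X| <= `|8 * X| by move: (X); clear; lia.
move=> /le_trans; apply; apply: le_trans hX _.
apply: (@le_trans _ _ ((9 * C%:Z * s%:Z) * (9 * C%:Z * s%:Z) * ((24 * (33 * C%:Z) ^+ 3 + 24) * s%:Z ^+ 3))).
  by apply: ler_pM => //; rewrite ?mulr_ge0 //; apply: ler_pM.
by rewrite le_eqVlt /Q; apply/orP; left; apply/eqP; ring.
Qed.

End LatticeSum.

(** * Abel summation *)

Section Abel.
Implicit Types (a b c : nat -> rat) (q : rat).

(** Convergence is stated with rational eps and for truncated sums, so no limit has to exist in
    [rat]. *)
Definition tends0 a : Prop := forall eps, 0 < eps -> exists X0, forall X, (X0 <= X)%N -> `|a X| <= eps.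

Lemma tends0D a b : tends0 a -> tends0 b -> tends0 (fun X => a X + b X).
Proof.
move=> ha hb eps e0; have e2 : 0 < eps / 2 by lra.
have [A hA] := ha _ e2; have [B hB] := hb _ e2; exists (A + B)%N => X hX.
have := hA X; have := hB X; rewrite (leq_trans (leq_addr _ _) hX) (leq_trans (leq_addl _ _) hX).
move=> /(_ isT) h1 /(_ isT) h2; have := ler_normD (a X) (b X); lra.
Qed.

Lemma tends0_le (K : rat) a b : tends0 b -> (forall X, `|a X| <= K * `|b X|) -> tends0 a.
Proof.
move=> hb hK eps e0; have K1 : 0 < `|K| + 1 by have := normr_ge0 K; lra.
have e1 : 0 < eps / (`|K| + 1) by rewrite divr_gt0.
have [A hA] := hb _ e1; exists A => X /hA hX; apply: le_trans (hK X) _.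
have K2 : K <= `|K| + 1 by have := ler_norm K; lra.
apply: le_trans (ler_wpM2r (normr_ge0 _) K2) _.
by rewrite mulrC -ler_pdivlMr.
Qed.

Lemma mulrn_exp_bound (r : rat) n : 0 <= r -> r < 1 -> n%:R * r ^+ n <= (1 - r)^-1.
Proof.
move=> r0 r1; have d : 0 < 1 - r by lra.
apply: (@le_trans _ _ (\sum_(i < n) r ^+ i)).
  rewrite -[X in X%:R]card_ord -sum1_card natr_sum mulr_suml; apply: ler_sum => i _.
  by rewrite mul1r; apply: ler_wiXn2l; rewrite ?(ltW r1) // ltnW.
rewrite -[_^-1]mul1r ler_pdivlMr // mulrC; have := subrX1 r n; have := exprn_ge0 n r0.
by move: (r ^+ n) (\sum_(i < n) _) => x y x0 e; lra.
Qed.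

Lemma bernoulli_le (x : rat) n : 0 <= x -> x <= 1 -> 1 - n%:R * x <= (1 - x) ^+ n.
Proof.
move=> x0 x1; elim: n => [|n IHn]; first by rewrite mul0r subr0 expr0.
have y0 : 0 <= 1 - x by lra.
rewrite exprS; apply: le_trans (ler_wpM2l y0 IHn).
have nx : 0 <= n%:R * x * x by rewrite !mulr_ge0.
by rewrite -natr1; nra.
Qed.

Lemma tends0_inv (M : rat) : tends0 (fun X => M / X.+1%:R).
Proof.
move=> eps e0; exists (Num.bound (`|M| / eps)) => X hX.
rewrite normrM normfV normr_nat ler_pdivrMr ?ltr0n // mulrC -ler_pdivrMr //.
have h := archi_boundP (divr_ge0 (normr_ge0 M) (ltW e0)).
apply: le_trans (ltW h) _; rewrite ler_nat; exact: leq_trans (leqnSn _).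
Qed.

(** Bernoulli's inequality provides a rational r < 1 with q <= r^(e+1), in place of a root of q.
    Then ((X+1) r^X)^(e+1) is bounded, which leaves a factor 1/(X+1) to spare. *)
Lemma tends0_exp (e : nat) q : 0 < q -> q < 1 -> tends0 (fun X => X.+1%:R ^+ e * q ^+ X).
Proof.
move=> q0 q1; pose x := (1 - q) / e.+1%:R; pose r := 1 - x.
have e0 : (0 : rat) < e.+1%:R by rewrite ltr0n.
have e1 : (1 : rat) <= e.+1%:R by rewrite ler1n.
have x0 : 0 < x by rewrite divr_gt0 //; lra.
have x1 : x < 1 by rewrite ltr_pdivrMr //; lra.
have r0 : 0 < r by rewrite /r; lra.
have r1 : r < 1 by rewrite /r; lra.
have qr : q <= r ^+ e.+1.
  apply: le_trans (bernoulli_le e.+1 (ltW x0) (ltW x1)).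
  by rewrite /x mulrC divfK ?gt_eqF //; lra.
pose M := ((1 - r)^-1 / r) ^+ e.+1.
apply: (@tends0_le 1 _ (fun X => M / X.+1%:R)) (tends0_inv M) _ => X.
have X0 : (0 : rat) < X.+1%:R by rewrite ltr0n.
have B0 : 0 <= (1 - r)^-1 / r by apply: divr_ge0; [rewrite invr_ge0 subr_ge0 ltW|exact: ltW].
have M0 : 0 <= M by exact: exprn_ge0.
rewrite mul1r !ger0_norm ?divr_ge0 ?mulr_ge0 ?exprn_ge0 ?(ltW X0) ?(ltW q0) //.
rewrite ler_pdivlMr // mulrAC -exprSr.
apply: (@le_trans _ _ ((X.+1%:R * r ^+ X) ^+ e.+1)).
  rewrite exprMn ler_pM2l ?exprn_gt0 // -exprM mulnC exprM.
  by apply: lerXn2r; rewrite ?nnegrE ?exprn_ge0 // ltW.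
have A0 : 0 <= X.+1%:R * r ^+ X by apply: mulr_ge0; [exact: ltW|apply: exprn_ge0; exact: ltW].
apply: lerXn2r; rewrite ?nnegrE // ler_pdivlMr // -mulrA -exprSr.
exact: mulrn_exp_bound (ltW r0) r1.
Qed.

Definition psum a (n : nat) : rat := \sum_(i < n.+1) a i.

Lemma abel_step a q X :
  \sum_(n < X) a n * q ^+ n = (1 - q) * \sum_(n < X) psum a n * q ^+ n + (\sum_(n < X) a n) * q ^+ X.
Proof.
elim: X => [|X IHX]; first by rewrite !big_ord0 mulr0 mul0r addr0.
have e : psum a X = \sum_(n < X) a n + a X by rewrite /psum big_ord_recr.
by rewrite 2!big_ord_recr [X in _ = _ + X * _]big_ord_recr /= IHX e exprS; ring.
Qed.

Definition poly_growth a : Prop := exists (K : rat) (e : nat), forall n, `|a n| <= K * n.+1%:R ^+ e.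

Lemma poly_growth_psum a : poly_growth a -> poly_growth (psum a).
Proof.
move=> [K [e hK]]; exists K, e.+1 => n.
have K0 : 0 <= K by have := hK 0%N; rewrite expr1n mulr1; apply: le_trans.
apply: le_trans (ler_norm_sum _ _ _) _.
apply: (@le_trans _ _ (\sum_(i < n.+1) K * n.+1%:R ^+ e)); last first.
  by rewrite sumr_const card_ord -[(_ * _) *+ _]mulr_natl exprS mulrCA.
apply: ler_sum => i _; apply: le_trans (hK i) _; rewrite ler_wpM2l //.
by apply: lerXn2r; rewrite ?nnegrE ?ler0n // ler_nat ltn_ord.
Qed.

Lemma abel_step_tends0 a q : 0 < q -> q < 1 -> poly_growth a ->
  tends0 (fun X => \sum_(n < X) a n * q ^+ n - (1 - q) * \sum_(n < X) psum a n * q ^+ n).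
Proof.
move=> q0 q1 /poly_growth_psum[K [e hK]].
apply: (@tends0_le K _ (fun X => X.+1%:R ^+ e * q ^+ X)); first exact: tends0_exp.
move=> X; rewrite abel_step addrC addKr normrM [ `|q ^+ X|]ger0_norm ?exprn_ge0 ?(ltW q0) //.
rewrite [X in K * X]ger0_norm ?mulr_ge0 ?exprn_ge0 ?(ltW q0) // mulrA ler_wpM2r ?exprn_ge0 ?(ltW q0) //.
case: X => [|X]; first by rewrite big_ord0 normr0 expr1n mulr1; have := hK 0%N; rewrite expr1n mulr1; apply: le_trans.
have K0 : 0 <= K by have := hK 0%N; rewrite expr1n mulr1; apply: le_trans.
apply: le_trans (hK X) _; rewrite ler_wpM2l //.
by apply: lerXn2r; rewrite ?nnegrE ?ler0n // ler_nat.
Qed.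

Lemma abel_iter_tends0 k a q : 0 < q -> q < 1 -> poly_growth a ->
  tends0 (fun X => \sum_(n < X) a n * q ^+ n - (1 - q) ^+ k * \sum_(n < X) iter k psum a n * q ^+ n).
Proof.
move=> q0 q1 ha; elim: k => [|k IHk].
  by move=> eps e0; exists 0%N => X _; rewrite expr0 mul1r subrr normr0 ltW.
have hk : poly_growth (iter k psum a) by elim: k {IHk} => // k; exact: poly_growth_psum.
have hs := abel_step_tends0 q0 q1 hk.
have hs' : tends0 (fun X => (1 - q) ^+ k * (\sum_(n < X) iter k psum a n * q ^+ n -
     (1 - q) * \sum_(n < X) iter k.+1 psum a n * q ^+ n)).
  by apply: (@tends0_le `|(1 - q) ^+ k| _ _ hs) => X; rewrite normrM.
move=> eps e0; have [X0 hX0] := tends0D IHk hs' e0; exists X0 => X /hX0.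
by congr (`|_| <= _); rewrite exprSr; ring.
Qed.

Definition delta0 (n : nat) : rat := (n == 0%N)%:R.

(** The k-fold partial sums of the series 1 are the coefficients of (1 - q)^(-k); truncation only
    loses nonnegative terms. *)
Lemma delta0_abel k q X : 0 <= q -> q <= 1 ->
  (forall n, 0 <= iter k psum delta0 n) /\
  (1 - q) ^+ k * \sum_(n < X) iter k psum delta0 n * q ^+ n <= 1.
Proof.
move=> q0 q1; elim: k => [|k [IH0 IHk]].
  split=> [n|]; first exact: ler0n.
  rewrite expr0 mul1r; case: X => [|X]; first by rewrite big_ord0.
  by rewrite big_ord_recl big1 ?addr0 ?mulr1 ?expr0 //= => i _; rewrite /delta0 mul0r.
split=> [n|]; first by rewrite /= /psum sumr_ge0.
apply: le_trans IHk; rewrite [X in _ <= _ * X]abel_step exprSr -mulrA ler_wpM2l ?exprn_ge0 ?subr_ge0 //.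
by rewrite lerDl mulr_ge0 ?exprn_ge0 // sumr_ge0.
Qed.

Lemma psum_delta0 n : psum delta0 n = 1.
Proof. by rewrite /psum big_ord_recl big1 ?addr0 // => i _. Qed.

(* [iter 4 psum delta0 n] is the binomial coefficient C(n + 3, 3). *)
Lemma cesaro_abel c : poly_growth c ->
  (forall eta, 0 < eta -> exists K, forall n, `|iter 4 psum c n| <= eta * iter 4 psum delta0 n + K) ->
  forall eps, 0 < eps -> exists2 d, 0 < d & forall q, 0 < q -> q < 1 -> 1 - q < d ->
    exists X0, forall X, (X0 <= X)%N -> `|\sum_(n < X) c n * q ^+ n| <= eps.
Proof.
move=> hc hC eps e0; have e3 : 0 < eps / 3 by lra.
have [K hK] := hC _ e3; pose K' := `|K| + 1.
have K0 : 0 < K' by rewrite /K'; have := normr_ge0 K; lra.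
exists (eps / 3 / K'); first by rewrite divr_gt0.
move=> q q0 q1 qd.
have [X0 hX0] := abel_iter_tends0 4 q0 q1 hc e3.
exists X0 => X /hX0; set A := \sum_(n < X) _; set B := \sum_(n < X) _ => hAB.
suff : `|(1 - q) ^+ 4 * B| <= eps / 3 + eps / 3.
  by have := ler_normD (A - (1 - q) ^+ 4 * B) ((1 - q) ^+ 4 * B); rewrite subrK; lra.
have d0 : 0 <= 1 - q by lra.
have [_ h4] := delta0_abel 4 X (ltW q0) (ltW q1).
have [_ h1] := delta0_abel 1 X (ltW q0) (ltW q1).
rewrite expr1 in h1.
rewrite normrM ger0_norm ?exprn_ge0 //.
(* The factor (1-q)^4 cancels the first sum entirely but only one order of the second, a geometric
   series; K'(1-q)^3 remains, and the choice of d makes it small. *)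
have hB : `|B| <= eps / 3 * (\sum_(n < X) iter 4 psum delta0 n * q ^+ n) + K' * (\sum_(n < X) iter 1 psum delta0 n * q ^+ n).
  rewrite !mulr_sumr -big_split /=; apply: le_trans (ler_norm_sum _ _ _) _; apply: ler_sum => n _.
  rewrite normrM [ `|q ^+ n|]ger0_norm ?exprn_ge0 ?(ltW q0) // psum_delta0 mul1r mulrA -mulrDl.
  rewrite ler_wpM2r ?exprn_ge0 ?(ltW q0) //; apply: le_trans (hK n) _.
  by rewrite lerD2l /K'; have := ler_norm K; lra.
apply: le_trans (ler_wpM2l (exprn_ge0 4 d0) hB) _; rewrite mulrDr lerD //.
  by rewrite mulrCA -[X in _ <= X]mulr1 ler_wpM2l // ltW.
rewrite (_ : (1 - q) ^+ 4 = (1 - q) ^+ 3 * (1 - q)); last by rewrite -exprSr.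
rewrite mulrCA -mulrA mulrA -[X in _ <= X]mulr1 ler_pM ?mulr_ge0 ?exprn_ge0 ?(ltW K0) //.
  by rewrite sumr_ge0 // => n _; rewrite /= psum_delta0 mul1r exprn_ge0 // ltW.
apply: (@le_trans _ _ (K' * (1 - q))).
  rewrite ler_wpM2l ?(ltW K0) // -[X in _ <= X]expr1 ler_wiXn2l //; lra.
by rewrite mulrC -ler_pdivlMr // ltW.
Qed.
End Abel.

(** * Lambert series and the value L(0, chi) *)

Lemma eq_psum (a b : nat -> rat) : a =1 b -> psum a =1 psum b.
Proof. by move=> ab n; apply: eq_bigr => i _; exact: ab. Qed.

Lemma psum0 (a : nat -> rat) : psum a 0 = a 0%N.
Proof. by rewrite /psum big_ord1. Qed.

Lemma psumS (a : nat -> rat) n : psum a n.+1 = psum a n + a n.+1.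
Proof. by rewrite /psum big_ord_recr. Qed.

Lemma psum_convolution (c w : nat -> rat) N :
  psum (fun N => \sum_(n < N.+1) c n * w (N - n)%N) N = \sum_(n < N.+1) c n * psum w (N - n)%N.
Proof.
elim: N => [|N IHN]; first by rewrite psum0 !big_ord1 psum0.
rewrite psumS IHN [RHS]big_ord_recr [X in _ + X]big_ord_recr /= addrA -big_split /= subnn psum0.
congr (_ + _); apply: eq_bigr => i _; have iN : (i <= N)%N by rewrite -ltnS ltn_ord.
by rewrite subSn // psumS mulrDr.
Qed.

Definition tetrahedral (k : nat) : rat := k.+1%:R * k.+2%:R * k.+3%:R / 6.

Lemma psum_iter3_1 : psum (psum (psum (fun=> 1))) =1 tetrahedral.
Proof.
have h1 n : psum (fun=> 1) n = n.+1%:R by rewrite /psum sumr_const card_ord.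
have h2 n : psum (fun n => n.+1%:R) n = n.+1%:R * n.+2%:R / 2.
  elim: n => [|n IHn]; first by rewrite psum0; field.
  by rewrite psumS IHn -(natr1 n.+2) -(natr1 n.+1); field.
move=> n; rewrite (eq_psum (eq_psum h1)) (eq_psum h2).
elim: n => [|n IHn]; first by rewrite psum0 /tetrahedral; field.
rewrite psumS IHn /tetrahedral.
by rewrite -(natr1 n.+3) -(natr1 n.+2) -(natr1 n.+1); field.
Qed.

Lemma iter_psum4 (c : nat -> rat) N : iter 4 psum c N = \sum_(n < N.+1) c n * tetrahedral (N - n)%N.
Proof.
have h1 n : psum c n = \sum_(i < n.+1) c i * (fun=> 1 : rat) (n - i)%N.
  by apply: eq_bigr => i _; rewrite mulr1.
have h2 := fun n => psum_convolution c (fun=> 1) n.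
have h3 := fun n => psum_convolution c (psum (fun=> 1)) n.
have h4 := fun n => psum_convolution c (psum (psum (fun=> 1))) n.
rewrite /= (eq_psum (eq_psum (eq_psum h1))) (eq_psum (eq_psum h2)) (eq_psum h3) h4.
by apply: eq_bigr => i _; rewrite psum_iter3_1.
Qed.

Lemma iter_psum4_delta0 N : iter 4 psum delta0 N = tetrahedral N.
Proof.
rewrite iter_psum4 big_ord_recl big1 ?addr0 ?mul1r ?subn0 // => i _.
by rewrite /delta0 mul0r.
Qed.

Lemma iter_psum4_cubic (c : nat -> int) N :
  6 * iter 4 psum (fun n => (c n)%:~R) N =
  (\sum_(n < N.+3) c n * cubic_weight (N.+2%:Z - n%:Z))%:~R.
Proof.
have cw (k : nat) : cubic_weight k%:Z = k%:Z ^+ 3 - k%:Z by rewrite /cubic_weight /pos_part.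
(* The weight vanishes at 0 and 1, so the last two terms drop out; this is why the cut-off is N +
   2. *)
have -> : \sum_(n < N.+3) c n * cubic_weight (N.+2%:Z - n%:Z) =
    \sum_(n < N.+1) c n * cubic_weight (N.+2%:Z - n%:Z).
  rewrite 2!big_ord_recr /= subrr (_ : N.+2%:Z - N.+1%:Z = 1); last by lia.
  by rewrite !cw expr1n expr0n /= !subrr !mulr0 !addr0.
rewrite iter_psum4 mulr_sumr rmorph_sum /=; apply: eq_bigr => n _.
have nN : (n <= N)%N by rewrite -ltnS ltn_ord.
have -> : N.+2%:Z - n%:Z = (N - n).+2%:Z by lia.
rewrite cw intrM rmorphB rmorphXn /= /tetrahedral.
by move: (N - n)%N => k; rewrite -!pmulrn -(natr1 k.+2) -(natr1 k.+1); field.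
Qed.

Lemma sqrt_approx N : exists s, [/\ (0 < s)%N, (N.+2 <= s * s)%N & (s * s <= 4 * N.+2)%N].
Proof.
elim: N => [|N [s [s0 h1 h2]]]; first by exists 2%N.
have [h|h] := leqP N.+3 (s * s)%N; first by exists s; split=> //; lia.
by exists s.+1; split=> //; nia.
Qed.

(** With M = N + 2 one needs 64 M^3 <= 512 (M-1)M(M+1)/6, which follows from M^2 - 1 >= 3M^2/4, with
    equality at M = 2. *)
Lemma tetrahedral_ge (N s : nat) : (s * s <= 4 * N.+2)%N -> s%:R ^+ 6 <= 512 * tetrahedral N.
Proof.
move=> h; pose M : rat := N.+2%:R.
have M2 : 2 <= M by rewrite /M ler_nat.
have hs : s%:R ^+ 2 <= 4 * M :> rat by rewrite /M expr2 -!natrM ler_nat.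
have -> : s%:R ^+ 6 = (s%:R ^+ 2) ^+ 3 :> rat by rewrite -exprM.
apply: (@le_trans _ _ ((4 * M) ^+ 3)).
  by apply: lerXn2r; rewrite ?nnegrE ?sqr_ge0 // mulr_ge0 //; lra.
have -> : tetrahedral N = (M - 1) * M * (M + 1) / 6.
  by rewrite /tetrahedral /M -(natr1 N.+2) -(natr1 N.+1); field.
rewrite exprMn; nra.
Qed.

Section CharacterSums.
Variable p : nat.
Hypothesis p_pr : prime p.
Hypothesis p4 : p = 1 %[mod 4].

Let D := (3 * p)%N.
Let D_gt0 : (0 < D)%N. Proof. by rewrite muln_gt0 (prime_gt0 p_pr). Qed.

Lemma chi0 : chi p 0 = 0.
Proof. by rewrite /chi /qchar eqxx mul0r. Qed.

Lemma chi_le1 m : `|chi p m| <= 1.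
Proof. by case: (chiP p m) => ->; rewrite ?normrN ?normr1 ?normr0. Qed.

Lemma chi_sum_indicator n X : (0 < n)%N -> (n <= X)%N ->
  chi_sum p n = \sum_(m < X.+1) (m %| n)%N%:Z * chi p m.
Proof.
move=> n0 nX; rewrite /chi_sum /dirichlet.
under eq_bigr do rewrite mulr1.
rewrite -(big_mkord xpredT (fun m => (m %| n)%N%:Z * chi p m)).
transitivity (\sum_(0 <= m < X.+1 | (m %| n)%N) chi p m); last first.
  by rewrite big_mkcond /=; apply: eq_bigr => m _; case: (m %| n)%N; rewrite ?mul1r ?mul0r.
rewrite -[RHS]big_filter; apply: perm_big; apply: uniq_perm.
- exact: divisors_uniq.
- by rewrite filter_uniq // iota_uniq.
move=> m; rewrite -dvdn_divisors // mem_filter mem_index_iota /= ltnS.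
by case mn: (m %| n)%N => //=; rewrite (leq_trans (dvdn_leq n0 mn)).
Qed.

Lemma chi_sum_le n : `|chi_sum p n| <= n.+1%:Z.
Proof.
case: n => [|n]; first by rewrite /chi_sum /dirichlet big_seq1 mulr1 chi_le1.
rewrite (@chi_sum_indicator n.+1 n.+1) //; apply: le_trans (ler_norm_sum _ _ _) _.
apply: (@le_trans _ _ (\sum_(m < n.+2) 1)); last by rewrite sumr_const card_ord natz.
by apply: ler_sum => m _; rewrite normrM; case: (m %| _)%N; rewrite ?mul1r ?mul0r ?chi_le1.
Qed.

Section Powers.
Variable q : rat.
Hypothesis q0 : 0 < q.
Hypothesis q1 : q < 1.

Lemma multiples_geometric m Y : (0 < m)%N ->
  \sum_(1 <= n < Y.+1) (m %| n)%N%:R * q ^+ n =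
  (q ^+ m - (q ^+ m) ^+ (Y %/ m).+1) / (1 - q ^+ m).
Proof.
move=> m0; have z1 : 1 - q ^+ m != 0 by rewrite subr_eq0 gt_eqF // exprn_ilt1 ?(ltW q0) // -lt0n.
elim: Y => [|Y IHY]; first by rewrite big_geq // div0n expr1 subrr mul0r.
rewrite big_nat_recr //= IHY divnS //; case: (m %| Y.+1)%N / boolP => d.
  have e : Y.+1 = (m * (Y %/ m).+1)%N.
    by have := divnS Y m0; rewrite d add1n => <-; rewrite mulnC divnK.
  rewrite add1n mul1r [in q ^+ Y.+1]e exprM [(q ^+ m) ^+ (Y %/ m).+2]exprS; field; exact: z1.
by rewrite add0n mul0r addr0.
Qed.

Definition lambert X : rat := \sum_(1 <= m < X.+1) (chi p m)%:~R * (q ^+ m / (1 - q ^+ m)).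

Definition theta_part Y : rat := \sum_(1 <= n < Y.+1) (chi_sum p n)%:~R * q ^+ n.

(** After exchanging the sums over n and m, each m leaves a geometric tail starting beyond q^Y.
    Separate cut-offs allow the series in q and in q^4 to be compared with Lambert sums of the same
    length. *)
Lemma theta_lambert X Y : (Y <= X)%N ->
  `|theta_part Y - lambert X| <= X%:R * (q ^+ Y / (1 - q)).
Proof.
move=> YX.
have -> : theta_part Y = \sum_(1 <= m < X.+1) (chi p m)%:~R * \sum_(1 <= n < Y.+1) (m %| n)%N%:R * q ^+ n.
  under [RHS]eq_bigr do rewrite mulr_sumr.
  rewrite [RHS]exchange_big /=; rewrite /theta_part !big_nat; apply: eq_bigr => n /andP[n0 nY].
  rewrite (@chi_sum_indicator n X) //; last by rewrite (leq_trans _ YX).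
  rewrite big_ord_recl chi0 mulr0 add0r rmorph_sum mulr_suml /= big_add1 /= big_mkord.
  by apply: eq_bigr => m _; rewrite /bump /= add1n intrM -pmulrn; ring.
rewrite /lambert -sumrB; apply: le_trans (ler_norm_sum _ _ _) _.
apply: (@le_trans _ _ (\sum_(1 <= m < X.+1) (q ^+ Y / (1 - q)))); last first.
  by rewrite sumr_const_nat subSS subn0 mulr_natl.
rewrite !big_nat; apply: ler_sum => m /andP[m0 mX].
rewrite multiples_geometric // -mulrBr normrM.
have zq : q ^+ m <= q by rewrite -[X in _ <= X]expr1 ler_wiXn2l // ltW.
have z1 : 0 < 1 - q ^+ m by rewrite subr_gt0 (le_lt_trans zq).
rewrite -mulrBl (_ : _ - _ - _ = - (q ^+ m) ^+ (Y %/ m).+1); last by ring.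
rewrite mulNr normrN [ `|_ / _|]ger0_norm; last by rewrite divr_ge0 ?exprn_ge0 ?(ltW q0) ?(ltW z1).
have cm : `|(chi p m)%:~R : rat| <= 1 by rewrite -intr_norm -[1]/(1%:~R) ler_int chi_le1.
rewrite -[X in _ <= X]mul1r; apply: ler_pM => //; first by rewrite divr_ge0 ?exprn_ge0 ?(ltW q0) ?(ltW z1).
apply: ler_pM; rewrite ?exprn_ge0 ?(ltW q0) ?invr_ge0 ?(ltW z1) //.
  by rewrite -exprM ler_wiXn2l ?(ltW q0) ?(ltW q1) // mulnC ltnW // ltn_ceil.
by rewrite lef_pV2 ?posrE ?subr_gt0 ?lerB // (le_lt_trans zq).
Qed.

Definition logistic (z : rat) : rat := z / (1 + z).

(** The second difference equals z (1-q)^2 (1 - zq) over a positive product. Along z = q^m it gives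
    convexity of the sequence in m. *)
Lemma logistic_convex (z : rat) : 0 <= z -> z <= 1 ->
  0 <= logistic z - 2 * logistic (z * q) + logistic (z * q * q).
Proof.
move=> z0 z1.
have a0 : 0 < 1 + z by lra.
have zq : 0 <= z * q by rewrite mulr_ge0 // ltW.
have zqq : 0 <= z * q * q by rewrite mulr_ge0 // ltW.
have a1 : 0 < 1 + z * q by lra.
have a2 : 0 < 1 + z * q * q by lra.
have -> : logistic z - 2 * logistic (z * q) + logistic (z * q * q) =
   z * (1 - q) ^+ 2 * (1 - z * q) / ((1 + z) * (1 + z * q) * (1 + z * q * q)).
  by rewrite /logistic; field; rewrite !gt_eqF.
have zq1 : z * q <= 1 by rewrite -[X in _ <= X]mulr1 ler_pM // ltW.
by rewrite divr_ge0 ?mulr_ge0 ?exprn_ge0 ?subr_ge0 ?(ltW q1) ?(ltW a0) ?(ltW a1) ?(ltW a2).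
Qed.

End Powers.

Definition partial_sum (m : nat) : rat := \sum_(i < m.+1) (chi p i)%:~R.

(* The Abel sum of [chi], i.e. the value of its L-function at 0. *)
Definition L0 : rat := - (\sum_(m < D) m%:R * (chi p m)%:~R) / D%:R.

Lemma sum_chi_period : \sum_(m < D) chi p m = 0.
Proof.
have h : \sum_(1 <= m < D) chi p m = - \sum_(1 <= m < D) chi p m.
  rewrite {1}big_nat_rev /= -sumrN !big_nat; apply: eq_bigr => m /andP[m1 mD].
  by rewrite -(chi_opp p_pr p4) ?(ltnW mD) //; congr chi; lia.
rewrite -(big_mkord xpredT (chi p)) big_ltn // chi0 add0r.
by move: (\sum_(1 <= m < D) chi p m) h => x; lia.
Qed.

Lemma partial_sum_periodic m : partial_sum (m + D) = partial_sum m.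
Proof.
have shift (k : nat) : chi p (D + k) = chi p k by rewrite addnC chi_periodic.
rewrite /partial_sum -(big_mkord xpredT (fun i => (chi p i)%:~R)) -addSn addnC.
rewrite (@big_cat_nat _ _ _ D) //= ?leq_addr // big_mkord -(rmorph_sum intr) /= sum_chi_period add0r.
rewrite -{1}[D]add0n big_addn addKn -(big_mkord xpredT (fun i => (chi p i)%:~R)).
by apply: eq_bigr => i _; rewrite addnC shift.
Qed.

(** [L0] is the mean of the partial sums of chi over a period: their total is the sum of (D - m)
    chi(m), and chi has total 0. *)
Lemma sum_partial_sum_period : \sum_(m < D) (partial_sum m - L0) = 0.
Proof.
have h X : \sum_(m < X) partial_sum m = \sum_(m < X) (X%:R - m%:R) * (chi p m)%:~R.
  elim: X => [|X IHX]; first by rewrite !big_ord0.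
  rewrite big_ord_recr [RHS]big_ord_recr /= IHX /partial_sum big_ord_recr /= addrA -big_split /=.
  congr (_ + _); last by rewrite -natr1 addrAC subrr add0r mul1r.
  by apply: eq_bigr => i _; rewrite -natr1; ring.
have D0 : (D%:R : rat) != 0 by rewrite pnatr_eq0 -lt0n.
have -> : \sum_(m < D) (partial_sum m - L0) = \sum_(m < D) partial_sum m - L0 * D%:R.
  by rewrite sumrB sumr_const card_ord mulr_natr.
rewrite h /L0 divfK // opprK.
under eq_bigr do rewrite mulrBl.
by rewrite sumrB -mulr_sumr -(rmorph_sum intr) /= sum_chi_period mulr0 sub0r addNr.
Qed.

Lemma periodic_bounded (f : nat -> rat) : (forall m, f (m + D)%N = f m) ->
  exists2 K, 0 <= K & forall m, `|f m| <= K.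
Proof.
move=> hf; exists (\sum_(i < D) `|f i|) => [|m]; first by apply: sumr_ge0.
have hk k r : f (r + k * D)%N = f r.
  by elim: k => [|k IHk]; rewrite ?addn0 // mulSn addnCA addnC hf.
rewrite (divn_eq m D) addnC hk (bigD1 (Ordinal (ltn_pmod m D_gt0))) //= lerDl.
by apply: sumr_ge0.
Qed.

Definition iterated_sum (m : nat) : rat := \sum_(1 <= i < m.+1) (partial_sum i - L0).

Lemma iterated_sum_periodic m : iterated_sum (m + D) = iterated_sum m.
Proof.
rewrite /iterated_sum -addSn (@big_cat_nat _ _ _ m.+1) ?leq_addr //=.
suff h k : \sum_(k <= i < k + D) (partial_sum i - L0) = 0 by rewrite h addr0.
elim: k => [|k IHk]; first by rewrite add0n big_mkord sum_partial_sum_period.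
have [e|D1] := leqP D 1; first by have := prime_gt0 p_pr; lia.
move: IHk; rewrite big_ltn ?addSn; last by lia.
rewrite [X in _ -> X = _]big_nat_recr /=; last by lia.
by rewrite partial_sum_periodic addrC.
Qed.

(** Two summations by parts. Centring the partial sums at [L0] makes their own sums periodic, and
    the value -L0 at index 0 produces the leading term. *)
Lemma chi_summation (psi : nat -> rat) X :
  \sum_(1 <= m < X.+1) (chi p m)%:~R * psi m = L0 * psi 1%N
   + \sum_(1 <= m < X.+1) iterated_sum m * (psi m - 2 * psi m.+1 + psi m.+2)
   + (partial_sum X - L0) * psi X.+1 + iterated_sum X * (psi X.+1 - psi X.+2).
Proof.
elim: X => [|X IHX].
  by rewrite /iterated_sum !big_geq // /partial_sum big_ord1 chi0; ring.
rewrite big_nat_recr //= IHX [X in _ = _ + X + _ + _]big_nat_recr //=.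
have -> : iterated_sum X.+1 = iterated_sum X + (partial_sum X.+1 - L0) by rewrite /iterated_sum big_nat_recr.
have -> : partial_sum X.+1 = partial_sum X + (chi p X.+1)%:~R by rewrite /partial_sum big_ord_recr.
ring.
Qed.

(** The iterated sums are bounded and the second differences nonnegative, so the latter telescope
    without loss to psi(1) - psi(2) = O(1 - q); the boundary terms at X are O(q^X). *)
Lemma chi_logistic_limit : exists2 K, 0 <= K & forall q X, 0 < q -> q < 1 ->
  `|\sum_(1 <= m < X.+1) (chi p m)%:~R * logistic (q ^+ m) - L0 * logistic q|
  <= K * ((1 - q) + q ^+ X).
Proof.
have [Kw Kw0 hKw] := periodic_bounded iterated_sum_periodic.
have [Kt Kt0 hKt] : exists2 K, 0 <= K & forall m, `|partial_sum m - L0| <= K.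
  by apply: (periodic_bounded (f := fun m => partial_sum m - L0)) => m; rewrite partial_sum_periodic.
exists (Kt + Kw) => [|q X q0 q1]; first exact: addr_ge0.
pose psi m := logistic (q ^+ m).
have z01 m : 0 <= q ^+ m <= 1 by rewrite exprn_ge0 ?exprn_ile1 ?(ltW q0) ?(ltW q1).
have conv m : 0 <= psi m - 2 * psi m.+1 + psi m.+2.
  have /andP[h0 h1] := z01 m.
  by rewrite /psi !exprSr; exact: logistic_convex.
have psi_le m : 0 <= psi m <= q ^+ m.
  have /andP[h0 h1] := z01 m; rewrite /psi /logistic.
  have h2 : 0 < 1 + q ^+ m by apply: ltr_wpDr.
  by rewrite divr_ge0 ?(ltW h2) //= ler_pdivrMr // ler_peMr // lerDl.
have psi_dec m : 0 <= psi m - psi m.+1.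
  have /andP[h0 h1] := z01 m; have /andP[h2 h3] := z01 m.+1.
  have h4 : q ^+ m.+1 <= q ^+ m by rewrite ler_wiXn2l ?(ltW q0) ?(ltW q1).
  have -> : psi m - psi m.+1 = (q ^+ m - q ^+ m.+1) / ((1 + q ^+ m) * (1 + q ^+ m.+1)).
    by rewrite /psi /logistic; field; rewrite !gt_eqF //; apply: ltr_wpDr.
  by rewrite divr_ge0 ?subr_ge0 // mulr_ge0 // addr_ge0.
rewrite (chi_summation psi X).
have e1 : logistic q = psi 1%N by rewrite /psi expr1.
have cancel (x y z w : rat) : x + y + z + w - x = y + z + w by ring.
rewrite e1 cancel.
have hS : `|\sum_(1 <= m < X.+1) iterated_sum m * (psi m - 2 * psi m.+1 + psi m.+2)| <= Kw * (1 - q).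
  apply: (@le_trans _ _ (\sum_(1 <= m < X.+1) Kw * (psi m - 2 * psi m.+1 + psi m.+2))).
    apply: le_trans (ler_norm_sum _ _ _) _; apply: ler_sum => m _.
    by rewrite normrM (ger0_norm (conv m)) ler_wpM2r.
  rewrite -mulr_sumr ler_wpM2l //.
  have -> : \sum_(1 <= m < X.+1) (psi m - 2 * psi m.+1 + psi m.+2) = (psi 1%N - psi 2%N) - (psi X.+1 - psi X.+2).
    elim: X => [|X IHX]; first by rewrite big_geq // subrr.
    by rewrite big_nat_recr //= IHX; ring.
  have h1 := psi_dec X.+1.
  suff : psi 1%N - psi 2%N <= 1 - q by lra.
  rewrite /psi /logistic expr1.
  have qq : 0 < 1 + q ^+ 2 by rewrite ltr_wpDr // sqr_ge0.
  have -> : q / (1 + q) - q ^+ 2 / (1 + q ^+ 2) = (1 - q) * (q / ((1 + q) * (1 + q ^+ 2))).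
    by field; rewrite !gt_eqF //; lra.
  rewrite -[X in _ <= X]mulr1 ler_wpM2l ?subr_ge0 ?(ltW q1) //.
  rewrite ler_pdivrMr; last by rewrite mulr_gt0 //; lra.
  by rewrite mul1r; have := sqr_ge0 q; nra.
have /andP[p0 p1] := psi_le X.+1; have p2 := psi_dec X.+1; have /andP[p3 _] := psi_le X.+2.
have qX : q ^+ X.+1 <= q ^+ X by rewrite ler_wiXn2l ?(ltW q0) ?(ltW q1).
have hT : `|(partial_sum X - L0) * psi X.+1| <= Kt * q ^+ X.
  by rewrite normrM (ger0_norm p0) ler_pM // (le_trans p1).
have hW : `|iterated_sum X * (psi X.+1 - psi X.+2)| <= Kw * q ^+ X.
  rewrite normrM (ger0_norm p2) ler_pM //; lra.
have tq : 0 <= Kt * (1 - q) by rewrite mulr_ge0 // subr_ge0 ltW.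
have n3 (x y z x' y' z' : rat) : `|x| <= x' -> `|y| <= y' -> `|z| <= z' -> `|x + y + z| <= x' + y' + z'.
  by move=> h1 h2 h3; apply: le_trans (ler_normD _ _) _; apply: lerD => //; apply: le_trans (ler_normD _ _) _; exact: lerD.
apply: le_trans (n3 _ _ _ _ _ _ hS hT hW) _; lra.
Qed.

End CharacterSums.

(** * The class number formula *)

Lemma small_step (d e K : rat) : 0 < d -> 0 < e -> 0 < K ->
  exists q, [/\ 0 < q, q < 1, 1 - q < d & (1 - q) * K <= e].
Proof.
move=> d0 e0 K0; pose t := Num.min (d / 2) (Num.min (1 / 2) (e / K)).
have t0 : 0 < t by rewrite /t !lt_min !divr_gt0.
have td : t <= d / 2 by rewrite ge_min lexx.
have t1 : t <= 1 / 2 by rewrite !ge_min lexx orbT.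
have tK : t * K <= e by rewrite -ler_pdivlMr // !ge_min lexx !orbT.
move: t t0 td t1 tK => t t0 td t1 tK; exists (1 - t).
have -> : 1 - (1 - t) = t by ring.
by split=> //; lra.
Qed.

Lemma logistic_half (z : rat) : 0 <= z -> z <= 1 -> `|logistic z - 2^-1| <= (1 - z) / 2.
Proof.
move=> z0 z1; have a0 : 0 < 1 + z by lra.
have -> : logistic z - 2^-1 = - ((1 - z) / 2 / (1 + z)) by rewrite /logistic; field; rewrite gt_eqF.
rewrite normrN ger0_norm; last by rewrite !divr_ge0 ?subr_ge0 // ltW.
by rewrite ler_pdivrMr // ler_peMr ?divr_ge0 ?subr_ge0 //; lra.
Qed.

Lemma one_sub_sqr_le (q : rat) : 1 - q ^+ 2 <= 2 * (1 - q).
Proof. by have := sqr_ge0 (1 - q); lra. Qed.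

(* The error terms in the comparison of the theta and Lambert series. *)
Lemma error_budget (e H L A1 A2 l1 l2 T1 T2 M1 M2 kt kq ku lt ut t : rat) :
  `|- 3 * H + 2 * T1 - 8 * T2| <= e / 4 ->
  `|A1 - l1| <= kt + kq -> `|A2 - l2| <= 2 * kt + kq ->
  M1 - 4 * M2 = A1 + 2 * A2 ->
  `|T1 - M1| <= ut -> `|T2 - M2| <= ut ->
  `|l1 - L / 2| <= lt -> `|l2 - L / 2| <= lt ->
  10 * ut + 6 * ku <= e / 4 -> 10 * kt + 6 * lt + t <= e / 4 ->
  kq <= ku -> 0 < t -> 0 < e -> `|3 * L - 3 * H| <= e.
Proof.
rewrite !ler_norml => /andP[? ?] /andP[? ?] /andP[? ?] ? /andP[? ?] /andP[? ?] /andP[? ?] /andP[? ?].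
by move=> *; apply/andP; split; lra.
Qed.

Section ClassNumberFormula.
Variable p : nat.
Hypothesis p_pr : prime p.
Hypothesis p4 : p = 1 %[mod 4].
Variables (h : nat) (F : 'I_h -> bqform).
Hypothesis F_red : forall i, disc_form p (F i).
Hypothesis F_sur : forall g, disc_form p g -> exists i, properly_equivalent (F i) g.
Hypothesis F_inj : forall i j, properly_equivalent (F i) (F j) -> i = j.

Let c (n : nat) : rat := (theta_diff_coef p h n)%:~R.

Lemma theta_coef_le n : `|theta_coef p h n| <= (h%:Z + 2) * n.+1%:Z.
Proof.
rewrite /theta_coef; case: eqP => [->|_].
  by rewrite ger0_norm // mulr1; lia.
have := chi_sum_le p n; have : 0 <= h%:Z * n.+1%:Z by [].
by rewrite mulrDl; move: (chi_sum p n) (h%:Z * n.+1%:Z); clear; lia.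
Qed.

Lemma theta_diff_growth : poly_growth c.
Proof.
exists (5 * (h%:Z + 2))%:~R, 1%N => n; rewrite /c -intr_norm expr1.
have -> : n.+1%:R = n.+1%:Z%:~R :> rat by [].
rewrite -intrM ler_int.
have h1 := theta_coef_le n; have h2 := theta_coef_le (n %/ 4).
have h3 : (h%:Z + 2) * (n %/ 4).+1%:Z <= (h%:Z + 2) * n.+1%:Z by rewrite ler_wpM2l // lez_nat ltnS leq_div.
rewrite /theta_diff_coef -mulrA; move: h1 h2 h3; move: ((h%:Z + 2) * _) ((h%:Z + 2) * _).
by case: ifP => _; move: (theta_coef p h n) (theta_coef p h _); clear; lia.
Qed.

(** The left side is O(s^5) while [tetrahedral N] is at least of order s^6. Beyond the threshold
    [S], where K w <= eta s, the first is absorbed; below it a constant suffices. *)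
Lemma theta_diff_cesaro eta : 0 < eta ->
  exists K, forall n, `|iter 4 psum c n| <= eta * iter 4 psum delta0 n + K.
Proof.
move=> eta0; have [K hK] := theta_diff_bound p_pr p4 F_red F_sur F_inj.
have [w w0 hw] : exists2 w : rat, 0 < w & forall N s, (s * s <= 4 * N.+2)%N ->
    s%:R ^+ 6 <= w * tetrahedral N.
  by exists 512; [rewrite ltr0n|exact: tetrahedral_ge].
pose S := Num.bound (K%:R * w / eta).
exists (K%:R * S%:R ^+ 5) => N; have [s [s0 h1 h2]] := sqrt_approx N.
have := hK s N.+2 s0 h1; rewrite -(ler_int rat) intr_norm -iter_psum4_cubic -/c => hN.
have K0 : (0 : rat) <= K%:R by exact: ler0n.
have {}hN : `|iter 4 psum c N| <= K%:R * s%:R ^+ 5.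
  have : `|iter 4 psum c N| <= `|6 * iter 4 psum c N|.
    rewrite normrM [X in X * _]ger0_norm //; move: (`|iter 4 psum c N|) (normr_ge0 (iter 4 psum c N)) => x; lra.
  by move/le_trans; apply; move: hN; rewrite rmorphM rmorphXn.
apply: le_trans hN _; rewrite iter_psum4_delta0.
have t6 := hw _ _ h2.
have t0 : 0 <= tetrahedral N.
  by rewrite -(pmulr_rge0 _ w0); apply: le_trans t6; rewrite exprn_ge0.
have et0 : 0 <= eta * tetrahedral N by rewrite mulr_ge0 // ltW.
have [sS|sS] := leqP s S.
  have h5 : (s%:R : rat) ^+ 5 <= S%:R ^+ 5 by apply: lerXn2r; rewrite ?nnegrE ?ler0n // ler_nat.
  by apply: le_trans (ler_wpM2l K0 h5) _; rewrite lerDr.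
have hS : K%:R * w <= eta * s%:R.
  rewrite [eta * _]mulrC -(ler_pdivrMr _ _ eta0).
  have := archi_boundP (divr_ge0 (mulr_ge0 K0 (ltW w0)) (ltW eta0)).
  by move/ltW/le_trans; apply; rewrite ler_nat ltnW.
have s5 : (0 : rat) <= s%:R ^+ 5 by rewrite exprn_ge0.
have h3 : w * (K%:R * s%:R ^+ 5) <= w * (eta * tetrahedral N).
  rewrite [w * (eta * _)]mulrCA; apply: le_trans (ler_wpM2l (ltW eta0) t6).
  by rewrite exprS [eta * _]mulrA mulrCA mulrA; apply: ler_wpM2r.
rewrite ler_pM2l // in h3; apply: le_trans h3 _.
by rewrite lerDl mulr_ge0 ?exprn_ge0.
Qed.

Lemma theta_diff_generating q Y : 
  \sum_(n < (4 * Y).+1) c n * q ^+ n =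
  - 3 * h%:R + 2 * theta_part p q (4 * Y) - 8 * theta_part p (q ^+ 4) Y.
Proof.
have part X z : \sum_(n < X.+1) (theta_coef p h n)%:~R * z ^+ n = h%:R + 2 * theta_part p z X.
  rewrite big_ord_recl /= expr0 mulr1 -pmulrn; congr (_ + _).
  rewrite /theta_part mulr_sumr big_add1 /= big_mkord; apply: eq_bigr => i _.
  by rewrite /bump /= add1n rmorphM /= mulrA.
have quarter : \sum_(n < (4 * Y).+1) (if (4 %| n)%N then (theta_coef p h (n %/ 4))%:~R else 0) * q ^+ n =
    \sum_(n < Y.+1) (theta_coef p h n)%:~R * (q ^+ 4) ^+ n.
  rewrite -(big_mkord xpredT (fun n => (if (4 %| n)%N then (theta_coef p h (n %/ 4))%:~R else 0) * q ^+ n)).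
  rewrite -(big_mkord xpredT (fun n => (theta_coef p h n)%:~R * (q ^+ 4) ^+ n)).
  elim: Y => [|Y IHY]; first by rewrite !big_nat1.
  rewrite [RHS]big_nat_recr //= -IHY (_ : (4 * Y.+1).+1 = (4 * Y).+4.+1)%N; last by rewrite mulnS.
  rewrite 4?big_nat_recr //=.
  have d (k : nat) : (4 %| 4 * Y + k)%N = (4 %| k)%N by rewrite dvdn_addr // dvdn_mulr.
  have := d 1%N; have := d 2%N; have := d 3%N; have := d 4%N.
  rewrite addn1 addn2 addn3 addn4 => -> -> -> -> /=.
  rewrite !mul0r !addr0 (_ : (4 * Y).+4 = 4 * Y.+1)%N; last by rewrite mulnS.
  by rewrite mulKn // exprM.
transitivity (\sum_(n < (4 * Y).+1) (theta_coef p h n)%:~R * q ^+ n - 4 *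
   \sum_(n < (4 * Y).+1) (if (4 %| n)%N then (theta_coef p h (n %/ 4))%:~R else 0) * q ^+ n).
  rewrite mulr_sumr -sumrB; apply: eq_bigr => n _; rewrite /c /theta_diff_coef.
  by case: (4 %| n)%N; rewrite rmorphB /= ?rmorphM /=; ring.
by rewrite quarter !part; ring.
Qed.

(** Termwise, z/(1-z) - 4z^4/(1-z^4) = z/(1+z) + 2z^2/(1+z^2): the factor 4 removes the pole at z =
    1. *)
Lemma lambert_logistic q X : 0 < q -> q < 1 ->
  lambert p q X - 4 * lambert p (q ^+ 4) X =
  \sum_(1 <= m < X.+1) (chi p m)%:~R * logistic (q ^+ m) +
  2 * \sum_(1 <= m < X.+1) (chi p m)%:~R * logistic ((q ^+ 2) ^+ m).
Proof.
move=> q0 q1; rewrite /lambert !mulr_sumr -sumrB -big_split /= !big_nat; apply: eq_bigr => m /andP[m0 _].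
rewrite -!exprM [(4 * m)%N]mulnC [(2 * m)%N]mulnC !exprM /logistic.
have z0 : 0 < q ^+ m by rewrite exprn_gt0.
have z1 : q ^+ m < 1 by rewrite exprn_ilt1 ?(ltW q0) // -lt0n.
move: (q ^+ m) z0 z1 => z z0 z1.
have h1 : 1 - z != 0 by rewrite subr_eq0 gt_eqF.
have h2 : 1 + z != 0 by rewrite gt_eqF //; lra.
have h3 : 1 + z ^+ 2 != 0 by rewrite gt_eqF // ltr_wpDr // sqr_ge0.
have -> : 1 - z ^+ 4 = (1 - z) * (1 + z) * (1 + z ^+ 2) by ring.
by field; rewrite h1 h2 h3.
Qed.

Lemma class_number_L0 : h%:R = L0 p.
Proof.
have [Kc Kc0 hKc] := chi_logistic_limit p_pr p4.
suff key eps : 0 < eps -> `|3 * L0 p - 3 * h%:R| <= eps.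
  apply/eqP; rewrite eq_sym -subr_eq0 -normr_le0.
  apply/ler_addgt0Pl => e e0; rewrite addr0; have e3 : 0 < 3 * e by lra.
  have := key _ e3; rewrite -mulrBr normrM [ `|3|]ger0_norm //; lra.
move=> e0; have e4 : 0 < eps / 4 by lra.
have [d d0 hd] := cesaro_abel theta_diff_growth theta_diff_cesaro e4.
(* First q is fixed close to 1, then Y is taken large in terms of q. The coefficients 10 and 6 are
   those of [error_budget]. *)
pose K := 10 * Kc + 6 * `|L0 p| + 1.
have L00 := normr_ge0 (L0 p).
have K0 : 0 < K by rewrite /K; lra.
have [q [q0 q1 qd tK]] := small_step d0 e4 K0.
have [t tq] : exists t, 1 - q = t by exists (1 - q).
have t0 : 0 < t by rewrite -tq subr_gt0.
rewrite tq in tK.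
have [X0 hX0] := hd q q0 q1 qd.
have qn := tends0_exp 1 q0 q1.
have M0 : 0 < 10 / t + 6 * Kc by apply: ltr_wpDr; [exact: mulr_ge0|exact: divr_gt0].
have e5 : 0 < eps / 4 / (10 / t + 6 * Kc) by rewrite divr_gt0.
have [X1 hX1] := qn _ e5.
have [Y [hY0 hY1]] : exists Y, (X0 <= (4 * Y).+1)%N /\ (X1 <= 4 * Y)%N.
  by exists (X0 + X1)%N; clear; lia.
have h1 := hX0 _ hY0; rewrite theta_diff_generating in h1.
have XY : (Y <= 4 * Y)%N by rewrite leq_pmull.
have X4 : (4 * Y)%N = (4 * Y)%N by [].
(* X stands for 4Y. The theta sum in q^4 stops at Y, but both Lambert sums are cut at X so that
   [lambert_logistic] applies. *)
move: {-2}(4 * Y)%N X4 XY hY1 h1 => X X4 XY hY1 h1.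
have qX0 : 0 <= q ^+ X by rewrite exprn_ge0 // ltW.
have h2 : X.+1%:R * q ^+ X * (10 / t + 6 * Kc) <= eps / 4.
  rewrite -ler_pdivlMr //; have := hX1 X hY1.
  by rewrite expr1; apply: le_trans; exact: ler_norm.
have q40 : 0 < q ^+ 4 by rewrite exprn_gt0.
have q41 : q ^+ 4 < 1 by rewrite exprn_ilt1 // ltW.
have q20 : 0 < q ^+ 2 by rewrite exprn_gt0.
have q21 : q ^+ 2 < 1 by rewrite exprn_ilt1 // ltW.
have h3 := theta_lambert p q0 q1 (leqnn X).
have h4 := theta_lambert p q40 q41 XY.
have h5 := hKc q X q0 q1.
have h6 := hKc (q ^+ 2) X q20 q21.
have h7 := lambert_logistic X q0 q1.
have tail (q' : rat) : 0 < q' -> q' <= q -> q' ^+ Y <= q ^+ X -> X%:R * (q' ^+ Y / (1 - q')) <= X.+1%:R * q ^+ X / t.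
  move=> q'0 q'q hq'; rewrite mulrA; apply: ler_pM.
  - by rewrite mulr_ge0 // exprn_ge0 // ltW.
  - by rewrite invr_ge0 subr_ge0 (le_trans q'q) // ltW.
  - by apply: ler_pM; rewrite ?exprn_ge0 ?(ltW q'0) // ler_nat.
  - by rewrite -tq lef_pV2 ?posrE ?subr_gt0 ?(le_lt_trans q'q) // lerB.
have t4 : `|theta_part p (q ^+ 4) Y - lambert p (q ^+ 4) X| <= X.+1%:R * q ^+ X / t.
  apply: le_trans h4 _; apply: tail => //; last by rewrite -exprM X4.
  by rewrite -[X in _ <= X]expr1 ler_wiXn2l // ltW.
have t3 : `|theta_part p q X - lambert p q X| <= X.+1%:R * q ^+ X / t.
  apply: le_trans h3 _; rewrite tq mulrA ler_wpM2r ?invr_ge0 ?(ltW t0) //.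
  by rewrite ler_wpM2r // ler_nat.
have XX : q ^+ X <= X.+1%:R * q ^+ X by rewrite ler_peMl // ler1n.
have q2X : (q ^+ 2) ^+ X <= q ^+ X.
  by rewrite -exprM ler_wiXn2l ?(ltW q0) ?(ltW q1) // leq_pmull.
have q2t : 1 - q ^+ 2 <= 2 * t by rewrite -tq one_sub_sqr_le.
have l1 : `|L0 p * logistic q - L0 p / 2| <= `|L0 p| * t.
  rewrite -mulrBr normrM ler_wpM2l //; apply: le_trans (logistic_half (ltW q0) (ltW q1)) _.
  by rewrite tq ler_pdivrMr // ler_peMr ?(ltW t0) // ler1n.
have l2 : `|L0 p * logistic (q ^+ 2) - L0 p / 2| <= `|L0 p| * t.
  rewrite -mulrBr normrM ler_wpM2l //; apply: le_trans (logistic_half (ltW q20) (ltW q21)) _.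
  by rewrite ler_pdivrMr // mulrC.
have KQ : Kc * q ^+ X <= Kc * (X.+1%:R * q ^+ X) by rewrite ler_wpM2l.
rewrite mulrDr tq in h5.
have {}h6 : `|\sum_(1 <= m < X.+1) (chi p m)%:~R * logistic ((q ^+ 2) ^+ m) - L0 p * logistic (q ^+ 2)|
    <= 2 * (Kc * t) + Kc * q ^+ X.
  by apply: le_trans h6 _; rewrite mulrDr lerD ?[2 * (_ * _)]mulrCA ?ler_wpM2l.
apply: (error_budget h1 h5 h6 h7 t3 t4 l1 l2 _ _ KQ t0 e0).
  by move: h2; rewrite mulrDr [_ * (10 / t)]mulrCA [_ * (6 * Kc)]mulrCA [_ * Kc]mulrC.
have tKE (x y : rat) : t * (10 * x + 6 * y + 1) = 10 * (x * t) + 6 * (y * t) + t by ring.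
by rewrite -tKE.
Qed.

End ClassNumberFormula.

(** * The congruence for U *)

Lemma sum_even_terms (f : nat -> int) m :
  \sum_(i < m.+1) (~~ odd i)%:Z * f i = \sum_(k < (m %/ 2).+1) f (2 * k)%N.
Proof.
rewrite divn2 -(big_mkord xpredT (fun i => (~~ odd i)%:Z * f i)) -(big_mkord xpredT (fun k => f (2 * k)%N)).
elim: m => [|m IHm]; first by rewrite !big_nat1 mul1r.
rewrite big_nat_recr //= IHm uphalf_half negbK.
case e: (odd m) => /=; last by rewrite add0n mul0r addr0.
rewrite add1n mul1r [RHS]big_nat_recr //= (_ : 2 * (m./2).+1 = m.+1)%N //.
by have := odd_double_half m; rewrite e; lia.
Qed.

(** Coefficient form of (e^t + e^(-t) - 1) G(t) = 1, where G is the exponential generating function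
    of [U]. *)
Lemma U_recurrence m : \sum_(i < m.+1) (1 + (-1) ^+ i) * ('C(m, i)%:Z * U (m - i)) - U m = (m == 0%N)%:Z.
Proof.
have -> : \sum_(i < m.+1) (1 + (-1) ^+ i) * ('C(m, i)%:Z * U (m - i)) =
    2 * \sum_(i < m.+1) (~~ odd i)%:Z * ('C(m, i)%:Z * U (m - i)).
  rewrite mulr_sumr; apply: eq_bigr => i _; rewrite mulrA -signr_odd.
  by case: (odd i); rewrite /= ?subrr ?mulr0 ?mul0r.
rewrite (sum_even_terms (fun i => 'C(m, i)%:Z * U (m - i))) big_ord_recl /= muln0 bin0 mul1r subn0.
case: m => [|m]; first by rewrite div0n big_ord0 U0.
rewrite [in X in _ - X]U_rec // big_add1 /= big_mkord.
have -> : \sum_(i < m.+1 %/ 2) 'C(m.+1, 2 * bump 0 i)%:Z * U (m.+1 - 2 * bump 0 i) =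
  \sum_(i < m.+1 %/ 2) 'C(m.+1, 2 * i.+1)%:Z * U (m.+1 - 2 * i.+1) by [].
have := @U_rec m.+1 isT; rewrite big_add1 /= big_mkord.
by move: (\sum_(i < _) _) (U m.+1) => x y; lia.
Qed.

Section Umbral.
Variable n : nat.

(* The umbral functional [X^k -> U k], on polynomials of degree at most [n]. *)
Definition umbral (P : {poly int}) : int := \sum_(i < n.+1) P`_i * U i.

Lemma umbralD P Q : umbral (P + Q) = umbral P + umbral Q.
Proof. by rewrite /umbral -big_split; apply: eq_bigr => i _; rewrite coefD mulrDl. Qed.

Lemma umbralZ a P : umbral (a *: P) = a * umbral P.
Proof. by rewrite /umbral mulr_sumr; apply: eq_bigr => i _; rewrite coefZ mulrA. Qed.

Lemma umbral_sum (I : Type) (r : seq I) (F : I -> {poly int}) :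
  umbral (\sum_(i <- r) F i) = \sum_(i <- r) umbral (F i).
Proof.
elim: r => [|x r IHr]; last by rewrite !big_cons umbralD IHr.
by rewrite !big_nil /umbral big1 // => i _; rewrite coef0 mul0r.
Qed.

Lemma umbralXn m : (m <= n)%N -> umbral 'X^m = U m.
Proof.
rewrite -ltnS => mn; rewrite /umbral (bigD1 (Ordinal mn)) //= coefXn eqxx mul1r big1 ?addr0 // => i im.
by rewrite coefXn (_ : (nat_of_ord i == m) = false) ?mul0r //; apply/negbTE.
Qed.

Lemma exprD_scale (P : {poly int}) (y : int) m :
  (P + y%:P) ^+ m = \sum_(i < m.+1) ('C(m, i)%:Z * y ^+ i) *: P ^+ (m - i).
Proof.
rewrite exprDn; apply: eq_bigr => i _.
rewrite -polyC_exp mulrC mul_polyC -scaler_nat scalerA natz //.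
Qed.

Lemma umbral_binomial y m : (m <= n)%N ->
  umbral (('X + y%:P) ^+ m) = \sum_(i < m.+1) y ^+ i * ('C(m, i)%:Z * U (m - i)).
Proof.
move=> mn; rewrite exprD_scale umbral_sum; apply: eq_bigr => i _.
by rewrite umbralZ umbralXn ?(leq_trans (leq_subr _ _)) //; ring.
Qed.

Lemma umbral_shift m : (m <= n)%N ->
  umbral (('X + 1%:P) ^+ m) + umbral (('X + (-1)%:P) ^+ m) - umbral ('X ^+ m) = (m == 0%N)%:Z.
Proof.
move=> mn; rewrite !umbral_binomial // umbralXn // -(U_recurrence m) -big_split /=.
by congr (_ - _); apply: eq_bigr => i _; rewrite expr1n mulrDl.
Qed.

Definition U_poly (c : int) : int := umbral (('X + c%:P) ^+ n).

Lemma U_polyE c : U_poly c = \sum_(i < n.+1) c ^+ i * ('C(n, i)%:Z * U (n - i)).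
Proof. exact: umbral_binomial. Qed.

Lemma U_poly0 : U_poly 0 = U n.
Proof. by rewrite /U_poly addr0 umbralXn. Qed.

Lemma U_poly_shift c : U_poly (c + 1) + U_poly (c - 1) - U_poly c = c ^+ n.
Proof.
have shift y : U_poly (c + y) = \sum_(i < n.+1) ('C(n, i)%:Z * c ^+ i) * umbral (('X + y%:P) ^+ (n - i)).
  rewrite /U_poly polyCD [c%:P + _]addrC addrA exprD_scale umbral_sum.
  by apply: eq_bigr => i _; rewrite umbralZ.
rewrite (shift 1) (shift (-1)) -[in X in _ - X](addr0 c) (shift 0) -big_split -sumrB /=.
rewrite big_ord_recr /= subnn binn mul1r big1 => [|i _].
  by rewrite add0r -mulrDr -mulrBr addr0 (@umbral_shift 0) // mulr1.
rewrite -mulrDr -mulrBr addr0 umbral_shift ?leq_subr //.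
by rewrite subn_eq0 leqNgt ltn_ord mulr0.
Qed.

(** In terms of the shift T, (T^2 - T + 1)(T + 1) = T^3 + 1: two instances of the three-term
    relation add up to a two-term one, which can telescope. *)
Lemma U_poly_shift3 c : U_poly (c + 3) + U_poly c = (c + 1) ^+ n + (c + 2) ^+ n.
Proof.
have h1 := U_poly_shift (c + 1); have h2 := U_poly_shift (c + 2).
have e1 : c + 1 + 1 = c + 2 by ring.
have e2 : c + 1 - 1 = c by ring.
have e3 : c + 2 + 1 = c + 3 by ring.
have e4 : c + 2 - 1 = c + 1 by ring.
by rewrite e1 e2 in h1; rewrite e3 e4 in h2; rewrite -h1 -h2; ring.
Qed.

Lemma U_poly_telescope M :
  \sum_(j < M) (-1) ^+ j * ((3 * j + 1)%N%:Z ^+ n + (3 * j + 2)%N%:Z ^+ n) =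
  U n - (-1) ^+ M * U_poly (3 * M)%N%:Z.
Proof.
elim: M => [|M IHM]; first by rewrite big_ord0 muln0 U_poly0 expr0 mul1r subrr.
have := U_poly_shift3 (3 * M)%N%:Z; rewrite -!PoszD -mulnSr => h.
by rewrite big_ord_recr /= IHM -h exprS; ring.
Qed.

End Umbral.

(** * The alternating character sum and reduction modulo p *)

Section Congruence.
Variable p : nat.
Hypothesis p_pr : prime p.
Hypothesis p4 : p = 1 %[mod 4].
Let D := (3 * p)%N.
Let E := D./2.
Let DE : D = (2 * E).+1. Proof. have := p4; rewrite /E /D; lia. Qed.

Lemma sum_blocks3 (f : nat -> int) M :
  \sum_(m < 3 * M) f m = \sum_(j < M) (f (3 * j)%N + f (3 * j + 1)%N + f (3 * j + 2)%N).
Proof.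
elim: M => [|M IHM]; first by rewrite muln0 !big_ord0.
rewrite [RHS]big_ord_recr /= -IHM (_ : 3 * M.+1 = (3 * M).+3)%N; last by rewrite mulnS.
by rewrite 3!big_ord_recr /= addn1 addn2 !addrA.
Qed.

Lemma sum_pairs (f : nat -> int) e : f 0%N = 0 ->
  \sum_(m < (2 * e).+1) f m = \sum_(1 <= j < e.+1) (f j + f ((2 * e).+1 - j)%N).
Proof.
move=> f0; rewrite -(big_mkord xpredT f) (@big_cat_nat _ _ _ e.+1) //=; last by lia.
rewrite big_ltn // f0 add0r big_split /=; congr (_ + _).
rewrite big_nat_rev /= -{1}[e.+1]add1n big_addn (_ : (2 * e).+1 - e = e.+1)%N; last by lia.
by rewrite !big_nat; apply: eq_bigr => j /andP[j1 je]; congr f; lia.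
Qed.

(** For odd modulus 2e+1 every nonzero residue is either even, 2j, or the complement of an even
    one. *)
Lemma sum_even_pairs (f : nat -> int) e : f 0%N = 0 ->
  \sum_(m < (2 * e).+1) f m = \sum_(1 <= j < e.+1) (f (2 * j)%N + f ((2 * e).+1 - 2 * j)%N).
Proof.
move=> f0; rewrite big_split /= [X in _ + X]big_nat_rev /=.
have -> : \sum_(1 <= i < e.+1) f ((2 * e).+1 - 2 * (1 + e.+1 - i.+1))%N = \sum_(0 <= i < e) f (2 * i).+1%N.
  by rewrite big_add1 /= !big_nat; apply: eq_bigr => i /andP[_ ie]; congr f; lia.
rewrite -(big_mkord xpredT f) big_add1 /=.
elim: e => [|e IHe]; first by rewrite muln0 big_nat1 !big_geq // f0.
rewrite (_ : 2 * e.+1 = (2 * e).+2)%N; last by lia.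
rewrite big_nat_recr //= big_nat_recr //= IHe [X in _ = X + _]big_nat_recr // [X in _ = _ + X]big_nat_recr //=.
rewrite (_ : 2 * e.+1 = (2 * e).+2)%N; last by lia.
ring.
Qed.

Definition alternating_chi_sum : int := \sum_(m < D) (-1) ^+ m.+1 * chi p m.

(** Pairing m with D - m, and then pairing the even residues, evaluates B in two ways; the second
    pairing also turns the alternating sum into -2 chi(2) H. Eliminating J gives DH = (chi(2) - 2)B,
    hence 2 - 4 chi(2) as the factor of h. *)
Lemma alternating_chi_sumE (h : nat) : h%:R = L0 p ->
  alternating_chi_sum = 2 * (1 + 2 * (-1) ^+ ((p - 1) %/ 4)) * h%:Z.
Proof.
move=> hL; set B : int := \sum_(m < D) m%:Z * chi p m.
have D0 : D%:Z != 0 by rewrite DE.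
have hB : D%:Z * h%:Z = - B.
  apply: (intr_inj (R := rat)); rewrite intrM /= -!pmulrn hL /L0 mulrC divfK; last by rewrite pnatr_eq0 -/D DE.
  by rewrite rmorphN rmorph_sum /=; congr (- _); apply: eq_bigr => m _; rewrite intrM.
have copp j : (j <= D)%N -> chi p (D - j) = - chi p j := @chi_opp p p_pr p4 j.
pose J : int := \sum_(1 <= j < E.+1) j%:Z * chi p j.
pose H : int := \sum_(1 <= j < E.+1) chi p j.
have B1 : B = 2 * J - D%:Z * H.
  rewrite /B DE (@sum_pairs (fun m => m%:Z * chi p m)) ?mul0r // -DE /J /H !mulr_sumr -sumrB !big_nat.
  apply: eq_bigr => j /andP[j1 jE]; have jD : (j <= D)%N by rewrite DE; lia.
  by rewrite copp // -subzn //; ring.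
have B2 : B = chi p 2 * (4 * J - D%:Z * H).
  rewrite /B DE (@sum_even_pairs (fun m => m%:Z * chi p m)) ?mul0r // -DE /J /H !mulr_sumr -sumrB mulr_sumr !big_nat.
  apply: eq_bigr => j /andP[j1 jE]; have jD : (2 * j <= D)%N by rewrite DE; lia.
  by rewrite copp // -subzn // chiM // PoszM; ring.
have A1 : alternating_chi_sum = - 2 * chi p 2 * H.
  rewrite /alternating_chi_sum DE (@sum_even_pairs (fun m => (-1) ^+ m.+1 * chi p m)).
    rewrite -DE /H mulr_sumr !big_nat; apply: eq_bigr => j /andP[j1 jE].
    have jD : (2 * j <= D)%N by rewrite DE; lia.
    rewrite copp // chiM // -!(signr_odd _ _.+1) /= oddB // oddM DE /= oddM /=.
    by rewrite expr1 expr0; ring.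
  by rewrite chi0 mulr0.
have c2 : chi p 2 ^+ 2 = 1 by rewrite chi_2 // sqrrN sqrr_sign.
have DH : D%:Z * H = (chi p 2 - 2) * B.
  have : chi p 2 * B = 4 * J - D%:Z * H by rewrite B2 mulrA -expr2 c2 mul1r.
  by move=> e; rewrite mulrBl e B1; ring.
apply: (mulfI D0); rewrite A1.
have -> : D%:Z * (-2 * chi p 2 * H) = -2 * chi p 2 * (D%:Z * H) by ring.
rewrite DH.
have -> : -2 * chi p 2 * ((chi p 2 - 2) * B) = (2 * chi p 2 ^+ 2 - 4 * chi p 2) * - B by ring.
by rewrite -hB c2 chi_2 //; ring.
Qed.

Lemma U_congruence : ((2 * U ((p - 1) %/ 2))%:~R : 'F_p) = alternating_chi_sum%:~R.
Proof.
set n := ((p - 1) %/ 2)%N.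
have hn m : (m%:R : 'F_p) ^+ n = (qchar (m%:R : 'F_p))%:~R.
  by rewrite (intr_qcharp p_pr p4) /n divn2.
have tel := U_poly_telescope n p.
have podd : odd p := p_odd p_pr p4.
(* Modulo p the end point 3p is 0, and the sign (-1)^p = -1 makes the two boundary values add up to
   2 U_n. *)
have pp : (U_poly n (3 * p)%N%:Z)%:~R = (U n)%:~R :> 'F_p.
  rewrite -(U_poly0 n) !U_polyE !rmorph_sum /=; apply: eq_bigr => i _.
  rewrite !rmorphM !rmorphXn /= -pmulrn; congr (_ ^+ _ * _).
  by rewrite natrM (pchar_Fp_0 p_pr) mulr0.
have -> : (2 * U n)%:~R = (U n - (-1) ^+ p * U_poly n (3 * p)%N%:Z)%:~R :> 'F_p.
  rewrite -signr_odd podd expr1 mulN1r opprK intrD pp -intrD; congr _%:~R; ring.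
rewrite -tel /alternating_chi_sum /D (sum_blocks3 (fun m => (-1) ^+ m.+1 * chi p m)) !rmorph_sum /=; apply: eq_bigr => j _.
(* On a block 3j, 3j+1, 3j+2 the symbol modulo 3 is 0, 1, -1; the last sign cancels the alternation
   inside the block, leaving the common sign (-1)^j of the telescoped sum. *)
have c30 : chi p (3 * j) = 0 by apply/eqP; rewrite chi_eq0 // dvdn_mulr.
have q3 k : qchar ((3 * j + k)%:R : 'F_3) = qchar (k%:R : 'F_3).
  by rewrite natrD natrM (pchar_Fp_0 (isT : prime 3)) mul0r add0r.
have c31 : chi p (3 * j + 1) = qchar ((3 * j + 1)%:R : 'F_p).
  by rewrite /chi q3 qchar1 mul1r.
have c32 : chi p (3 * j + 2) = - qchar ((3 * j + 2)%:R : 'F_p).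
  by rewrite /chi q3 (_ : qchar (2%:R : 'F_3) = -1) ?mulN1r // /qchar card_Fp.
rewrite c30 c31 c32 mulr0 add0r.
have s1 : (-1) ^+ (3 * j + 1).+1 = (-1) ^+ j :> int.
  by rewrite -signr_odd -[RHS]signr_odd /= oddD oddM /= addbT negbK.
have s2 : (-1) ^+ (3 * j + 2).+1 = - (-1) ^+ j :> int.
  by rewrite -signr_odd -[in RHS]signr_odd /= oddD oddM /= addbF; case: (odd j).
rewrite s1 s2 mulrNN -mulrDr !intrM; congr (_ * _).
by rewrite !intrD -!hn !rmorphXn.
Qed.

End Congruence.

Theorem theorem3p1 (p : nat) (p_prime : prime p) (p_mod4 : p = 1 %[mod 4]) :
  (U ((p - 1) %/ 2)
     = (1 + 2 * (-1) ^+ ((p - 1) %/ 4)) * (class_number (- 3 * p%:Z))%:Z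
     %[mod p%:Z])%Z.
Proof.
have [F [F_red F_sur F_inj]] := class_representatives p_prime p_mod4.
have hL := class_number_L0 p_prime p_mod4 F_red F_sur F_inj.
apply/eqP; rewrite eqz_mod_dvd (dvdz_pcharf (pchar_Fp p_prime)) rmorphB /= subr_eq0; apply/eqP.
have two := Fp_two_neq0 p_prime (p_odd p_prime p_mod4).
(* Both evaluations concern 2 U_n, and 2 is cancelled in the field of p elements. *)
apply: (mulfI two); rewrite -[2%:R]/(2%:~R) -!intrM U_congruence // (alternating_chi_sumE _ _ hL) //.
by rewrite mulrA.
Qed.
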